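(* Let $\chi\in(0,1]$. There is an open and dense subset $\mathcal{U}$ of $\mathcal{E}^{1,\chi}(\mathbb{T})$ (with the $C^{1,\chi}$ topology) such that every $T\in\mathcal{U}$ has a unique Lyapunov minimizing measure, and this measure is supported on a periodic orbit of $T$.
   Context: $\mathbb{T}=\mathbb{R}/\mathbb{Z}$ is the circle with its standard metric $d$. A $C^1$ map $T:\mathbb{T}\to\mathbb{T}$ is expanding if there are $C>0$ and $\lambda>1$ with $|DT^n(x)|\ge C\lambda^n$ for all $x\in\mathbb{T}$, $n\ge1$. For $\chi\in(0,1]$, $\mathcal{E}^{1,\chi}(\mathbb{T})$ is the space of $C^1$ expanding self-maps of $\mathbb{T}$ whose derivative is $\chi$-Hölder, with the distance $d_{C^{1,\chi}}(S,T)=d_{C^0}(S,T)+d_{C^0}(DS,DT)+\sup_{x\neq y}\frac{|(DS-DT)(x)-(DS-DT)(y)|}{d(x,y)^{\chi}}$. For a $T$-invariant Borel probability measure $\mu$, $\lambda_T(\mu)=\int\log|DT|\,d\mu$; $\alpha(T)$ is the infimum of $\lambda_T(\nu)$ over all $T$-invariant Borel probability measures $\nu$, and $\mu$ is a Lyapunov minimizing measure if $\lambda_T(\mu)=\alpha(T)$. *)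

(* Defs.v *)
(* The circle T = R/Z is represented through lifts:
   a continuous self-map of R/Z is given by a lift F : R -> R with
   F (x + 1) = F x + deg for some integer deg.  Measures on T are Borel
   probability measures on R giving full mass to [0,1) (a fundamental domain). *)
From HB Require Import structures.
From mathcomp Require Import all_boot all_order all_algebra.
From mathcomp Require Import all_classical all_reals all_analysis.
Set Implicit Arguments. Unset Strict Implicit. Unset Printing Implicit Defensive.
Import Order.TTheory GRing.Theory Num.Theory.
Import numFieldNormedType.Exports.
Local Open Scope classical_set_scope.
Local Open Scope ring_scope.

Section Circle.
Variable R : realType.

Definition frac (x : R) : R := x - (Num.floor x)%:~R.

Definition circ_dist (x y : R) : R :=
  Num.min (frac (x - y)) (1 - frac (x - y)).

Definition is_lift (F : R -> R) : Prop :=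
  exists deg : int, forall x, F (x + 1) = F x + deg%:~R.

Definition C1 (F : R -> R) : Prop :=
  (forall x, derivable F x 1) /\ continuous ((derive1 F)).

Definition holder_deriv (chi : R) (F : R -> R) : Prop :=
  exists K : R, forall x y,
    `| (derive1 F) x - (derive1 F) y | <= K * (circ_dist x y `^ chi).

(* expanding: |D T^n (x)| >= C lambda^n ; the lift of T^n is iter n F *)
Definition expanding (F : R -> R) : Prop :=
  exists C lam : R, 0 < C /\ 1 < lam /\
    forall n : nat, (1 <= n)%N -> forall x,
      C * lam ^+ n <= `| derive1 (iter n F) x |.

Definition E1chi (chi : R) : set (R -> R) :=
  [set F | is_lift F /\ C1 F /\ holder_deriv chi F /\ expanding F].

Definition dC1chi (chi : R) (S T : R -> R) : \bar R :=
  (ereal_sup [set (circ_dist (S x) (T x))%:E | x in [set: R]] +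
   ereal_sup [set (`| (derive1 S) x - (derive1 T) x |)%:E | x in [set: R]] +
   ereal_sup [set (`| ((derive1 S) xy.1 - (derive1 T) xy.1) - ((derive1 S) xy.2 - (derive1 T) xy.2) |
                   / (circ_dist xy.1 xy.2 `^ chi))%:E
             | xy in [set xy : R * R | circ_dist xy.1 xy.2 != 0%R]])%E.

Definition C1chi_open (chi : R) (U : set (R -> R)) : Prop :=
  forall F, U F -> exists2 eps : R, 0 < eps &
    forall G, E1chi chi G -> (dC1chi chi G F < eps%:E)%E -> U G.

Definition C1chi_dense (chi : R) (U : set (R -> R)) : Prop :=
  forall F, E1chi chi F -> forall eps : R, 0 < eps ->
    exists G, U G /\ (dC1chi chi G F < eps%:E)%E.

Definition tmap (F : R -> R) (x : R) : R := frac (F x).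

Definition invariant (F : R -> R) (P : probability R R) : Prop :=
  P [set` `[0%R, 1%R[] = 1%E /\
  forall A : set R, measurable A -> P (tmap F @^-1` A) = P A.

Definition lyap (F : R -> R) (P : probability R R) : \bar R :=
  (\int[P]_x (ln `| (derive1 F) x |)%:E)%E.

Definition alpha (F : R -> R) : \bar R :=
  ereal_inf [set lyap F P | P in [set P | invariant F P]].

Definition lyap_minimizing (F : R -> R) (P : probability R R) : Prop :=
  invariant F P /\ lyap F P = alpha F.

Definition supported_on_periodic_orbit (F : R -> R) (P : probability R R) : Prop :=
  exists (x : R) (p : nat), (0 < p)%N /\ iter p (tmap F) x = x /\
    P [set iter k (tmap F) x | k in [set k : nat | (k < p)%N]] = 1%E.

End Circle.

(* Main.v *)
(** Let [phi = ln |F'|], let [alpha] be the infimum of its averages over periodic orbits,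
    and let [u] be a Hölder sub-action, so that [f = phi - alpha + u - u o F >= 0].
    Counting words along an orbit on which [f] is small gives periodic orbits whose period
    [p] is so short that [p^A * sum f] is as small as one wishes, for any exponent [A].
    Halving the period at each close return then leads to a periodic orbit with
    [sum f <= kappa * r^chi] whose points are at distance at least [4 r] from each other.
    A bump of radius [r] which is small in the [C^(1,chi)] topology fixes this orbit and
    lowers its exponent by about [eps * r^chi], while it changes [u o F] only by
    [O(r^(chi + chi^2))]. For every map [G] close to the perturbed one, an orbit that
    leaves the continuation of the periodic orbit has to spend some time at distance of
    order [r] from it, and there it loses more than it could gain while shadowing it.
    Hence the Birkhoff sums of [ln |G'|] minus the exponent of the periodic orbit are
    bounded below, with an extra cost for each visit far from that orbit, and integrating
    this bound shows that the measure on the periodic orbit is the only minimizing one. *)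

From HB Require Import structures.
From mathcomp Require Import all_boot all_order all_algebra.
From mathcomp Require Import all_classical all_reals all_analysis.
From mathcomp Require Import ring lra zify.
Set Implicit Arguments. Unset Strict Implicit. Unset Printing Implicit Defensive.
From mathcomp Require Import measurable_realfun.
Require Import Defs.
Import Order.TTheory GRing.Theory Num.Theory.
Import numFieldNormedType.Exports.
Local Open Scope classical_set_scope.
Local Open Scope ring_scope.

(** * The circle and Hölder functions *)


(** A bump at scale [r] with small Hölder seminorm can lower the exponent of an orbit only by a
    small multiple of [r ^ chi]. So the action of the orbit has to be small against the power [chi]
    of its own gap, with a ratio [kappa] that is fixed before the orbit is known; a small action
    alone does not ensure that. One halving of the period multiplies the action by at most a
    constant [B] that does not depend on the period, and this dictates the exponent [A]: when
    [2 ^ A > B], the quantity [p ^ A * sum f] does not grow during the halvings. The sub-action of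
    the unperturbed map is kept for all nearby maps, so that the same function [u] and the same
    constants serve throughout. Locking is formulated as an inequality for orbits of lifts, and
    measures enter only at the very end. *)

Section CircleMetric.
Variable R : realType.
Implicit Types (x y : R) (k : int).

Lemma frac_ge0 x : 0 <= frac x.
Proof. by rewrite /frac subr_ge0 floor_le. Qed.

Lemma frac_lt1 x : frac x < 1.
Proof. by rewrite /frac ltrBlDl; have := floorD1_gt x; rewrite intrD. Qed.

Lemma frac_addz x k : frac (x + k%:~R) = frac x.
Proof.
by rewrite /frac floorDrz ?intr_int // intrKfloor intrD opprD addrACA subrr addr0.
Qed.

Lemma frac_ex x : exists k, frac x = x + k%:~R.
Proof. by exists (- Num.floor x); rewrite /frac intrN. Qed.

Lemma frac_id x : 0 <= x < 1 -> frac x = x.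
Proof. by move=> h; rewrite /frac (@floor_def _ x 0) ?subr0 // add0r. Qed.

(** With [circ_dist_le] this makes [circ_dist] the minimum of [|x - y - k|] over the integers [k],
    the form that suits lifts. *)
Lemma circ_dist_ex x y : exists k, circ_dist x y = `|x - y - k%:~R|.
Proof.
rewrite /circ_dist; have h0 := frac_ge0 (x - y); have h1 := frac_lt1 (x - y).
rewrite minElt; case: ifP => _.
  by exists (Num.floor (x - y)); rewrite [in RHS]ger0_norm.
exists (Num.floor (x - y) + 1); rewrite /frac in h0 h1 *.
by rewrite ler0_norm intrD; lra.
Qed.

Lemma circ_dist_le x y k : circ_dist x y <= `|x - y - k%:~R|.
Proof.
rewrite /circ_dist; have h0 := frac_ge0 (x - y); have h1 := frac_lt1 (x - y).
rewrite -(frac_addz (x - y) (- k)) intrN in h0 h1 *.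
set t := x - y - k%:~R in h0 h1 *; rewrite ge_min.
have [t0|t0] := leP 0 t.
  apply/orP; left; rewrite ger0_norm // /frac lerBlDr lerDl.
  by rewrite ler0z floor_ge0.
apply/orP; right; rewrite ltr0_norm // /frac.
have : (Num.floor t)%:~R <= (-1)%:~R :> R.
  by rewrite ler_int; have := floor_lt0 t; rewrite t0; lia.
rewrite intrN; lra.
Qed.

Lemma circ_dist_ge0 x y : 0 <= circ_dist x y.
Proof. by have [k ->] := circ_dist_ex x y. Qed.

Lemma circ_dist_le_norm x y : circ_dist x y <= `|x - y|.
Proof. by have := circ_dist_le x y 0; rewrite subr0. Qed.

Lemma circ_dist_le1 x y : circ_dist x y <= 1.
Proof.
rewrite /circ_dist ge_min; apply/orP; left; exact/ltW/frac_lt1.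
Qed.

Lemma circ_dist_addz x y k : circ_dist (x + k%:~R) y = circ_dist x y.
Proof. by rewrite /circ_dist addrAC frac_addz. Qed.

Lemma circ_distC x y : circ_dist x y = circ_dist y x.
Proof.
suff h (u v : R) : circ_dist u v <= circ_dist v u by apply/eqP; rewrite eq_le !h.
have [k ->] := circ_dist_ex v u; rewrite -normrN.
have -> : - (v - u - k%:~R) = u - v - (- k)%:~R by rewrite intrN; ring.
exact: circ_dist_le.
Qed.

Lemma circ_dist_triangle x y z : circ_dist x z <= circ_dist x y + circ_dist y z.
Proof.
have [k ->] := circ_dist_ex x y; have [l ->] := circ_dist_ex y z.
apply: le_trans (circ_dist_le x z (k + l)) _; apply: le_trans (ler_normD _ _).
rewrite intrD; suff -> : x - z - (k%:~R + l%:~R) = x - y - k%:~R + (y - z - l%:~R) by [].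
ring.
Qed.

Lemma circ_distxx x : circ_dist x x = 0.
Proof.
apply/eqP; rewrite eq_le circ_dist_ge0 andbT.
by have := circ_dist_le_norm x x; rewrite subrr normr0.
Qed.

Definition per1 (f : R -> R) := forall x k, f (x + k%:~R) = f x.

Lemma per1_of_succ (f : R -> R) : (forall x, f (x + 1) = f x) -> per1 f.
Proof.
move=> h; have hn (n : nat) x : f (x + n%:R) = f x.
  by elim: n => [|n IH]; rewrite ?addr0 // -natr1 addrA h.
move=> x [n|n]; first exact: hn.
by rewrite NegzE intrN -(hn n.+1 (x - _)) subrK.
Qed.

End CircleMetric.

Lemma powRV (R : realType) (x a : R) : 0 <= x -> x^-1 `^ a = (x `^ a)^-1.
Proof. by move=> x0; rewrite -powR_inv1 // powRAC powR_inv1 // powR_ge0. Qed.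

Lemma powR_exprn (R : realType) (x a : R) n : 0 <= x -> (x ^+ n) `^ a = (x `^ a) ^+ n.
Proof. by move=> x0; rewrite -powR_mulrn // powRAC powR_mulrn // powR_ge0. Qed.

Section HolderTools.
Variables (R : realType) (chi : R).
Hypothesis chi01 : 0 < chi <= 1.
Implicit Types (x y a b : R).

Let chi0 : 0 < chi. Proof. by case/andP: chi01. Qed.

Lemma le_powR a b : 0 <= a -> a <= b -> a `^ chi <= b `^ chi.
Proof.
move=> a0 ab; apply: ge0_ler_powR => //; first exact: ltW.
by rewrite nnegrE (le_trans a0).
Qed.

Lemma powR_subadd a b : 0 <= a -> 0 <= b -> (a + b) `^ chi <= a `^ chi + b `^ chi.
Proof.
move=> a0 b0; have := addr_ge0 a0 b0; rewrite le_eqVlt => /predU1P[s0|s0].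
  rewrite -s0 powR0 ?gt_eqF // addr_ge0 //; exact: powR_ge0.
(* A share [t = c / (a + b)] lies in [[0, 1]], so [t <= t ^ chi]; the shares of [a] and [b] add up
   to 1. *)
have key c : 0 <= c -> c <= a + b -> c / (a + b) * (a + b) `^ chi <= c `^ chi.
  rewrite le_eqVlt => /predU1P[<- _|c0 cs]; first by rewrite !mul0r powR_ge0.
  rewrite -[X in _ <= X `^ _](divfK (lt0r_neq0 s0)) powRM ?divr_ge0 ?(ltW c0) ?(ltW s0) //.
  rewrite ler_wpM2r ?powR_ge0 //; apply: ger1_powR; last by case/andP: chi01.
  by rewrite divr_gt0 //= ler_pdivrMr // mul1r.
apply: le_trans (lerD (key a a0 _) (key b b0 _)); rewrite ?lerDl ?lerDr //.
by rewrite -mulrDl -mulrDl divff ?mul1r // lt0r_neq0.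
Qed.

(* Subadditivity of [t^chi] lets the sum of the [e i ^ chi] absorb itself. *)
Lemma expanding_chain_sum (lam : R) (e d : nat -> R) n :
  1 < lam -> (forall i, 0 <= e i) -> (forall i, 0 <= d i) ->
  (forall i, (i < n)%N -> lam * e i <= e i.+1 + d i) ->
  (lam `^ chi - 1) * \sum_(i < n) e i `^ chi
    <= e n `^ chi - e 0%N `^ chi + \sum_(i < n) d i `^ chi.
Proof.
move=> lam1 e0 d0; elim: n => [|n IH] h.
  by rewrite !big_ord0 mulr0 subrr addr0.
rewrite !big_ord_recr /= mulrDr.
have {}IH := IH (fun i hi => h i (leqW hi)).
have hn : lam `^ chi * e n `^ chi <= e n.+1 `^ chi + d n `^ chi.
  rewrite -powRM ?e0 // ?(ltW (lt_trans ltr01 lam1)) //.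
  apply: le_trans (powR_subadd _ _) => //.
  by apply: le_powR; rewrite ?h // mulr_ge0 ?e0 // (ltW (lt_trans ltr01 lam1)).
move: IH hn; set E := _ * \sum_(i < n) _ => IH hn.
rewrite [(_ - 1) * (e n `^ chi)]mulrBl mul1r; lra.
Qed.

Lemma powR_gt1 (lam : R) : 1 < lam -> 1 < lam `^ chi.
Proof.
move=> h; have {1}<- : 1 `^ chi = 1 :> R by rewrite powR1.
by rewrite gt0_ltr_powR // nnegrE // ltW // (lt_trans ltr01).
Qed.

Definition holder (K : R) (f : R -> R) := forall x y, `|f x - f y| <= K * `|x - y| `^ chi.

Lemma holder_per1 K f x y (k : int) : per1 f -> holder K f ->
  `|f x - f y| <= K * `|x - (y + k%:~R)| `^ chi.
Proof. by move=> pf hf; rewrite -(pf y k); exact: hf. Qed.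

End HolderTools.

(** * Expanding lifts *)


Section Analysis.
Variable R : realType.

Lemma lipschitz_continuous (L : R) (h : R -> R) :
  (forall x y, `|h x - h y| <= L * `|x - y|) -> continuous h.
Proof.
move=> hL x; apply/cvgrPdist_lt => e e0.
have L1 : 0 < `|L| + 1 by rewrite ltr_wpDl.
near=> t; apply: le_lt_trans (hL x t) _.
apply: (@le_lt_trans _ _ ((`|L| + 1) * `|x - t|)).
  by rewrite ler_wpM2r // (le_trans (ler_norm L)) // lerDl.
rewrite mulrC -ltr_pdivlMr //; near: t.
by apply: cvgr_dist_lt => //; rewrite divr_gt0.
Unshelve. all: by end_near. Qed.

(** The integer [k] is sent to [h 0 + e * k], so [h] takes values on both sides of [v] and the
    intermediate value theorem applies. *)
Lemma degree_surjective (h : R -> R) (e : int) : continuous h ->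
  (forall x, h (x + 1) = h x + e%:~R) -> e != 0 -> forall v, exists x, h x = v.
Proof.
move=> hc he e0 v.
have hk (k : int) : h k%:~R = h 0 + (e * k)%:~R.
  have p1 : per1 (fun x => h x - e%:~R * x).
    by apply: per1_of_succ => x; rewrite he; ring.
  by have := p1 0 k; rewrite add0r mulr0 subr0 => <-; rewrite intrM; ring.
pose N : nat := (Num.trunc `|v - h 0|).+1.
have hN : `|v - h 0| < N%:R by exact: truncnS_gt.
have e1 : (1 : R) <= `|e|%:~R by rewrite ler1z; lia.
(* The sign of [e] is put into [s], so that [h] is large at [s] and small at [- s] in both cases. *)
pose s : int := sgz e * N%:Z.
have hs : h s%:~R = h 0 + `|e|%:~R * N%:R.
  rewrite hk /s; have -> : e * (sgz e * N%:Z) = `|e| * N%:Z by lia.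
  by rewrite intrM.
have hns : h (- s)%:~R = h 0 - `|e|%:~R * N%:R.
  rewrite hk /s; have -> : e * - (sgz e * N%:Z) = - (`|e| * N%:Z) by lia.
  by rewrite intrN intrM.
have big : `|v - h 0| <= `|e|%:~R * N%:R.
  by apply: le_trans (ltW hN) _; rewrite ler_peMl // ler0n.
move: big; rewrite ler_norml => /andP[b1 b2].
have [a [b [ab ha hb]]] : exists a b : R, [/\ a <= b, Num.min (h a) (h b) <= v & v <= Num.max (h a) (h b)].
  have [ss|ss] := leP ((- s)%:~R : R) s%:~R; [exists (- s)%:~R, s%:~R|exists s%:~R, (- s)%:~R];
   (split; rewrite ?(ltW ss) // ?ge_min ?le_max hs hns; apply/orP; first [left; lra | right; lra]).
have [c _ hcv] := IVT ab (continuous_subspaceT hc) (introT andP (conj ha hb)).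
by exists c.
Qed.

Lemma bernoulli (lam : R) n : 1 < lam -> 1 + n%:R * (lam - 1) <= lam ^+ n.
Proof.
move=> l1; elim: n => [|n IH]; first by rewrite mul0r addr0 expr0.
rewrite exprS -natr1; have n0 : 0 <= n%:R :> R by rewrite ler0n.
have : lam * (1 + n%:R * (lam - 1)) <= lam * lam ^+ n by rewrite ler_wpM2l //; lra.
have : 0 <= n%:R * (lam - 1) ^+ 2 by rewrite mulr_ge0 // sqr_ge0.
lra.
Qed.

Lemma expr_unbounded (lam C : R) : 1 < lam -> exists n, C < lam ^+ n.
Proof.
move=> l1; pose N := (Num.trunc (`|C| / (lam - 1))).+1.
exists N; apply: lt_le_trans (bernoulli N l1).
have : `|C| / (lam - 1) < N%:R by exact: truncnS_gt.
rewrite ltr_pdivrMr ?subr_gt0 // => h; have := ler_norm C; lra.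
Qed.

End Analysis.

Section Lifts.
Variables (R : realType) (G : R -> R) (d : int).
Hypothesis liftG : forall x, G (x + 1) = G x + d%:~R.

Lemma lift_addz x (k : int) : G (x + k%:~R) = G x + (d * k)%:~R.
Proof.
have p1 : per1 (fun x => G x - d%:~R * x).
  by apply: per1_of_succ => z; rewrite liftG; ring.
by have := p1 x k; rewrite intrM => h; have := congr1 (+%R^~ (d%:~R * (x + k%:~R))) h; rewrite subrK => ->; ring.
Qed.

Lemma iter_addz n x (k : int) : iter n G (x + k%:~R) = iter n G x + (d ^+ n * k)%:~R.
Proof.
elim: n => [|n IH] /=; first by rewrite expr0 mul1r.
by rewrite IH lift_addz exprS mulrA.
Qed.

End Lifts.

(* [D] is an adapted metric on the line, for which [G] is expanding at the first step. *)
Record regular_lift (R : realType) (d : int) (L C lam : R) (G : R -> R) (D : R -> R -> R) : Prop := {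
  rl_lift : forall x, G (x + 1) = G x + d%:~R;
  rl_lip : forall x y, `|G x - G y| <= L * `|x - y|;
  rl_sym : forall x y, D x y = D y x;
  rl_tri : forall y x z, D x z <= D x y + D y z;
  rl_addz : forall x y (k : int), D (x + k%:~R) (y + k%:~R) = D x y;
  rl_lb : forall x y, `|x - y| <= D x y;
  rl_ub : forall x y, D x y <= C * `|x - y|;
  rl_exp : forall x y, lam * D x y <= D (G x) (G y);
  rl_lam : 1 < lam
}.

Section Shadowing.
Variables (R : realType) (d : int) (L C lam : R) (G : R -> R) (D : R -> R -> R).
Hypothesis rG : regular_lift d L C lam G D.
Let liftG := rl_lift rG.
Let lam1 := rl_lam rG.

Lemma rl_D0 x y : 0 <= D x y.
Proof. exact: le_trans (normr_ge0 _) (rl_lb rG x y). Qed.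

Lemma rl_Dxx x : D x x = 0.
Proof.
apply/eqP; rewrite eq_le rl_D0 andbT.
by have := rl_ub rG x x; rewrite subrr normr0 mulr0.
Qed.

Lemma rl_lam0 : 0 < lam. Proof. exact: lt_trans ltr01 lam1. Qed.

Lemma rl_C1 : 1 <= C.
Proof.
have := le_trans (rl_lb rG 1 0) (rl_ub rG 1 0).
by rewrite subr0 normr1 mulr1.
Qed.

Lemma rl_iter_exp n x y : lam ^+ n * D x y <= D (iter n G x) (iter n G y).
Proof.
elim: n => [|n IH] /=; first by rewrite mul1r.
rewrite exprS -mulrA; apply: le_trans (rl_exp rG _ _).
by rewrite ler_wpM2l // ltW // rl_lam0.
Qed.

Lemma rl_continuous : continuous G.
Proof. exact: lipschitz_continuous (rl_lip rG). Qed.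

Lemma rl_iter_continuous n : continuous (iter n G).
Proof.
elim: n => [|n IH] x; first exact: cvg_id.
by apply: (continuous_comp (IH x)); exact: rl_continuous.
Qed.

(** If [|d| <= 1], the images of 1 and 0 would stay at distance at most 1, while their [D]-distance
    grows like [lam ^ n]. *)
Lemma rl_degree : (1 < `|d|)%N.
Proof.
rewrite ltnNge; apply/negP => d1.
have [n hn] := expr_unbounded C lam1.
have := rl_iter_exp n 1 0.
have -> : iter n G 1 = iter n G 0 + (d ^+ n)%:~R.
  by have := iter_addz liftG n 0 1; rewrite add0r mulr1.
have h1 : `|(d ^+ n)%:~R : R| <= 1.
  by rewrite -intr_norm normrX -[1]/(1%:~R) ler_int exprn_ile1 // -abszE lez_nat.
have h2 : D (iter n G 0 + (d ^+ n)%:~R) (iter n G 0) <= C.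
  apply: le_trans (rl_ub rG _ _) _; rewrite addrAC subrr add0r.
  by apply: ler_piMr => //; exact: le_trans ler01 rl_C1.
have h3 : lam ^+ n <= lam ^+ n * D 1 0.
  apply: ler_peMr; first by rewrite exprn_ge0 // ltW // rl_lam0.
  by have := rl_lb rG 1 0; rewrite subr0 normr1.
by move=> h4; have := lt_le_trans hn (le_trans h3 (le_trans h4 h2)); rewrite ltxx.
Qed.

Lemma rl_degX_neq0 n : d ^+ n != 0.
Proof. by rewrite expf_neq0 //; have := rl_degree; lia. Qed.

Lemma rl_degX_neq1 n : (0 < n)%N -> d ^+ n - 1 != 0.
Proof.
move=> n0; rewrite subr_eq0; apply/eqP => h.
have : (`|d ^+ n| = 1)%N by rewrite h.
by rewrite abszX => /eqP; rewrite -(exp1n n) eqn_exp2r // => /eqP; have := rl_degree; lia.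
Qed.

Lemma rl_iter_surj n v : exists x, iter n G x = v.
Proof.
apply: (degree_surjective (@rl_iter_continuous n) _ (rl_degX_neq0 n)) => x.
by have := iter_addz liftG n x 1; rewrite mulr1.
Qed.

(** [iter n G - id] has the nonzero degree [d ^ n - 1], so it takes every integer value. *)
Lemma rl_periodic_point n (M : int) : (0 < n)%N -> exists z, iter n G z = z + M%:~R.
Proof.
move=> n0.
have [z hz] : exists z, iter n G z - z = M%:~R.
  apply: (degree_surjective (h := fun x => iter n G x - x) _ _ (rl_degX_neq1 n0)).
    by move=> x; apply: continuousB; [exact: rl_iter_continuous|exact: cvg_id].
  move=> x; have := iter_addz liftG n x 1; rewrite mulr1 => ->.
  by rewrite intrB; ring.
by exists z; rewrite -hz addrC subrK.
Qed.

End Shadowing.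

(** * Shadowing and sub-actions *)


Section PeriodicShadowing.
Variables (R : realType) (chi : R).
Hypothesis chi01 : 0 < chi <= 1.
Variables (d : int) (L C lam : R) (G : R -> R) (D : R -> R -> R).
Hypothesis rG : regular_lift d L C lam G D.
Let liftG := rl_lift rG.
Let lam1 := rl_lam rG.
Let D0 := rl_D0 rG.
Let lamchi1 : 1 < lam `^ chi := powR_gt1 chi01 lam1.

(** The pseudo-orbit is lifted to the line by the integers [K i], and [z] is a periodic point with
    the same total displacement [K n]. The error at time [n] then equals the error at time 0, so the
    boundary terms of [expanding_chain_sum] cancel. *)
Lemma periodic_shadowing n (y delta : nat -> R) : (0 < n)%N -> y n = y 0%N ->
  (forall i, 0 <= delta i) ->
  (forall i, (i < n)%N -> exists k : int, D (G (y i)) (y i.+1 + k%:~R) <= delta i) ->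
  exists z (M : int) (K : nat -> int), iter n G z = z + M%:~R /\
    (lam `^ chi - 1) * \sum_(i < n) D (iter i G z) (y i + (K i)%:~R) `^ chi
      <= \sum_(i < n) delta i `^ chi.
Proof.
move=> n0 yn d0 hy.
have /choice [k hk] : forall i, exists k : int, (i < n)%N -> D (G (y i)) (y i.+1 + k%:~R) <= delta i.
  by move=> i; case: (ltnP i n) => [/hy [k hk]|_]; [exists k|exists 0].
(* Moving a point by [K i] moves its image by [d * K i]; the jump adds [k i]. *)
pose K := fix K (i : nat) : int := if i is j.+1 then d * K j + k j else 0.
have hK i : (i < n)%N -> D (G (y i + (K i)%:~R)) (y i.+1 + (K i.+1)%:~R) <= delta i.
  move=> /hk; rewrite (lift_addz liftG) /= intrD -(rl_addz rG _ _ (d * K i)).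
  by have -> : y i.+1 + ((d * K i)%:~R + (k i)%:~R) = y i.+1 + (k i)%:~R + (d * K i)%:~R by ring.
have [z hz] := rl_periodic_point rG (K n) n0.
exists z, (K n), K; split => //.
pose e i := D (iter i G z) (y i + (K i)%:~R).
have := @expanding_chain_sum R chi chi01 lam e delta n lam1 (fun=> D0 _ _) d0.
have -> : e n = e 0%N by rewrite /e hz yn (rl_addz rG) /= addr0.
rewrite subrr add0r; apply => i ltin.
apply: le_trans (rl_exp rG _ _) _; rewrite -iterS.
apply: le_trans (rl_tri rG (y i.+1 + (K i.+1)%:~R) _ _) _.
by rewrite lerD2l (rl_sym rG) hK.
Qed.

Variables (Kp : R) (psi : R -> R).
Hypotheses (psi_per : per1 psi) (psi_holder : holder chi Kp psi).

Lemma holder_const_ge0 : 0 <= Kp.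
Proof.
have := psi_holder 0 1; rewrite sub0r normrN1 powR1 mulr1.
exact: le_trans.
Qed.

Lemma holder_D x y (k : int) : `|psi x - psi y| <= Kp * D x (y + k%:~R) `^ chi.
Proof.
apply: le_trans (holder_per1 _ _ k psi_per psi_holder) _.
by rewrite ler_wpM2l ?holder_const_ge0 // le_powR // (rl_lb rG).
Qed.

Lemma shadowing_sum n (y delta : nat -> R) : (0 < n)%N -> y n = y 0%N ->
  (forall i, 0 <= delta i) ->
  (forall i, (i < n)%N -> exists k : int, D (G (y i)) (y i.+1 + k%:~R) <= delta i) ->
  exists z (M : int), iter n G z = z + M%:~R /\
    `|\sum_(i < n) psi (iter i G z) - \sum_(i < n) psi (y i)|
      <= Kp / (lam `^ chi - 1) * \sum_(i < n) delta i `^ chi.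
Proof.
move=> n0 yn d0 hy; have [z [M [K [hz hs]]]] := periodic_shadowing n0 yn d0 hy.
exists z, M; split => //; rewrite -sumrB; apply: le_trans (ler_norm_sum _ _ _) _.
apply: (@le_trans _ _ (\sum_(i < n) Kp * D (iter i G z) (y i + (K i)%:~R) `^ chi)).
  by apply: ler_sum => i _; exact: holder_D.
rewrite -mulr_sumr -mulrA ler_wpM2l ?holder_const_ge0 // ler_pdivlMl ?subr_gt0 //.
Qed.

Lemma sum_delta_last (A : R) n :
  \sum_(i < n.+1) (if i.+1 == n.+1 then A else 0) `^ chi = A `^ chi.
Proof.
rewrite big_ord_recr /= eqxx big1 ?add0r // => i _.
by rewrite eqSS ltn_eqF // powR0 // gt_eqF //; case/andP: chi01.
Qed.

(** The orbit segment of [x], closed up by returning to [x], is a pseudo-orbit whose only jump is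
    the last one. The factor [C] converts the usual distance to [D]. *)
Lemma closing_one n x (k : int) delta : (0 < n)%N ->
  `|iter n G x - x - k%:~R| <= delta ->
  exists z (M : int), iter n G z = z + M%:~R /\
    `|\sum_(i < n) psi (iter i G z) - \sum_(i < n) psi (iter i G x)|
      <= Kp / (lam `^ chi - 1) * (C * delta) `^ chi.
Proof.
case: n => // n _ hx.
pose y i := if (i < n.+1)%N then iter i G x else x.
pose dl i := if i.+1 == n.+1 then C * delta else 0.
have C0 : 0 <= C := le_trans ler01 (rl_C1 rG).
have de0 : 0 <= delta := le_trans (normr_ge0 _) hx.
have yn : y n.+1 = y 0%N by rewrite /y ltnn.
have dl0 i : 0 <= dl i by rewrite /dl; case: ifP => // _; rewrite mulr_ge0.
have [|z [M [hz hs]]] := shadowing_sum (ltn0Sn n) yn dl0.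
  move=> i ltin; rewrite /y /dl ltin.
  have [e1|ne] := eqVneq i.+1 n.+1.
    rewrite e1 ltnn; exists k; apply: le_trans (rl_ub rG _ _) _.
    by rewrite ler_wpM2l // -iterS e1 opprD addrA.
  have -> : (i.+1 < n.+1)%N by rewrite ltn_neqAle ne.
  by exists 0; rewrite addr0 -iterS (rl_Dxx rG).
exists z, M; split => //; move: hs; rewrite sum_delta_last.
by under [X in _ - X]eq_bigr => i _ do rewrite /y ltn_ord.
Qed.

(** Two orbit segments, each ending near the start of the other, form one closed pseudo-orbit with
    jumps only into the times [n1] and [n1 + n2]. *)
Lemma closing_two n1 n2 x1 x2 (k1 k2 : int) delta : (0 < n1)%N -> (0 < n2)%N ->
  `|iter n1 G x1 - x2 - k1%:~R| <= delta ->
  `|iter n2 G x2 - x1 - k2%:~R| <= delta ->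
  exists z (M : int), iter (n1 + n2) G z = z + M%:~R /\
    `|\sum_(i < n1 + n2) psi (iter i G z)
       - (\sum_(i < n1) psi (iter i G x1) + \sum_(i < n2) psi (iter i G x2))|
      <= Kp / (lam `^ chi - 1) * ((C * delta) `^ chi *+ 2).
Proof.
move=> n10 n20 h1 h2.
pose y i := if (i < n1)%N then iter i G x1 else
            if (i < n1 + n2)%N then iter (i - n1) G x2 else x1.
pose dl i := if (i.+1 == n1) || (i.+1 == n1 + n2)%N then C * delta else 0.
have C0 : 0 <= C := le_trans ler01 (rl_C1 rG).
have de0 : 0 <= delta := le_trans (normr_ge0 _) h1.
have yn : y (n1 + n2)%N = y 0%N.
  by rewrite /y n10 ltnn ifF //; apply/negbTE; rewrite -leqNgt leq_addr.
have dl0 i : 0 <= dl i by rewrite /dl; case: ifP => // _; rewrite mulr_ge0.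
have n120 : (0 < n1 + n2)%N by rewrite addn_gt0 n10.
have [|z [M [hz hs]]] := shadowing_sum n120 yn dl0.
  move=> i ltin; rewrite /y /dl ltin.
  have [lti1|le1i] := ltnP i n1.
    have [e1|ne1] := eqVneq i.+1 n1.
      rewrite e1 ltnn ifT; last by rewrite -addn1 leq_add2l.
      rewrite subnn /=; exists k1; apply: le_trans (rl_ub rG _ _) _.
      by rewrite ler_wpM2l // -iterS e1; rewrite opprD addrA.
    rewrite ifT; last by rewrite ltn_neqAle ne1.
    rewrite ifF; last by apply/negbTE/eqP; move: n20 lti1 ne1; lia.
    by exists 0; rewrite addr0 -iterS (rl_Dxx rG).
  rewrite [(i.+1 < n1)%N]ltnNge (leqW le1i) /= [i.+1 == n1]gtn_eqF ?ltnS //=.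
  have ii : (i.+1 - n1 = (i - n1).+1)%N by rewrite subSn.
  have [e2|ne2] := eqVneq i.+1 (n1 + n2)%N.
    rewrite -e2 ltnn; exists k2; apply: le_trans (rl_ub rG _ _) _.
    rewrite ler_wpM2l // -iterS -ii e2 addKn.
    by rewrite opprD addrA.
  rewrite ifT; last by rewrite ltn_neqAle ne2.
  by exists 0; rewrite addr0 -iterS ii (rl_Dxx rG).
exists z, M; split => //; move: hs; rewrite !big_split_ord /=.
have -> : \sum_(i < n1) psi (y i) = \sum_(i < n1) psi (iter i G x1).
  by apply: eq_bigr => i _; rewrite /y ltn_ord.
have -> : \sum_(i < n2) psi (y (n1 + i)%N) = \sum_(i < n2) psi (iter i G x2).
  by apply: eq_bigr => i _; rewrite /y ltnNge leq_addr /= ltn_add2l ltn_ord addKn.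
suff -> : \sum_(i < n1) dl i `^ chi + \sum_(i < n2) dl (n1 + i)%N `^ chi = (C * delta) `^ chi *+ 2 by [].
case: n1 n2 n10 n20 @y @dl {h1 h2 yn dl0 n120 hz} => [//|m1] [//|m2] _ _ _ dl.
rewrite mulr2n -{1}(sum_delta_last _ m1) -(sum_delta_last _ m2); congr (_ + _);
  apply: eq_bigr => i _; rewrite /dl; congr (_ `^ _).
  case: eqP => //= _; rewrite ifF //; apply/negbTE/eqP.
  by have := ltn_ord i; lia.
by rewrite -addnS eqn_add2l [_ == m1.+1]gtn_eqF // addnS ltnS leq_addr.
Qed.

End PeriodicShadowing.

(** * Sub-actions *)

Section SubAction.
Variables (R : realType) (chi : R).
Hypothesis chi01 : 0 < chi <= 1.
Variables (d : int) (L C lam : R) (G : R -> R) (D : R -> R -> R).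
Hypothesis rG : regular_lift d L C lam G D.
Variables (Kp : R) (phi : R -> R).
Hypotheses (phi_per : per1 phi) (phi_holder : holder chi Kp phi).
Let lam1 := rl_lam rG.
Let liftG := rl_lift rG.
Let lamchi1 : 1 < lam `^ chi := powR_gt1 chi01 lam1.
Let Kp0 : 0 <= Kp := holder_const_ge0 phi_holder.
Let C0 : 0 <= C := le_trans ler01 (rl_C1 rG).

Lemma per1_holder_bounded x : `|phi x| <= `|phi 0| + Kp.
Proof.
have [k hk] := circ_dist_ex x 0.
have : `|phi x - phi 0| <= Kp * 1.
  apply: le_trans (holder_per1 _ _ k phi_per phi_holder) _.
  rewrite ler_wpM2l // add0r; rewrite subr0 in hk; rewrite -hk.
  have -> : 1 = 1 `^ chi :> R by rewrite powR1.
  by rewrite le_powR // ?circ_dist_ge0 ?circ_dist_le1.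
rewrite mulr1 => h; rewrite -[phi x](subrK (phi 0)) addrC.
by apply: le_trans (ler_normD _ _) _; rewrite lerD2l.
Qed.

(** Closed orbits stand in for invariant measures: [iter n G z = z + M] is periodicity on the
    circle, and near-minimizers of the infimum come as orbits. *)
Definition periodic_averages : set R := [set a | exists z n (M : int),
  [/\ (0 < n)%N, iter n G z = z + M%:~R & a = (\sum_(i < n) phi (iter i G z)) / n%:R]].

Definition min_average := inf periodic_averages.

Let av_inf : has_inf periodic_averages.
Proof.
split.
  have [z hz] := @rl_periodic_point _ _ _ _ _ _ _ rG 1 0 isT.
  by exists ((\sum_(i < 1) phi (iter i G z)) / 1%:R), z, 1%N, 0.
exists (- (`|phi 0| + Kp)) => _ [z [n [M [n0 _ ->]]]].
rewrite ler_pdivlMr ?ltr0n // mulrC mulr_natl -[X in _ *+ X](card_ord n) -sumr_const.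
apply: ler_sum => i _; have := per1_holder_bounded (iter i G z).
by rewrite ler_norml => /andP[].
Qed.

Lemma periodic_sum_ge z n (M : int) : iter n G z = z + M%:~R ->
  n%:R * min_average <= \sum_(i < n) phi (iter i G z).
Proof.
case: n => [|n] hz; first by rewrite big_ord0 mul0r.
rewrite mulrC -ler_pdivlMr ?ltr0n //; apply: ge_inf; first by case: av_inf.
by exists z, n.+1, M.
Qed.

Lemma periodic_sum_approx e : 0 < e -> exists z n (M : int),
  [/\ (0 < n)%N, iter n G z = z + M%:~R &
      \sum_(i < n) phi (iter i G z) < n%:R * (min_average + e)].
Proof.
move=> e0; have [_ [z [n [M [n0 hz ->]]]] h] := inf_adherent e0 av_inf.
exists z, n, M; split => //; move: h.
by rewrite ltr_pdivrMr ?ltr0n // mulrC.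
Qed.

(** On the circle every segment ends within distance 1 of its start, so it closes up at a cost that
    does not depend on its length. *)
Lemma orbit_sum_ge : exists2 B, 0 <= B & forall n x,
  n%:R * min_average - B <= \sum_(i < n) phi (iter i G x).
Proof.
exists (Kp / (lam `^ chi - 1) * (C * 1) `^ chi).
  by rewrite mulr_ge0 ?powR_ge0 // divr_ge0 // subr_ge0 ltW.
case=> [x|n x].
  by rewrite big_ord0 mul0r add0r oppr_le0 mulr_ge0 ?powR_ge0 // divr_ge0 // subr_ge0 ltW.
have [k hk] := circ_dist_ex (iter n.+1 G x) x.
have := circ_dist_le1 (iter n.+1 G x) x; rewrite hk => {}hk.
have [z [M [hz]]] := closing_one chi01 rG phi_per phi_holder (ltn0Sn n) hk.
rewrite ler_norml => /andP[h1 h2]; have := periodic_sum_ge hz; lra.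
Qed.

Let values x : set R := [set v | exists n y (k : int),
  iter n G y = x + k%:~R /\ v = \sum_(i < n) phi (iter i G y) - n%:R * min_average].

(** The least normalized cost of arriving at [x] modulo integers from any past, in the manner of
    Mañé's potential; [orbit_sum_ge] keeps it finite. *)
Definition sub_action x := inf (values x).

Let values_inf x : has_inf (values x).
Proof.
split.
  exists 0, 0%N, x, 0; split => //=; first by rewrite addr0.
  by rewrite big_ord0 mul0r subrr.
have [B B0 hB] := orbit_sum_ge; exists (- B) => _ [n [y [k [_ ->]]]].
by have := hB n y; lra.
Qed.

Lemma sub_action_per : per1 sub_action.
Proof.
move=> x k; congr inf; apply/seteqP; split => v [n [y [l [hy ->]]]].
  by exists n, y, (k + l); split => //; rewrite hy intrD addrA.
by exists n, y, (l - k); split => //; rewrite hy intrB; ring.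
Qed.

(** Every past of [x] is moved to a past of [x'] of the same length. As [G] expands [D] on the whole
    line, the preimage [y'] of the shifted end point stays close to [y] at all earlier times,
    without a choice of inverse branch. *)
Lemma sub_action_holder :
  holder chi (Kp / (lam `^ chi - 1) * C `^ chi) sub_action.
Proof.
set Ku := _ * _.
suff key x x' : sub_action x' - Ku * `|x - x'| `^ chi <= sub_action x.
  move=> x y; have h1 := key x y; have h2 := key y x.
  by rewrite ler_norml; move: h2; rewrite (distrC y x); lra.
have [ne lb] := values_inf x.
apply: lb_le_inf => // _ [n [y [k [hy ->]]]].
have [y' hy'] := rl_iter_surj rG n (iter n G y + (x' - x)).
have e0 i : 0 <= D (iter i G y') (iter i G y) by exact: rl_D0 rG _ _.
have chain := @expanding_chain_sum R chi chi01 lam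
  (fun i => D (iter i G y') (iter i G y)) (fun=> 0) n lam1 e0 (fun=> lexx 0).
have {}chain : (lam `^ chi - 1) * \sum_(i < n) D (iter i G y') (iter i G y) `^ chi
    <= (C * `|x - x'|) `^ chi.
  apply: le_trans (chain _) _; first by move=> i _; rewrite addr0; exact: rl_exp rG _ _.
  rewrite big1 ?addr0; last by move=> i _; rewrite powR0 // gt_eqF //; case/andP: chi01.
  rewrite (@le_trans _ _ (D (iter n G y') (iter n G y) `^ chi)) //.
    by rewrite gerBl powR_ge0.
  rewrite le_powR //; apply: le_trans (rl_ub rG _ _) _.
  by rewrite hy' addrAC subrr add0r distrC.
have dif : `|\sum_(i < n) phi (iter i G y') - \sum_(i < n) phi (iter i G y)| <= Ku * `|x - x'| `^ chi.
  rewrite -sumrB; apply: le_trans (ler_norm_sum _ _ _) _.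
  apply: (@le_trans _ _ (\sum_(i < n) Kp * D (iter i G y') (iter i G y) `^ chi)).
    apply: ler_sum => i _; rewrite -{2}[iter i G y]addr0.
    exact: (holder_D chi01 rG phi_per phi_holder _ _ 0).
  rewrite -mulr_sumr /Ku -!mulrA ler_wpM2l // ler_pdivlMl ?subr_gt0 //.
  by rewrite -powRM.
have : sub_action x' <= \sum_(i < n) phi (iter i G y') - n%:R * min_average.
  apply: ge_inf; first by case: (values_inf x').
  by exists n, y', k; split => //; rewrite hy' hy; ring.
move: dif; rewrite ler_norml => /andP[]; lra.
Qed.

(** A past of [x] followed by one more step is a past of [G x]. *)
Lemma sub_action_ge0 x : 0 <= phi x - min_average + sub_action x - sub_action (G x).
Proof.
suff : sub_action (G x) - (phi x - min_average) <= sub_action x by lra.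
have [ne lb] := values_inf x.
apply: lb_le_inf => // _ [n [y [k [hy ->]]]].
have : sub_action (G x) <= \sum_(i < n.+1) phi (iter i G y) - n.+1%:R * min_average.
  apply: ge_inf; first by case: (values_inf (G x)).
  exists n.+1, y, (d * k); split => //.
  by rewrite iterS hy (lift_addz liftG).
rewrite big_ord_recr /= hy phi_per -natr1; lra.
Qed.

End SubAction.

(** * Short pseudo-cycles *)


Section FiniteCombinatorics.
Local Close Scope classical_set_scope.

Lemma card_imset_factor (P T1 T2 : finType) (S : {set P}) (f : P -> T1) (g : P -> T2) :
  {in S &, forall p p', g p = g p' -> f p = f p'} -> (#|f @: S| <= #|g @: S|)%N.
Proof.
move=> h; have [->|[p0 p0S]] := set_0Vmem S; first by rewrite imset0 cards0.
pose r y := if [pick p in S | g p == y] is Some p then f p else f p0.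
suff -> : f @: S = r @: (g @: S) by exact: leq_imset_card.
have rE p : p \in S -> r (g p) = f p.
  move=> pS; rewrite /r; case: pickP => [p' /andP[p'S /eqP e]|/(_ p)]; first exact: h.
  by rewrite pS eqxx.
apply/setP => y; apply/imsetP/imsetP => [[p pS ->]|[_ /imsetP[p pS ->] ->]].
  by exists (g p); rewrite ?imset_f ?rE.
by exists p; rewrite ?rE.
Qed.

Lemma ffact_le_expn n m : (n ^_ m <= n ^ m)%N.
Proof.
elim: m n => [|m IH] n; first by rewrite ffactn0.
case: n => [|n]; first by rewrite ffact0n.
rewrite ffactSS expnS leq_mul2l /=; apply: leq_trans (IH n) _.
by case: m {IH} => // m; rewrite leq_exp2r.
Qed.

Lemma mono_ord_id (k : nat) (sg : nat -> nat) :
  (forall j, (j < k)%N -> (sg j < k)%N) ->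
  (forall j, (j.+1 < k)%N -> (sg j < sg j.+1)%N) ->
  forall j, (j < k)%N -> sg j = j.
Proof.
move=> hk hm.
have h1 j : (j < k)%N -> (j <= sg j)%N.
  elim: j => // j IH jk; apply: leq_ltn_trans (IH (ltnW jk)) (hm _ jk).
have h2 t j : (j + t < k)%N -> (sg j + t <= sg (j + t))%N.
  elim: t => [|t IH]; first by rewrite !addn0.
  by rewrite !addnS => jk; apply: leq_ltn_trans (IH (ltnW jk)) (hm _ jk).
move=> j jk; apply/eqP; rewrite eqn_leq h1 // andbT.
have e : (j + (k.-1 - j) = k.-1)%N by lia.
have := h2 (k.-1 - j)%N j; rewrite e => /(_ ltac:(lia)).
have := hk k.-1 ltac:(lia); lia.
Qed.

Section Words.
Variables (A : finType) (s : nat -> A).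

Definition word n i : n.-tuple A := [tuple s (i + j) | j < n].

Lemma wordP n i i' : (word n i = word n i') <-> (forall j, (j < n)%N -> s (i + j) = s (i' + j)).
Proof.
split=> [h j jn|h].
  by have := congr1 (fun w => tnth w (Ordinal jn)) h; rewrite !tnth_mktuple.
by apply: eq_from_tnth => j; rewrite !tnth_mktuple h.
Qed.

Definition word_set N n := [set word n i | i : 'I_N.+1 & (i + n <= N)%N].

(** Equal words will mean close points, so this is a segment of [m] blocks that nearly closes up;
    [two_jumps] is a pair of segments, each ending near the start of the other. *)
Definition one_jump N n k := exists i m,
  [/\ (0 < m)%N, (m <= k)%N, (i + m * n + n <= N)%N & word n (i + m * n) = word n i].

Definition two_jumps N n k := exists i i' m m',
  [/\ [/\ (0 < m)%N, (0 < m')%N & (m + m' <= k)%N],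
      (i + m * n + n <= N)%N /\ (i' + m' * n + n <= N)%N,
      word n (i + m * n) = word n i' & word n (i' + m' * n) = word n i].

(* A word of length [k * n] is a path of [k] blocks of length [n]. If two paths visit the
   same blocks in different orders, a descent of the second order with respect to the
   first one gives a short pseudo-cycle with two jumps. *)
Lemma word_set_card N n k : (0 < n)%N ->
  ~ one_jump N n k -> ~ two_jumps N n k ->
  (#|word_set N (k * n)| <= 'C(#|word_set N n|, k))%N.
Proof.
move=> n0 no1 no2.
(* The unordered set of the blocks of a long word; it will turn out to determine the word. *)
pose g (i : 'I_N.+1) := [set word n (i + j * n) | j : 'I_k].
have inj (i : 'I_N.+1) (j j' : nat) : (i + k * n <= N)%N -> (j < k)%N -> (j' < k)%N ->
    word n (i + j * n) = word n (i + j' * n) -> j = j'.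
  suff w (a b : nat) : (i + k * n <= N)%N -> (a < b)%N -> (b < k)%N ->
      word n (i + a * n) <> word n (i + b * n).
    by move=> iN jk j'k e; case: (ltngtP j j') => // /w; [case/(_ iN j'k)|case/(_ iN jk)].
  move=> iN ab bk e; apply: no1; exists (i + a * n)%N, (b - a)%N.
  have -> : (i + a * n + (b - a) * n = i + b * n)%N by rewrite -addnA -mulnDl subnKC ?(ltnW ab).
  by split; [lia|lia|nia|].
pose S := [set i : 'I_N.+1 | (i + k * n <= N)%N].
pose f (i : 'I_N.+1) := word (k * n) i.
have -> : word_set N (k * n) = f @: S.
  by apply/setP => y; apply/imsetP/imsetP => -[i]; rewrite ?inE => hi ->; exists i; rewrite ?inE.
suff fg : {in S &, forall i i', g i = g i' -> f i = f i'}.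
  apply: leq_trans (card_imset_factor fg) _.
  rewrite -cards_draws; apply/subset_leq_card/fintype.subsetP => _ /imsetP[i +->]; rewrite !inE => iN.
  apply/andP; split.
    apply/fintype.subsetP => _ /imsetP[j _ ->]; apply/imsetP.
    have jk := ltn_ord j.
    have h : (i + j * n < N.+1)%N by nia.
    by exists (Ordinal h) => //; rewrite inE /=; nia.
  rewrite card_in_imset ?card_ord // => j j' _ _ e; apply: val_inj.
  exact: (inj i j j' iN (ltn_ord j) (ltn_ord j') e).
move=> i i'; rewrite /f !inE => iN i'N gi.
have /choice [sg hsg] : forall j, exists t, (j < k)%N -> (t < k)%N /\ word n (i' + j * n) = word n (i + t * n).
  move=> j; case: (ltnP j k) => [jk|]; last by exists 0%N.
  have : word n (i' + j * n) \in g i by rewrite gi; apply/imsetP; exists (Ordinal jk).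
  by case/imsetP => t _ ->; exists t.
have sgid : forall j, (j < k)%N -> sg j = j.
  apply: mono_ord_id => [j /hsg[]//|j jk].
  have [a1 a2] := hsg _ jk; have [b1 b2] := hsg _ (ltnW jk).
  rewrite ltnNge leq_eqVlt; apply/negP => /orP[/eqP e|lt].
    by move: a2; rewrite e -b2 => /(inj i' _ _ i'N jk (ltnW jk)); lia.
  (* A descent: one block along the path from [i'] leads from block [sg j] to block [sg j.+1] of the
     path from [i], and [sg j - sg j.+1] blocks along the latter lead back. *)
  apply: no2; exists (i' + j * n)%N, (i + sg j.+1 * n)%N, 1%N, (sg j - sg j.+1)%N.
  have -> : (i' + j * n + 1 * n = i' + j.+1 * n)%N by rewrite -addnA -mulnDl addn1.
  have -> : (i + sg j.+1 * n + (sg j - sg j.+1) * n = i + sg j * n)%N.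
    by rewrite -addnA -mulnDl subnKC ?(ltnW lt).
  split => //; first by split; lia.
  split; nia.
apply/wordP => t tk.
have tn : (t %/ n < k)%N by rewrite ltn_divLR.
have := (hsg _ tn).2; rewrite sgid // => /wordP /(_ (t %% n)%N); rewrite ltn_mod n0 => /(_ isT).
by rewrite -!addnA -divn_eq.
Qed.

End Words.

End FiniteCombinatorics.

(** * Growth rate of the number of words *)

Section Growth.
Variable R : realType.

(** A crude form of Stirling's formula; the induction step is [(1 + 1/k) ^ k <= e]. *)
Lemma expn_le_fact k : (k%:R : R) ^+ k <= expR 1 ^+ k * k`!%:R.
Proof.
elim: k => [|k IH]; first by rewrite !expr0 fact0 mulr1.
have step : (k.+1%:R : R) ^+ k <= expR 1 * k%:R ^+ k.
  case: k {IH} => [|k]; first by rewrite !expr0 mulr1 ltW // expR_gt1.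
  have k0 : 0 < k.+1%:R :> R by rewrite ltr0n.
  have h : (k.+2%:R : R) <= k.+1%:R * expR (k.+1%:R^-1).
    apply: (@le_trans _ _ (k.+1%:R * (1 + k.+1%:R^-1))).
      by rewrite mulrDr mulr1 divff ?lt0r_neq0 // -natr1.
    by rewrite ler_wpM2l ?(ltW k0) // expR_ge1Dx.
  apply: le_trans (lerXn2r _ _ _ h) _; rewrite ?nnegrE ?ler0n ?mulr_ge0 ?(ltW k0) ?expR_ge0 //.
  by rewrite exprMn mulrC -expRM_natl mulfV ?lt0r_neq0.
rewrite exprS factS natrM exprS.
apply: (@le_trans _ _ (k.+1%:R * (expR 1 * k%:R ^+ k))); first by rewrite ler_wpM2l.
apply: (@le_trans _ _ (k.+1%:R * (expR 1 * (expR 1 ^+ k * k`!%:R)))).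
  by rewrite !ler_wpM2l // expR_ge0.
by rewrite le_eqVlt; apply/orP; left; apply/eqP; ring.
Qed.

Variable w : R.
Hypothesis w1 : 1 < w.

(** The least integer above [e * w ^ n]: this number of blocks makes the binomial coefficient small
    enough in [card_words_step]. *)
Definition block_count n := (Num.trunc (expR 1 * w ^+ n)).+1.

Let w0 : 0 < w := lt_trans ltr01 w1.

Lemma block_count_le n : (block_count n)%:R <= (expR 1 + 1) * w ^+ n.
Proof.
rewrite /block_count -natr1 mulrDl mul1r lerD //.
  by rewrite truncn_le mulr_ge0 ?expR_ge0 // exprn_ge0 // ltW.
by rewrite exprn_ege1 // ltW.
Qed.

(** ['C(K, k) <= K ^ k / k! <= (e * K / k) ^ k], and [e / k <= w ^ (- n)] takes a factor [w] off the
    growth rate [Q]. *)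
Lemma card_words_step (K K' n k : nat) (Q : R) : k = block_count n -> 0 <= Q ->
  (K%:R <= Q ^+ n) -> (K' <= 'C(K, k))%N -> K'%:R <= (Q / w) ^+ (k * n).
Proof.
move=> kE Q0 hK hK'.
have k0 : 0 < k%:R :> R by rewrite kE ltr0n.
have hk : expR 1 * w ^+ n <= k%:R by rewrite kE ltW // truncnS_gt.
apply: (@le_trans _ _ ('C(K, k)%:R)); first by rewrite ler_nat.
have f0 : 0 < k`!%:R :> R by rewrite ltr0n fact_gt0.
rewrite -(ler_pM2r f0) -natrM bin_ffact.
apply: (@le_trans _ _ (K%:R ^+ k)); first by rewrite -natrX ler_nat ffact_le_expn.
apply: (@le_trans _ _ ((Q ^+ n) ^+ k)).
  by rewrite lerXn2r // ?nnegrE ?ler0n ?exprn_ge0.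
rewrite mulnC exprM expr_div_n exprMn -mulrA ler_peMr ?exprn_ge0 //.
rewrite exprVn ler_pdivlMl ?exprn_gt0 // mulr1.
have e0 : 0 < expR 1 ^+ k :> R by rewrite exprn_gt0 ?expR_gt0.
rewrite -(ler_pM2l e0) -exprMn; apply: le_trans (expn_le_fact k).
by rewrite lerXn2r // nnegrE ?mulr_ge0 ?expR_ge0 ?exprn_ge0 // ltW.
Qed.

(* After Bressaud and Quas: without short pseudo-cycles the growth rate of the number of
   words would drop by the factor [w] each time that [n] is replaced by [block_count n * n]. *)
Lemma short_pseudo_cycle (q n0 : nat) : (0 < n0)%N -> exists N, forall (A : finType) (s : nat -> A),
  #|A| = q -> exists2 n, (n0 <= n)%N &
    one_jump s N n (block_count n) \/ two_jumps s N n (block_count n).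
Proof.
move=> n00.
pose nn := fix nn j : nat := if j is i.+1 then (block_count (nn i) * nn i)%N else n0.
have nnS j : (n0 <= nn j)%N.
  by elim: j => //= j IH; apply: leq_trans IH _; rewrite leq_pmull.
(* After [J] reductions the rate [q / w ^ J] is below 1, so there would be no word of length [nn J]
   at all, not even the one at position 0. This length depends on [q], [n0] and [w] only, so it is
   known before the sequence [s]. *)
have [J hJ] := expr_unbounded (q%:R : R) w1.
have nnmono j : (j <= J)%N -> (nn j <= nn J)%N.
  move=> jJ; rewrite -(subnK jJ); elim: (J - j)%N => // t IH.
  by apply: leq_trans IH _; rewrite addSn /= leq_pmull.
exists (nn J) => A s qA; apply: contrapT => no.
have no1 j : ~ one_jump s (nn J) (nn j) (block_count (nn j)).
  by move=> h; apply: no; exists (nn j) => //; left.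
have no2 j : ~ two_jumps s (nn J) (nn j) (block_count (nn j)).
  by move=> h; apply: no; exists (nn j) => //; right.
have bound j : (#|word_set s (nn J) (nn j)|%:R : R) <= (q%:R / w ^+ j) ^+ (nn j).
  elim: j => [|j IH].
    rewrite expr0 divr1 /= -natrX ler_nat -qA -card_tuple.
    exact: max_card.
  have -> : q%:R / w ^+ j.+1 = (q%:R / w ^+ j) / w by rewrite exprSr invfM mulrA.
  apply: (card_words_step erefl _ IH); first by rewrite divr_ge0 // exprn_ge0 // ltW.
  by apply: word_set_card => //; apply: leq_trans (nnS j).
have nJ0 : (0 < nn J)%N by apply: leq_trans (nnS J).
have : (#|word_set s (nn J) (nn J)|%:R : R) < 1.
  apply: le_lt_trans (bound J) _; rewrite exprn_ilt1 ?divr_ge0 ?exprn_ge0 ?(ltW w0) // -?lt0n //.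
  by rewrite ltr_pdivrMr ?exprn_gt0 // mul1r.
rewrite ltrn1 ltnS leqn0 cards_eq0 => /eqP e.
have : word s (nn J) 0%N \in word_set s (nn J) (nn J).
  by apply/imsetP; exists ord0 => //; rewrite inE.
by rewrite e inE.
Qed.

End Growth.

(** * Periodic orbits with small action and large gaps *)


Section GoodOrbits.
Variables (R : realType) (chi : R).
Hypothesis chi01 : 0 < chi <= 1.
Variables (d : int) (L C lam : R) (G : R -> R) (D : R -> R -> R).
Hypothesis rG : regular_lift d L C lam G D.
Variables (Kf : R) (f : R -> R).
Hypotheses (f_per : per1 f) (f_holder : holder chi Kf f) (f_ge0 : forall x, 0 <= f x).
Let lam1 := rl_lam rG.
Let lam0 := rl_lam0 rG.
Let liftG := rl_lift rG.
Let mu1 : 1 < lam `^ chi := powR_gt1 chi01 lam1.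
Let Kf0 : 0 <= Kf := holder_const_ge0 f_holder.
Let C0 : 0 <= C := le_trans ler01 (rl_C1 rG).
Let chi0 : 0 < chi. Proof. by case/andP: chi01. Qed.

Lemma cyclic_sum z n (M : int) i : iter n G z = z + M%:~R ->
  \sum_(j < n) f (iter j G (iter i G z)) = \sum_(j < n) f (iter j G z).
Proof.
move=> hz; elim: i => // i <-.
have shift : \sum_(j < n) f (iter j G (iter i.+1 G z)) + f (iter i G z)
    = \sum_(j < n) f (iter j G (iter i G z)) + f (iter n G (iter i G z)).
  rewrite addrC -(big_ord_recr n (fun j => f (iter j G (iter i G z)))) big_ord_recl.
  by congr (_ + _); apply: eq_bigr => j _; rewrite [iter i.+1 G z]iterS -iterSr.
apply: (addIr (f (iter i G z))); rewrite shift -iterD addnC iterD hz.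
by rewrite (iter_addz liftG) f_per.
Qed.

Lemma segment_sum_le z N i n : (i + n <= N)%N ->
  \sum_(j < n) f (iter j G (iter i G z)) <= \sum_(j < N) f (iter j G z).
Proof.
move=> h; rewrite -(subnKC h) !big_split_ord /= -addrA addrCA.
under eq_bigr => j _ do rewrite -iterD addnC.
by rewrite lerDl addr_ge0 // sumr_ge0.
Qed.

Hypothesis small_average : forall e, 0 < e -> exists z n (M : int),
  [/\ (0 < n)%N, iter n G z = z + M%:~R & \sum_(i < n) f (iter i G z) <= n%:R * e].

(** Summing over all starting points of a closed orbit counts each of its points [N] times, so the
    mean segment sum is at most [N * tau / N.+1]. *)
Lemma small_segment N tau : 0 < tau -> exists x, \sum_(i < N) f (iter i G x) <= tau.
Proof.
move=> tau0; have N0 : 0 < N.+1%:R :> R by rewrite ltr0n.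
have [z [n [M [n0 hz hs]]]] := small_average (divr_gt0 tau0 N0).
apply: contrapT => no.
have h (j : 'I_n) : true -> tau <= \sum_(i < N) f (iter i G (iter j G z)).
  by move=> _; rewrite leNgt; apply/negP => /ltW h; apply: no; exists (iter j G z).
have : \sum_(j < n) tau <= \sum_(j < n) \sum_(i < N) f (iter i G (iter j G z)).
  exact: ler_sum.
rewrite sumr_const card_ord exchange_big /=.
under eq_bigr => i _ do (under eq_bigr => j _ do rewrite -iterD addnC iterD; rewrite (cyclic_sum _ hz)).
rewrite sumr_const card_ord -mulr_natl -[X in _ <= X]mulr_natl leNgt; case/negP.
apply: le_lt_trans (ler_wpM2l (ler0n _ _) hs) _.
rewrite mulrCA ltr_pM2l ?ltr0n // mulrA ltr_pdivrMr // mulrC ltr_pM2l //.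
by rewrite ltr_nat.
Qed.

Definition letter q (x : R) : 'I_q.+1 := inord (Num.trunc (q.+1%:R * frac x)).

Lemma same_letter q x y : letter q x = letter q y ->
  exists k : int, `|x - y - k%:~R| < q.+1%:R^-1.
Proof.
have q0 : 0 < q.+1%:R :> R by rewrite ltr0n.
have t0 u : 0 <= q.+1%:R * frac u :> R by rewrite mulr_ge0 // ?frac_ge0 // ltW.
have tq u : (Num.trunc (q.+1%:R * frac u : R) < q.+1)%N.
  by rewrite truncn_lt_nat // -[ltRHS]mulr1 ltr_pM2l // frac_lt1.
move=> /(congr1 val) /=; rewrite !inordK // => e.
have /andP[a1 a2] := truncn_itv (t0 x); have /andP[b1 b2] := truncn_itv (t0 y).
have [k hk] := frac_ex x; have [l hl] := frac_ex y; exists (l - k).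
have -> : x - y - (l - k)%:~R = frac x - frac y by rewrite hk hl intrB; ring.
rewrite -[ltRHS]mul1r ltr_pdivlMr // mulrC -(ger0_norm (ltW q0)) -normrM.
rewrite mulrBr ltr_norml; move: a1 a2 b1 b2; rewrite e -natr1; lra.
Qed.

(** Equal letters give closeness modulo an integer that might change with time. The mesh [1 / q.+1]
    is so fine that the integer found at time 0 serves throughout: a change would be a nonzero
    integer of size below [(L + 1) / q.+1 <= 1]. Expansion on the line then gives the bound. *)
Lemma close_words q n u v : L + 1 <= q.+1%:R ->
  (forall t, (t <= n)%N -> letter q (iter t G u) = letter q (iter t G v)) ->
  exists k : int, lam ^+ n * `|u - v - k%:~R| <= C.
Proof.
move=> hq h; have q0 : 0 < q.+1%:R :> R by rewrite ltr0n.
have [k hk] := same_letter (h 0%N isT); exists k.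
have hlift t : (t <= n)%N -> `|iter t G u - iter t G (v + k%:~R)| < q.+1%:R^-1.
  elim: t => [_|t IH tn]; first by rewrite /= opprD addrA.
  have h1 := rl_lip rG (iter t G u) (iter t G (v + k%:~R)).
  have [l] := same_letter (h _ tn).
  have -> : iter t.+1 G v = iter t.+1 G (v + k%:~R) - (d ^+ t.+1 * k)%:~R.
    by rewrite (iter_addz liftG) addrK.
  set X := iter t.+1 G u; set Y := iter t.+1 G _ => h2.
  have {}h1 : `|X - Y| <= L * q.+1%:R^-1.
    apply: le_trans h1 _; rewrite ler_wpM2l //; last by rewrite ltW // IH // ltnW.
    have := rl_lip rG 1 0; rewrite subr0 normr1 mulr1; exact: le_trans.
  suff e0 : (d ^+ t.+1 * k) - l = 0.
    move: h2; have -> : X - (Y - (d ^+ t.+1 * k)%:~R) - l%:~R = X - Y + ((d ^+ t.+1 * k) - l)%:~R.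
      by rewrite intrB; ring.
    by rewrite e0 addr0.
  set m := _ - l; have hm : `|m%:~R : R| < 1.
    have -> : m%:~R = (X - (Y - (d ^+ t.+1 * k)%:~R) - l%:~R) - (X - Y).
      by rewrite /m intrB; ring.
    apply: le_lt_trans (ler_normB _ _) _.
    apply: lt_le_trans (ltr_leD h2 h1) _.
    by rewrite -[X in X + _]mul1r -mulrDl ler_pdivrMr // mul1r addrC.
  by move: hm; rewrite -intr_norm -[1]/(1%:~R) ltr_int; clearbody m; clear -m; lia.
rewrite -addrA -opprD.
apply: (@le_trans _ _ (lam ^+ n * D u (v + k%:~R))).
  by rewrite ler_wpM2l ?exprn_ge0 ?(ltW lam0) // (rl_lb rG).
apply: le_trans (rl_iter_exp rG _ _ _) _; apply: le_trans (rl_ub rG _ _) _.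
rewrite -[leRHS]mulr1 ler_wpM2l // ltW //; apply: lt_le_trans (hlift _ (leqnn _)) _.
by rewrite invf_le1 // ler1n.
Qed.

(** Words of length [n] close up at a cost of order [mu ^ (- n)], with [mu = lam ^ chi], while the
    period is at most of order [w ^ (2 n)]. Since [w ^ (2 A + 1) = mu], the product of [p ^ A] and
    the cost is of order [w ^ (- n)]. *)
Lemma start_orbit A tau : 0 < tau -> exists z p (M : int),
  [/\ (0 < p)%N, iter p G z = z + M%:~R &
      p%:R ^+ A * \sum_(i < p) f (iter i G z) <= tau].
Proof.
move=> tau0; have mu_gt1 := mu1; set mu := lam `^ chi in mu_gt1.
have mu0 : 0 <= mu by exact: powR_ge0.
pose b : R := (A.*2.+1)%:R.
have b0 : 0 < b by rewrite ltr0n.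
pose w := mu `^ b^-1.
have wE : w ^+ A.*2.+1 = mu by rewrite -powR_mulrn ?powR_ge0 // -powRrM mulVf ?powRr1 ?lt0r_neq0.
have w1 : 1 < w.
  rewrite ltNge; apply/negP => w1; have : w ^+ A.*2.+1 <= 1 by rewrite exprn_ile1 ?powR_ge0.
  by rewrite wE leNgt mu_gt1.
have w0 : 0 < w := lt_trans ltr01 w1.
pose q := Num.trunc (L + 1).
have hq : L + 1 <= q.+1%:R by rewrite ltW // truncnS_gt.
pose c1 := (expR 1 + 1) / (w - 1).
have c10 : 0 <= c1.
  by apply: divr_ge0; [rewrite addr_ge0 // expR_ge0|rewrite subr_ge0 ltW].
(* By Bernoulli's inequality the factor [n] is at most [w ^ n / (w - 1)]. *)
have cnt n : (block_count w n * n)%:R <= c1 * w ^+ n.*2.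
  have bn := block_count_le w1 n; have be := bernoulli n w1.
  rewrite natrM -addnn exprD /c1 mulrA mulrAC -mulrA mulrACA.
  apply: ler_pM => //; rewrite ?ler0n // mulrC ler_pdivlMr ?subr_gt0 //; lra.
pose c3 := Kf / (mu - 1) * ((C * (C * lam)) `^ chi *+ 2).
have kk0 : 0 <= Kf / (mu - 1) by rewrite divr_ge0 // subr_ge0 ltW.
have c30 : 0 <= c3 by rewrite mulr_ge0 // mulrn_wge0 // powR_ge0.
have err n delta : (0 < n)%N -> delta = C / lam ^+ n.-1 ->
    Kf / (mu - 1) * ((C * delta) `^ chi *+ 2) = c3 / mu ^+ n.
  case: n => // n _ ->; rewrite /c3 -!mulrA; congr (_ * (_ * _)).
  have -> : C * (C / lam ^+ n) = C * (C * lam) * lam ^- n.+1.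
    by rewrite exprS; field; rewrite !lt0r_neq0 // exprn_gt0.
  have l0 : 0 <= lam ^- n.+1 by rewrite invr_ge0 exprn_ge0 // ltW.
  rewrite powRM ?mulr_ge0 ?(ltW lam0) // mulrnAl; congr (_ * _ *+ 2).
  by rewrite powRV ?exprn_ge0 ?(ltW lam0) // powR_exprn // ltW.
have [n1 hn1] := expr_unbounded (c1 ^+ A * c3 * 2 / tau) w1.
have [N hN] := short_pseudo_cycle w1 q.+1 (ltn0Sn n1).
(* [N] is fixed by now and bounds the period by [2 N], so the action of the starting segment can be
   made negligible whichever [n] the counting yields. *)
pose tau' := tau / 2 / ((N.*2.+1)%:R ^+ A * 2).
have NA0 : 0 < (N.*2.+1)%:R ^+ A * 2 :> R by rewrite mulr_gt0 ?exprn_gt0 ?ltr0n.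
have tau'0 : 0 < tau' by rewrite !divr_gt0.
have [x hx] := small_segment N tau'0.
have [n n1n jumps] := hN _ (fun i => letter q (iter i G x)) (card_ord _).
have n0 : (0 < n)%N by apply: leq_trans n1n.
pose delta := C / lam ^+ n.-1.
have closeP i i' : word (fun i => letter q (iter i G x)) n i = word (fun i => letter q (iter i G x)) n i' ->
    exists k : int, `|iter i G x - iter i' G x - k%:~R| <= delta.
  move=> /wordP h; have [|k hk] := @close_words q n.-1 (iter i G x) (iter i' G x) hq.
    by move=> t tn; rewrite -!iterD ![(t + _)%N]addnC h // -(prednK n0) ltnS.
  by exists k; rewrite ler_pdivlMr ?exprn_gt0 // mulrC.
have final p S : (p <= block_count w n * n)%N -> (p <= N.*2)%N ->
    S <= tau' *+ 2 + Kf / (mu - 1) * ((C * delta) `^ chi *+ 2) -> p%:R ^+ A * S <= tau.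
  move=> p1 p2 hS; have p0 : 0 <= p%:R ^+ A :> R by rewrite exprn_ge0.
  apply: le_trans (ler_wpM2l p0 hS) _; rewrite mulrDr (err n) //.
  have h1 : p%:R ^+ A * (tau' *+ 2) <= tau / 2.
    have -> : tau / 2 = (N.*2.+1)%:R ^+ A * (tau' *+ 2).
      by rewrite /tau' -mulr_natr; field; rewrite lt0r_neq0 // exprn_gt0 // ltr0n.
    rewrite ler_wpM2r ?mulrn_wge0 ?(ltW tau'0) // lerXn2r ?nnegrE ?ler0n // ler_nat.
    exact: leq_trans p2 _.
  have h2 : p%:R ^+ A * (c3 / mu ^+ n) <= tau / 2.
    apply: (@le_trans _ _ ((c1 * w ^+ n.*2) ^+ A * (c3 / mu ^+ n))).
      apply: ler_wpM2r; first by rewrite divr_ge0 // exprn_ge0.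
      have cw0 : 0 <= c1 * w ^+ n.*2 by apply: mulr_ge0 => //; rewrite exprn_ge0 // ltW.
      apply: lerXn2r; rewrite ?nnegrE ?ler0n //.
      by apply: (le_trans _ (cnt n)); rewrite ler_nat.
    have -> : (c1 * w ^+ n.*2) ^+ A * (c3 / mu ^+ n) = c1 ^+ A * c3 / w ^+ n.
      rewrite -wE -exprM exprMn -exprM mulSn exprD.
      have -> : (n.*2 * A = A.*2 * n)%N by rewrite -!doubleMl mulnC.
      by field; rewrite !expf_neq0 // lt0r_neq0.
    rewrite ler_pdivrMr ?exprn_gt0 //.
    have : c1 ^+ A * c3 * 2 / tau <= w ^+ n.
      by apply: le_trans (ltW hn1) _; rewrite ler_weXn2l ?(ltW w1) // ltnW.
    rewrite ler_pdivrMr //; lra.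
  lra.
have le1 (u v t : nat) : (u + v + t <= N)%N -> (u + v <= N)%N by clear; lia.
have le2 (u v t : nat) : (u + v + t <= N)%N -> (v <= N.*2)%N by clear; lia.
have le3 (u v t u' v' t' : nat) : (u + v + t <= N)%N -> (u' + v' + t' <= N)%N -> (v + v' <= N.*2)%N.
  by clear; lia.
case: jumps => [[i [m [m0 mk iN /closeP [k hk]]]]|[i [i' [m [m' [[m0 m'0 mk] [iN i'N] /closeP [k hk] /closeP [k' hk']]]]]]].
  have mn0 : (0 < m * n)%N by rewrite muln_gt0 m0.
  rewrite addnC iterD in hk.
  have [z [M [hz hs]]] := closing_one chi01 rG f_per f_holder mn0 hk.
  exists z, (m * n)%N, M; split => //; apply: final; rewrite ?leq_mul2r ?mk ?orbT ?(le2 _ _ _ iN) //.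
  have seg : \sum_(j < m * n) f (iter j G (iter i G x)) <= tau'.
    by apply: le_trans (segment_sum_le _ (le1 _ _ _ iN)) hx.
  have e0 : 0 <= Kf / (mu - 1) * (C * delta) `^ chi.
    by rewrite mulr_ge0 // powR_ge0.
  move: hs; rewrite ler_norml => /andP[_]; rewrite -/mu mulrnAr !mulr2n; lra.
rewrite addnC iterD in hk; rewrite addnC iterD in hk'.
have mn0 : (0 < m * n)%N by rewrite muln_gt0 m0.
have mn'0 : (0 < m' * n)%N by rewrite muln_gt0 m'0.
have [z [M [hz hs]]] := closing_two chi01 rG f_per f_holder mn0 mn'0 hk hk'.
exists z, (m * n + m' * n)%N, M; split => //; first by rewrite addn_gt0 mn0.
apply: final; [by rewrite -mulnDl leq_mul2r mk orbT|exact: le3 iN i'N|].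
have seg : \sum_(j < m * n) f (iter j G (iter i G x)) <= tau'.
  by apply: le_trans (segment_sum_le _ (le1 _ _ _ iN)) hx.
have seg' : \sum_(j < m' * n) f (iter j G (iter i' G x)) <= tau'.
  by apply: le_trans (segment_sum_le _ (le1 _ _ _ i'N)) hx.
move: hs; rewrite ler_norml => /andP[_]; rewrite -/mu [tau' *+ 2]mulr2n; lra.
Qed.

Lemma good_orbit kappa r0 : 0 < kappa -> 0 < r0 -> exists z p (M : int) r,
  [/\ (0 < p)%N, iter p G z = z + M%:~R, 0 < r <= r0,
      forall i j (k : int), (i < j < p)%N -> 4 * r <= `|iter i G z - iter j G z - k%:~R| &
      \sum_(i < p) f (iter i G z) <= kappa * r `^ chi].
Proof.
move=> ka0 r00.
(* Closing up at distance [4 * r] costs [(B - 1) * sg] when [kappa * r ^ chi = sg], so a halving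
   multiplies the bound on the action by at most [B]; [A] is taken with [B < 2 ^ A]. *)
pose B := 1 + Kf / (lam `^ chi - 1) * (C * 4) `^ chi / kappa.
have [A hA] := expr_unbounded B (ltr1n R 2).
pose T := kappa * r0 `^ chi.
have T0 : 0 < T by rewrite mulr_gt0 ?powR_gt0.
(* The action itself might vanish; a positive upper bound [sg] keeps the radius positive. The
   condition [p ^ A * sg <= T] survives each halving, and [T] is such that it forces [r <= r0]. *)
suff claim p : forall z (M : int) sg, (0 < p)%N -> iter p G z = z + M%:~R -> 0 < sg ->
    \sum_(i < p) f (iter i G z) <= sg -> p%:R ^+ A * sg <= T -> exists z p (M : int) r,
  [/\ (0 < p)%N, iter p G z = z + M%:~R, 0 < r <= r0,
      forall i j (k : int), (i < j < p)%N -> 4 * r <= `|iter i G z - iter j G z - k%:~R| &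
      \sum_(i < p) f (iter i G z) <= kappa * r `^ chi].
  have [z [p [M [p0 hz hs]]]] := start_orbit A T0.
  have pA : 0 < p%:R ^+ A :> R by rewrite exprn_gt0 // ltr0n.
  apply: (claim p z M (T / p%:R ^+ A) p0 hz); first by rewrite divr_gt0.
    by rewrite ler_pdivlMr // mulrC.
  by rewrite mulrCA divff ?mulr1 // lt0r_neq0.
elim/ltn_ind: p => p IH z M sg p0 hz sg0 hs hT.
pose r := (sg / kappa) `^ chi^-1.
have sk0 : 0 < sg / kappa by rewrite divr_gt0.
have rE : r `^ chi = sg / kappa by rewrite -powRrM mulVf ?powRr1 ?lt0r_neq0 // ltW.
have r_gt0 : 0 < r by rewrite powR_gt0.
have rr0 : r <= r0.
  have <- : (r0 `^ chi) `^ chi^-1 = r0 by rewrite -powRrM mulfV ?powRr1 ?lt0r_neq0 // ltW.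
  apply: ge0_ler_powR; rewrite ?nnegrE ?invr_ge0 ?powR_ge0 ?(ltW sk0) ?(ltW chi0) //.
  rewrite ler_pdivrMr // mulrC; apply: le_trans hT.
  by rewrite ler_peMl ?(ltW sg0) // exprn_ege1 // ler1n.
have [sep|] := pselect (forall i j (k : int), (i < j < p)%N -> 4 * r <= `|iter i G z - iter j G z - k%:~R|).
  exists z, p, M, r; split => //; first by rewrite r_gt0.
  by rewrite rE mulrCA divff ?mulr1 // lt0r_neq0.
move=> nsep.
have [i [j [k [/andP[ij jp] hk]]]] : exists i j (k : int), (i < j < p)%N /\ `|iter i G z - iter j G z - k%:~R| <= 4 * r.
  apply: contrapT => no; apply: nsep => i j k ij; rewrite leNgt; apply/negP => /ltW h.
  by apply: no; exists i, j, k.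
(* Both arcs between the two close points close up; the shorter one halves the period. *)
have half a n (l : int) : (0 < n)%N -> (n.*2 <= p)%N ->
    `|iter n G (iter a G z) - iter a G z - l%:~R| <= 4 * r -> exists z p (M : int) r,
  [/\ (0 < p)%N, iter p G z = z + M%:~R, 0 < r <= r0,
      forall i j (k : int), (i < j < p)%N -> 4 * r <= `|iter i G z - iter j G z - k%:~R| &
      \sum_(i < p) f (iter i G z) <= kappa * r `^ chi].
  move=> n0 n2 hl; have [z' [M' [hz' hs']]] := closing_one chi01 rG f_per f_holder n0 hl.
  have B1 : 1 <= B.
    by rewrite lerDl !mulr_ge0 ?invr_ge0 ?powR_ge0 ?subr_ge0 ?(ltW mu1) ?(ltW ka0).
  apply: (IH n _ z' M' (B * sg)) => //; first by move: n0 n2; clear; lia.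
  - by rewrite mulr_gt0 // (lt_le_trans ltr01).
  - have seg : \sum_(i0 < n) f (iter i0 G (iter a G z)) <= sg.
      apply: le_trans hs; rewrite -(cyclic_sum a hz).
      by have := @segment_sum_le (iter a G z) p 0 n; apply; move: n2; clear; lia.
    have e : Kf / (lam `^ chi - 1) * (C * (4 * r)) `^ chi = (B - 1) * sg.
      rewrite mulrA powRM ?mulr_ge0 ?(ltW r_gt0) // rE /B addrAC subrr add0r.
      by rewrite -!mulrA; congr (_ * (_ * (_ * _))); rewrite mulrC.
    move: hs'; rewrite e ler_norml => /andP[_]; lra.
  apply: le_trans hT; rewrite mulrA ler_wpM2r ?(ltW sg0) //.
  apply: (@le_trans _ _ (n%:R ^+ A * 2 ^+ A)).
    by rewrite ler_wpM2l ?exprn_ge0 // ltW.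
  by rewrite -exprMn lerXn2r ?nnegrE ?mulr_ge0 // -natrM ler_nat muln2.
have [h2|h2] := leqP (j - i).*2 p.
  apply: (half i (j - i)%N (- k)); rewrite ?subn_gt0 //.
  rewrite -iterD subnK ?(ltnW ij) // -normrN intrN.
  by have -> : - (iter j G z - iter i G z - - k%:~R) = iter i G z - iter j G z - k%:~R by ring.
(* The complementary arc runs from time [j] to time [i + p], which adds the displacement
   [d ^ i * M]. *)
apply: (half j (p - (j - i))%N (d ^+ i * M + k)); [by move: ij jp; clear; lia|by move: ij jp h2; clear; lia|].
rewrite -iterD; have -> : (p - (j - i) + j = i + p)%N by move: ij jp; clear; lia.
rewrite iterD hz (iter_addz liftG) intrD.
by have -> : iter i G z + (d ^+ i * M)%:~R - iter j G z - ((d ^+ i * M)%:~R + k%:~R) = iter i G z - iter j G z - k%:~R by ring.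
Qed.

End GoodOrbits.

(** * Uniform estimates in the C1 topology *)


Section Derivatives.
Variable R : realType.
Implicit Types (F G f : R -> R).

Lemma two_steps_ge (a b c q : R) : `|a - b| <= q -> `|b - c| <= q -> c - 2 * q <= a.
Proof. by rewrite !ler_norml => /andP[h1 _] /andP[h2 _]; lra. Qed.

Lemma expR_half_le (a b : R) : a - ln 2 <= b -> expR a <= 2 * expR b.
Proof.
have {2}<- : expR (ln 2) = 2 :> R by rewrite lnK // posrE.
by rewrite -expRD ler_expR lerBlDl.
Qed.

Lemma derive1_is_derive f x : derivable f x 1 -> is_derive x 1 f (derive1 f x).
Proof. by move=> /derivableP; rewrite derive1E. Qed.

Lemma mean_value f x y : (forall t, derivable f t 1) ->
  exists c, f x - f y = derive1 f c * (x - y).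
Proof.
move=> df; have dc a b : {within `[a, b], continuous f}.
  apply: derivable_within_continuous => t _; exact: df.
have w a b : a < b -> exists c, f b - f a = derive1 f c * (b - a).
  move=> ab; have [|c _ ->] := MVT ab (f := f) (df := derive1 f) _ (dc a b).
    by move=> t _; exact: derive1_is_derive.
  by exists c.
have [xy|xy|->] := ltgtP x y; last by exists y; rewrite !subrr mulr0.
  by have [c h] := w _ _ xy; exists c; rewrite -opprB h -mulrN opprB.
exact: w.
Qed.

Lemma derive1_norm_ge f x c : derivable f x 1 ->
  (forall y, c * `|x - y| <= `|f x - f y|) -> c <= `|derive1 f x|.
Proof.
move=> df hc.
have dq : cvg (h^-1 *: (f (h + x) - f x) @[h --> 0^']).
  suff <- : (fun h : R => h^-1 *: ((f \o shift x) (h *: 1) - f x)) =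
    (fun h => h^-1 *: (f (h + x) - f x)) by exact: df.
  by apply/funext => h; rewrite /= [h *: _]mulr1.
rewrite /derive1 -(lim_norm dq); apply: limr_ge; first exact: is_cvg_norm.
near=> t; have t0 : t != 0 by near: t; exact: nbhs_dnbhs_neq.
rewrite normrZ normfV ler_pdivlMl ?normr_gt0 // mulrC distrC.
by have := hc (t + x); rewrite opprD addrCA subrr addr0 normrN.
Unshelve. all: by end_near. Qed.

Lemma is_derive_iter G n (x : R) : (forall t, derivable G t 1) ->
  is_derive x 1 (iter n G) (\prod_(i < n) derive1 G (iter i G x)).
Proof.
move=> dG; elim: n => [|n IH]; first by rewrite big_ord0; exact: is_derive_id.
rewrite big_ord_recr /= mulrC.
have := is_derive1_comp (derive1_is_derive (dG (iter n G x))) IH.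
by congr is_derive.
Qed.

Lemma ln_lipschitz (m a b : R) : 0 < m -> m <= a -> m <= b -> `|ln a - ln b| <= `|a - b| / m.
Proof.
move=> m0; suff w (u v : R) : m <= u -> m <= v -> ln u - ln v <= `|u - v| / m.
  by move=> ma mb; rewrite ler_norml lerNl opprB w // distrC w.
move=> mu mv; have u0 := lt_le_trans m0 mu; have v0 := lt_le_trans m0 mv.
rewrite -ln_div ?posrE //.
have -> : u / v = 1 + (u - v) / v by field; rewrite lt0r_neq0.
apply: le_trans (le_ln1Dx _) _.
  by rewrite mulrBl divff ?lt0r_neq0 // ltrBrDl subrr divr_gt0.
apply: (@le_trans _ _ (`|u - v| / v)); first by rewrite ler_pM2r ?invr_gt0 // ler_norm.
by rewrite ler_wpM2l // lef_pV2 // posrE.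
Qed.

End Derivatives.

Section Closeness.
Variables (R : realType) (chi : R).
Hypothesis chi01 : 0 < chi <= 1.
Implicit Types (F G H : R -> R).
Let chi0 : 0 < chi. Proof. by case/andP: chi01. Qed.

Definition lnd G x : R := ln `|derive1 G x|.

Lemma derive1_per1 G : is_lift G -> per1 (derive1 G).
Proof.
move=> [d liftG] x k; rewrite /derive1.
suff -> : (fun h : R => h^-1 *: (G (h + (x + k%:~R)) - G (x + k%:~R))) =
  (fun h => h^-1 *: (G (h + x) - G x)) by [].
apply/funext => h; congr (_ *: _).
by rewrite addrA !(lift_addz liftG) opprD addrACA subrr addr0.
Qed.

Lemma lnd_per1 G : is_lift G -> per1 (lnd G).
Proof. by move=> /derive1_per1 h x k; rewrite /lnd h. Qed.

(** The distance [dC1chi] with its three parts bounded separately by a real number; [dC1chi_close]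
    and [close_dC1chi] show that this changes it by a factor of at most 3. *)
Definition close eta G F := [/\ forall x, circ_dist (G x) (F x) <= eta,
  forall x, `|derive1 G x - derive1 F x| <= eta &
  forall x y, `|(derive1 G x - derive1 F x) - (derive1 G y - derive1 F y)|
                <= eta * circ_dist x y `^ chi].

Lemma close_trans e1 e2 G F H : close e1 G F -> close e2 F H -> close (e1 + e2) G H.
Proof.
move=> [a1 a2 a3] [b1 b2 b3]; split=> [x|x|x y].
- exact: le_trans (circ_dist_triangle _ (F x) _) (lerD (a1 x) (b1 x)).
- by rewrite -(subrKA (derive1 F x)); apply: le_trans (ler_normD _ _) (lerD (a2 x) (b2 x)).
rewrite mulrDl; apply: le_trans (lerD (a3 x y) (b3 x y)); apply: le_trans (ler_normD _ _).
by rewrite le_eqVlt; apply/orP; left; apply/eqP; congr `|_|; ring.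
Qed.

Lemma close_mono e1 e2 G F : e1 <= e2 -> close e1 G F -> close e2 G F.
Proof.
move=> e [a1 a2 a3]; split=> [x|x|x y]; try exact: le_trans e.
by apply: le_trans (a3 x y) _; rewrite ler_wpM2r ?powR_ge0.
Qed.

Lemma close_refl e F : 0 <= e -> close e F F.
Proof.
move=> e0; split=> [x|x|x y]; rewrite ?circ_distxx ?subrr ?normr0 //.
by rewrite mulr_ge0 // powR_ge0.
Qed.

Lemma dC1chi_close e G F : is_lift G -> is_lift F ->
  (dC1chi chi G F < e%:E)%E -> close e G F.
Proof.
move=> lG lF; rewrite /dC1chi; set A : \bar R := ereal_sup _; set B : \bar R := ereal_sup _; set D : \bar R := ereal_sup _.
move=> h.
have A0 : (0%:E <= A)%E.
  by apply: (@le_trans _ _ ((circ_dist (G 0) (F 0))%:E)); [rewrite lee_fin circ_dist_ge0|apply: ereal_sup_ubound; exists 0].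
have B0 : (0%:E <= B)%E.
  by apply: (@le_trans _ _ ((`|derive1 G 0 - derive1 F 0| : R)%:E)); [rewrite lee_fin|apply: ereal_sup_ubound; exists 0].
have D0 : (0%:E <= D)%E.
  (* A pair at positive distance shows that the third supremum is not taken over the empty set,
     where it would be [-oo]. *)
  have c2 : circ_dist (2^-1 : R) 0 != 0.
    rewrite /circ_dist subr0 frac_id; last by apply/andP; split; lra.
    by have -> : 1 - 2^-1 = 2^-1 :> R; [lra|rewrite minxx invr_neq0].
  apply: le_trans (ereal_sup_ubound (ex_intro2 _ _ (2^-1, 0) c2 erefl)).
  by rewrite lee_fin divr_ge0 // powR_ge0.
have [hA hB hD] : [/\ (A <= e%:E)%E, (B <= e%:E)%E & (D <= e%:E)%E].
  split; apply: le_trans (ltW h).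
  - by rewrite -addeA leeDl // adde_ge0.
  - by rewrite addeAC leeDr // adde_ge0.
  - by rewrite leeDr // adde_ge0.
split=> [x|x|x y].
- by rewrite -lee_fin; apply: le_trans hA; apply: ereal_sup_ubound; exists x.
- by rewrite -lee_fin; apply: le_trans hB; apply: ereal_sup_ubound; exists x.
(* Pairs at distance 0 are left out of the supremum; they differ by an integer, and periodicity
   settles them. *)
have [c0|c0] := eqVneq (circ_dist x y) 0.
  have [k] := circ_dist_ex x y; rewrite c0 => /esym/eqP; rewrite normr_eq0 => /eqP hk.
  have -> : x = y + k%:~R by rewrite -[x](subrK y) -[x - y](subrK k%:~R) hk add0r addrC.
  by rewrite !derive1_per1 // subrr normr0 mulr_ge0 ?powR_ge0 // -lee_fin (le_trans A0).
have cp : 0 < circ_dist x y `^ chi by rewrite powR_gt0 // lt_def c0 circ_dist_ge0.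
rewrite -ler_pdivrMr // -lee_fin; apply: le_trans hD.
by apply: ereal_sup_ubound; exists (x, y).
Qed.

Lemma close_dC1chi e G F : close e G F -> (dC1chi chi G F <= (e * 3)%:E)%E.
Proof.
move=> [a1 a2 a3]; have -> : (e * 3)%:E = (e%:E + e%:E + e%:E)%E :> \bar R.
  by rewrite -!EFinD; congr (_%:E); ring.
rewrite /dC1chi; apply: leeD; first apply: leeD.
- by apply: ge_ereal_sup => _ [x _ <-]; rewrite lee_fin.
- by apply: ge_ereal_sup => _ [x _ <-]; rewrite lee_fin.
apply: ge_ereal_sup => _ [[x y] /= c0 <-]; rewrite lee_fin ler_pdivrMr //.
by rewrite powR_gt0 // lt_def c0 circ_dist_ge0.
Qed.

Lemma derive1_holder_le F K0 x y : 0 <= K0 ->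
  (forall u v, `|derive1 F u - derive1 F v| <= K0 * circ_dist u v `^ chi) ->
  `|derive1 F x - derive1 F y| <= K0 * `|x - y| `^ chi.
Proof.
move=> K0_ge0 h; apply: le_trans (h x y) _; rewrite ler_wpM2l // le_powR ?circ_dist_ge0 //.
exact: circ_dist_le_norm.
Qed.

Lemma regular_expanding (d : int) L C lam G D : regular_lift d L C lam G D ->
  (forall x, derivable G x 1) -> expanding G.
Proof.
move=> rG dG; have C1 := rl_C1 rG; have C0 : 0 < C := lt_le_trans ltr01 C1.
exists C^-1, lam; rewrite invr_gt0; split => //; split; first exact: rl_lam rG.
move=> n n1 x; apply: derive1_norm_ge.
  by have [] := is_derive_iter n x dG.
move=> y; rewrite -mulrA ler_pdivrMl //.
apply: le_trans (rl_ub rG _ _); apply: le_trans (rl_iter_exp rG _ _ _).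
by rewrite ler_wpM2l ?(rl_lb rG) // exprn_ge0 // ltW // (rl_lam0 rG).
Qed.



Section UniformRegularity.

Lemma nonexp_lift_circ (d : int) G L a b : (forall x, G (x + 1) = G x + d%:~R) ->
  (forall x y, `|G x - G y| <= L * `|x - y|) -> circ_dist (G a) (G b) <= L * circ_dist a b.
Proof.
move=> lG hL; have [k ->] := circ_dist_ex a b.
have -> : a - b - k%:~R = a - (b + k%:~R) by rewrite opprD addrA.
apply: le_trans (hL _ _); rewrite (lift_addz lG) opprD addrA.
exact: circ_dist_le.
Qed.

(* The metric [D] is [sum_{i<N} lam^-i |G^i x - G^i y|]. *)
Lemma adapted_metric (d : int) (G : R -> R) (L lam : R) N :
  (forall x, G (x + 1) = G x + d%:~R) -> (forall x y, `|G x - G y| <= L * `|x - y|) ->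
  1 <= L -> 1 < lam ->
  (forall x y, lam ^+ N.+1 * `|x - y| <= `|iter N.+1 G x - iter N.+1 G y|) ->
  exists D, regular_lift d L (\sum_(i < N.+1) L ^+ i) lam G D.
Proof.
move=> lG hL L1 lam1 hN; have lam0 : 0 < lam := lt_trans ltr01 lam1.
have L0 : 0 <= L := le_trans ler01 L1.
exists (fun x y => \sum_(i < N.+1) lam ^- i * `|iter i G x - iter i G y|).
have lami i : 0 <= lam ^- i by rewrite invr_ge0 exprn_ge0 // ltW.
split => // [x y|y x z|x y k|x y|x y|x y].
- by apply: eq_bigr => i _; rewrite distrC.
- rewrite -big_split; apply: ler_sum => i _ /=; rewrite -mulrDr ler_wpM2l //.
  by rewrite -(subrKA (iter i G y)); exact: ler_normD.
- apply: eq_bigr => i _; rewrite !(iter_addz lG); congr (_ * `|_|); ring.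
- rewrite big_ord_recl /= expr0 invr1 mul1r lerDl.
  by apply: sumr_ge0 => i _; rewrite mulr_ge0.
- rewrite mulr_suml; apply: ler_sum => i _.
  have hi : `|iter i G x - iter i G y| <= L ^+ i * `|x - y|.
    elim: (nat_of_ord i) => [|j IH] /=; first by rewrite expr0 mul1r.
    apply: le_trans (hL _ _) _; rewrite exprS -mulrA ler_wpM2l //.
  apply: le_trans hi; rewrite ler_piMl // invf_le1 ?exprn_gt0 // exprn_ege1 // ltW //.
(* One step of [G] shifts the sum, which accounts for the factor [lam] in all terms but the first;
   that one is dominated by the new last term, by [hN]. *)
rewrite big_ord_recl big_ord_recr /= expr0 invr1 mul1r mulrDr [leLHS]addrC; apply: lerD.
  rewrite mulr_sumr le_eqVlt; apply/orP; left; apply/eqP; apply: eq_bigr => i _.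
  rewrite /bump /= add1n -!iterSr !iterS mulrA; congr (_ * _).
  by rewrite exprS invfM mulrA divff ?mul1r // lt0r_neq0.
rewrite -!iterSr ler_pdivlMl ?exprn_gt0 // mulrA -exprSr.
exact: hN.
Qed.

(** The constants come from [F] alone and serve a whole neighbourhood, so the perturbed map and the
    maps close to it are treated with numbers fixed before these maps are known. *)
Lemma uniform_regularity (F : R -> R) : E1chi chi F -> exists L C lam K m eta0,
  [/\ 0 < eta0, 1 <= L, 0 < m, 0 <= K & forall G, is_lift G -> C1 G -> close eta0 G F ->
    [/\ exists d D, regular_lift d L C lam G D, holder chi K (lnd G) &
      forall x, m <= `|derive1 G x| <= L]].
Proof.
move=> [lF [[dF cF] [[KF0 hKF0] [C0 [l0 [C0_gt0 [l0_gt1 hexp]]]]]]].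
pose KF := `|KF0|; have KF_ge0 : 0 <= KF by exact: normr_ge0.
have hKF x y : `|derive1 F x - derive1 F y| <= KF * circ_dist x y `^ chi.
  by apply: le_trans (hKF0 x y) _; rewrite ler_wpM2r ?powR_ge0 // ler_norm.
pose m1 := C0 * l0; have m1_gt0 : 0 < m1 by rewrite mulr_gt0 // (lt_trans ltr01).
have Fm1 x : m1 <= `|derive1 F x| by have := hexp 1%N isT x; rewrite expr1.
pose L := `|derive1 F 0| + KF + 2.
have FL x : `|derive1 F x| <= L - 1.
  have : `|derive1 F x - derive1 F 0| <= KF.
    apply: le_trans (hKF _ _) _; rewrite -[leRHS]mulr1 ler_wpM2l //.
    have -> : 1 = 1 `^ chi :> R by rewrite powR1.
    by rewrite le_powR ?circ_dist_ge0 ?circ_dist_le1.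
  have := ler_normD (derive1 F x - derive1 F 0) (derive1 F 0); rewrite subrK /L; lra.
have L1 : 1 <= L by rewrite /L; have := normr_ge0 (derive1 F 0); lra.
have L0 : 0 <= L := le_trans ler01 L1.
(* A rate strictly between 1 and [l0]: for large [N] the derivative of [iter N.+1 F] is at least
   [2 * lam ^ N.+1], and the factor 2 pays for the passage to [G]. *)
pose lam := (1 + l0) / 2.
have lam1 : 1 < lam by rewrite /lam; lra.
have lam0 : 0 < lam := lt_trans ltr01 lam1.
have w1 : 1 < l0 / lam by rewrite ltr_pdivlMr // mul1r /lam; lra.
have [N hN] := expr_unbounded (2 / C0) w1.
have hexpN x : 2 * lam ^+ N.+1 <= `|derive1 (iter N.+1 F) x|.
  apply: le_trans (hexp N.+1 isT x); rewrite -ler_pdivlMr ?exprn_gt0 // -mulrA -expr_div_n.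
  rewrite -ler_pdivrMl // mulrC; apply: le_trans (ltW hN) _.
  by rewrite ler_weXn2l // ltW.
pose m := m1 / 2; have m0 : 0 < m by rewrite divr_gt0.
pose K := (KF + 1) / m; have K0 : 0 <= K by rewrite divr_ge0 ?addr_ge0 // ltW.
(* [eta0 * T n] bounds the distance between the [n]-th iterates of a point under [G] and [F]. *)
pose T := fix T n : R := if n is k.+1 then 1 + L * T k else 0.
have T0 n : 0 <= T n by elim: n => //= n IH; rewrite addr_ge0 // mulr_ge0.
pose TN := \sum_(i < N.+1) T i + 1.
have TN0 : 0 < TN by rewrite ltr_wpDl // sumr_ge0.
have TTN i : (i < N.+1)%N -> T i <= TN.
  move=> iN; rewrite /TN (bigD1 (Ordinal iN)) //= -addrA lerDl addr_ge0 // sumr_ge0 //.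
(* Each of the [N.+1] factors of the derivative may lose [2 * q] in its logarithm, [ln 2]
   altogether: one [q] for the change of derivative, one for the distance of the orbits. *)
pose q := ln 2 / (2 * N.+1%:R) : R.
have ln2_gt0 : 0 < ln 2 :> R by rewrite ln_gt0 // ltr1n.
have q0 : 0 < q by rewrite divr_gt0 // mulr_gt0 // ltr0n.
pose eta0 := Num.min (Num.min 1 m) (Num.min (m * q) ((q / (K + 1)) `^ chi^-1 / TN)).
have qK0 : 0 < q / (K + 1) by rewrite divr_gt0 // ltr_wpDl.
have eta0_gt0 : 0 < eta0 by rewrite !lt_min ltr01 m0 (mulr_gt0 m0 q0) divr_gt0 // powR_gt0.
have eta_1 : eta0 <= 1 by rewrite !ge_min lexx.
have eta_m : eta0 <= m by rewrite !ge_min lexx orbT.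
have eta_q : eta0 <= m * q by rewrite !ge_min lexx ?orbT.
have eta_T : K * (eta0 * TN) `^ chi <= q.
  have : eta0 * TN <= (q / (K + 1)) `^ chi^-1 by rewrite -ler_pdivlMr // !ge_min lexx ?orbT.
  move=> /(le_powR chi01 (mulr_ge0 (ltW eta0_gt0) (ltW TN0))).
  rewrite -powRrM mulVf ?powRr1 ?(ltW qK0) ?lt0r_neq0 // => h.
  apply: le_trans (ler_wpM2l K0 h) _; rewrite mulrCA ler_piMr ?(ltW q0) //.
  by rewrite ler_pdivrMr ?ltr_wpDl // mul1r lerDl.
exists L, (\sum_(i < N.+1) L ^+ i), lam, K, m, eta0; split => // G lG [dG cG] [cl1 cl2 cl3].
have hm x : m <= `|derive1 G x|.
  have := ler_normB (derive1 G x) (derive1 G x - derive1 F x); rewrite subKr.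
  have := Fm1 x; have := le_trans (cl2 x) eta_m; rewrite /m; lra.
have hL x : `|derive1 G x| <= L.
  have := ler_normD (derive1 G x - derive1 F x) (derive1 F x); rewrite subrK.
  have := FL x; have := le_trans (cl2 x) eta_1; lra.
have Fm x : m <= `|derive1 F x| by have := Fm1 x; rewrite /m; lra.
have lndF x y : `|lnd F x - lnd F y| <= K * circ_dist x y `^ chi.
  apply: le_trans (ln_lipschitz m0 (Fm x) (Fm y)) _; rewrite /K -mulrA [_^-1 * _]mulrC mulrA.
  rewrite ler_pM2r ?invr_gt0 //; apply: le_trans (ler_dist_dist _ _) _.
  by apply: le_trans (hKF x y) _; rewrite ler_wpM2r ?powR_ge0 // lerDl.
have lip x y : `|G x - G y| <= L * `|x - y|.
  by have [c ->] := mean_value x y dG; rewrite normrM ler_wpM2r.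
have lipF x y : `|F x - F y| <= L * `|x - y|.
  have [c ->] := mean_value x y dF; rewrite normrM ler_wpM2r //.
  by apply: le_trans (FL c) _; rewrite gerBl.
have [dd lGd] := lG; have [ddF lFd] := lF.
have orb x i : circ_dist (iter i G x) (iter i F x) <= eta0 * T i.
  elim: i => [|i IH] /=; first by rewrite circ_distxx mulr0.
  apply: le_trans (circ_dist_triangle _ (F (iter i G x)) _) _.
  rewrite mulrDr mulr1 mulrCA; apply: lerD => //.
  by apply: le_trans (nonexp_lift_circ _ _ lFd lipF) _; rewrite ler_wpM2l.
have term x (i : 'I_N.+1) : lnd F (iter i F x) - 2 * q <= lnd G (iter i G x).
  have h1 : `|lnd G (iter i G x) - lnd F (iter i G x)| <= q.
    apply: le_trans (ln_lipschitz m0 (hm _) (Fm _)) _; rewrite ler_pdivrMr // mulrC.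
    by apply: le_trans (ler_dist_dist _ _) _; apply: le_trans (cl2 _) eta_q.
  have h2 : `|lnd F (iter i G x) - lnd F (iter i F x)| <= q.
    apply: le_trans (lndF _ _) _; apply: le_trans eta_T; rewrite ler_wpM2l // le_powR ?circ_dist_ge0 //.
    by apply: le_trans (orb x i) _; rewrite ler_wpM2l ?(ltW eta0_gt0) // TTN.
  exact: two_steps_ge h1 h2.
have prodE H : (forall t, m <= `|derive1 H t|) -> (forall t, derivable H t 1) -> forall x,
    `|derive1 (iter N.+1 H) x| = expR (\sum_(i < N.+1) lnd H (iter i H x)).
  move=> Hm dH x; have [_] := is_derive_iter N.+1 x dH; rewrite derive1E => ->.
  rewrite normr_prod expR_sum; apply: eq_bigr => i _; rewrite lnK // posrE.
  exact: lt_le_trans (Hm _).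
have DGN x : lam ^+ N.+1 <= `|derive1 (iter N.+1 G) x|.
  rewrite (prodE G hm dG); have := hexpN x; rewrite (prodE F Fm dF) => h.
  have h2 : \sum_(i < N.+1) lnd F (iter i F x) - ln 2 <= \sum_(i < N.+1) lnd G (iter i G x).
    have -> : ln 2 = \sum_(i < N.+1) 2 * q.
      rewrite sumr_const card_ord -[RHS]mulr_natr /q.
      by set n : R := N.+1%:R; have n0 : n != 0 by [rewrite pnatr_eq0]; field.
    by rewrite -sumrB; apply: ler_sum => i _; exact: term.
  by have := le_trans h (expR_half_le h2); rewrite ler_pM2l.
split.
- exists dd; apply: adapted_metric => // x y.
  have [|c ->] := @mean_value _ (iter N.+1 G) x y.
    by move=> t; have [] := is_derive_iter N.+1 t dG.
  by rewrite normrM ler_wpM2r.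
- move=> x y; apply: le_trans (ln_lipschitz m0 (hm x) (hm y)) _; rewrite /K -mulrA [_^-1 * _]mulrC mulrA.
  rewrite ler_pM2r ?invr_gt0 //; apply: le_trans (ler_dist_dist _ _) _.
  apply: derive1_holder_le => [|u v]; first by rewrite addr_ge0.
  rewrite -[derive1 G u](subrK (derive1 F u)) -[derive1 G v](subrK (derive1 F v)) opprD addrACA mulrDl mul1r addrC.
  apply: le_trans (ler_normD _ _) _; apply: lerD => //; apply: le_trans (cl3 u v) _.
  by rewrite -[leRHS]mul1r ler_wpM2r ?powR_ge0.
by move=> x; rewrite hm hL.
Qed.

End UniformRegularity.

End Closeness.

(** * Birkhoff sums near a periodic orbit *)


Section Locking.
Variables (R : realType) (chi : R).
Hypothesis chi01 : 0 < chi <= 1.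
Variables (d : int) (L C lam : R) (G : R -> R) (D : R -> R -> R).
Hypothesis rG : regular_lift d L C lam G D.
Hypothesis L1 : 1 <= L.
Let lam1 := rl_lam rG.
Let lam0 := rl_lam0 rG.
Let mu1 : 1 < lam `^ chi := powR_gt1 chi01 lam1.
Let D0 := rl_D0 rG.
Let C1 : 1 <= C := rl_C1 rG.
Let C0 : 0 <= C := le_trans ler01 C1.

Variables (O : set R) (sep s rad : R).
Hypotheses (O_inv : forall a, O a -> O (G a))
  (O_sep : forall a b, O a -> O b -> a <> b -> sep <= `|a - b|)
  (s0 : 0 < s) (s_rad : C * L * s <= rad) (rad_sep : (L + 1) * rad < sep).

Definition far x := forall a, O a -> s < `|x - a|.

Let L0 : 0 <= L := le_trans ler01 L1.
Let ss : s <= rad.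
Proof.
apply: le_trans s_rad; rewrite -[leLHS]mul1r ler_wpM2r ?(ltW s0) //.
by rewrite -[leLHS]mul1r ler_pM.
Qed.
Let rad0 : 0 < rad := lt_le_trans s0 ss.

Let O_eq a b : O a -> O b -> `|a - b| < sep -> a = b.
Proof.
move=> Oa Ob h; apply: contrapT => ne.
by have := lt_le_trans h (O_sep Oa Ob ne); rewrite ltxx.
Qed.

(** The points [b] and [G a] of [O] are at distance at most [(L + 1) * rad], which is below the
    separation. *)
Let track x a b : O a -> O b -> `|x - a| <= rad -> `|G x - b| <= rad -> b = G a.
Proof.
move=> Oa Ob h1 h2; apply: O_eq => //; first exact: O_inv.
apply: le_lt_trans rad_sep; rewrite -(subrKA (G x)) mulrDl mul1r addrC.
apply: le_trans (ler_normD _ _) _; apply: lerD; last by rewrite distrC.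
by apply: le_trans (rl_lip rG _ _) _; rewrite ler_wpM2l.
Qed.

(** By [track] the nearby points of [O] form an orbit, and two orbits that stay within [s] of each
    other forever coincide by expansion. *)
Lemma never_far_orbit x : (forall i, ~ far (iter i G x)) -> O x.
Proof.
move=> nf.
have /choice [a ha] : forall i, exists a, O a /\ `|iter i G x - a| <= s.
  move=> i; apply: contrapT => no; apply: (nf i) => a Oa.
  by rewrite ltNge; apply/negP => h; apply: no; exists a.
have aE i : a i = iter i G (a 0%N).
  elim: i => //= i <-; apply: (@track (iter i G x)); try exact: (ha _).1.
    exact: le_trans (ha _).2 ss.
  exact: le_trans (ha i.+1).2 ss.
have [Dx|] := eqVneq (D x (a 0%N)) 0.
  suff -> : x = a 0%N by exact: (ha _).1.
  by apply/eqP; rewrite -subr_eq0 -normr_le0 -Dx (rl_lb rG).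
rewrite neq_lt ltNge D0 /= => Dx.
have [n hn] := expr_unbounded (C * s / D x (a 0%N)) lam1.
move: hn; rewrite ltr_pdivrMr // ltNge => /negP[].
apply: le_trans (rl_iter_exp rG _ _ _) _; apply: le_trans (rl_ub rG _ _) _.
by rewrite ler_wpM2l // -aE; exact: (ha n).2.
Qed.

Variables (g : R -> R) (K1 b c0 : R).
Let A := K1 / (lam `^ chi - 1).
Hypotheses (g_holder : forall x y, g y - K1 * `|x - y| `^ chi <= g x)
  (K10 : 0 <= K1) (b0 : 0 <= b) (c00 : 0 <= c0)
  (O_sum : forall n a, O a -> - b <= \sum_(j < n) g (iter j G a))
  (g_far : forall x, (forall a, O a -> s < D x a) -> b + c0 <= g x)
  (g_very_far : forall x, (forall a, O a -> rad < D x a) -> b + A * (lam * s) `^ chi + c0 <= g x).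

Let h x := g x - c0 * (`[< far x >])%:R.

(* While an orbit follows [a], its Birkhoff sum loses at most the part of
   [A * (lam * s) ^ chi] not yet recovered, as measured by its distance to [a];
   the visit outside of the radius [rad] that must follow pays for it. *)
Lemma locking_sum n x :
  - (b + A * (lam * s) `^ chi) <= \sum_(i < n) (g (iter i G x) - c0 * (`[< far (iter i G x) >])%:R).
Proof.
set c := lam * s.
have b_ge0 := b0; have c0_ge0 := c00.
have c_ge0 : 0 <= c by rewrite mulr_ge0 // ltW.
have A0 : 0 <= A by rewrite divr_ge0 // subr_ge0 ltW.
(* This explains [A]: the Hölder loss [K1 * t ^ chi] at distance [t] equals the gain
   [A * ((lam * t) ^ chi - t ^ chi)] made when the distance grows to [lam * t]. *)
have AE : A * (lam `^ chi - 1) = K1 by rewrite divfK // subr_eq0 gt_eqF.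
have Sn m y : \sum_(i < m.+1) h (iter i G y) = h y + \sum_(i < m) h (iter i G (G y)).
  by rewrite big_ord_recl /=; congr (_ + _); apply: eq_bigr => i _; rewrite -iterSr.
have gn m y : \sum_(i < m.+1) g (iter i G y) = g y + \sum_(i < m) g (iter i G (G y)).
  by rewrite big_ord_recl /=; congr (_ + _); apply: eq_bigr => i _; rewrite -iterSr.
have hg y : g y - c0 <= h y.
  by rewrite /h lerD2l lerN2; case: `[< _ >]; rewrite ?mulr1 ?mulr0.
have minc t : 0 <= t -> Num.min t c `^ chi <= c `^ chi.
  by move=> t0; rewrite le_powR ?ge_min ?lexx ?orbT // le_min t0.
(* [k] counts the steps spent within [s] of the followed point; capping the distance at
   [c = lam * s] keeps the debt bounded. An orbit that starts very far away owes nothing. *)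
have claim m : (forall y a, O a -> D y a <= rad -> exists k,
      \sum_(j < k) g (iter j G a) - A * (c `^ chi - Num.min (D y a) c `^ chi)
        <= \sum_(i < m) h (iter i G y)) /\
    (forall y, (forall a, O a -> rad < D y a) -> 0 <= \sum_(i < m) h (iter i G y)).
  elim: m => [|m [IH1 IH2]].
    split=> [y a _ _|y _]; last by rewrite big_ord0.
    by exists 0%N; rewrite !big_ord0 sub0r oppr_le0 mulr_ge0 // subr_ge0 minc.
  have dich y : (exists2 a, O a & D y a <= rad) \/ (forall a, O a -> rad < D y a).
    have [|no] := pselect (exists2 a, O a & D y a <= rad); first by left.
    by right => a Oa; rewrite ltNge; apply/negP => ya; apply: no; exists a.
  split=> [y a Oa ya|y vf]; rewrite Sn; last first.
    (* A visit outside of [rad] pays in advance the full debt of the tracking phase that may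
       follow. *)
    have hy : b + A * c `^ chi <= h y by have := hg y; have := g_very_far vf; lra.
    have [[a Oa ya]|{}vf] := dich (G y).
      have [k hk] := IH1 _ _ Oa ya; have := O_sum k Oa.
      have : 0 <= A * Num.min (D (G y) a) c `^ chi by rewrite mulr_ge0 // powR_ge0.
      by move: hk; rewrite mulrBr; lra.
    have := IH2 _ vf; have : 0 <= A * c `^ chi by rewrite mulr_ge0 // powR_ge0.
    lra.
  have [ts|ts] := leP (D y a) s.
    have hy : h y = g y.
      rewrite /h; case: asboolP => [f|_]; last by rewrite mulr0 subr0.
      by have := lt_le_trans (f a Oa) (le_trans (rl_lb rG y a) ts); rewrite ltxx.
    have Gya : D (G y) (G a) <= rad.
      apply: le_trans (rl_ub rG _ _) _; apply: le_trans s_rad; rewrite -mulrA ler_wpM2l //.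
      apply: le_trans (rl_lip rG _ _) _; rewrite ler_wpM2l //.
      exact: le_trans (rl_lb rG y a) ts.
    have [k hk] := IH1 _ _ (O_inv Oa) Gya; exists k.+1; rewrite gn hy.
    have g1 := g_holder y a.
    have g2 : K1 * `|y - a| `^ chi <= K1 * D y a `^ chi.
      by rewrite ler_wpM2l // le_powR // (rl_lb rG).
    have g3 : A * (lam `^ chi * D y a `^ chi) <= A * Num.min (D (G y) (G a)) c `^ chi.
      rewrite ler_wpM2l // -powRM ?D0 ?(ltW lam0) // le_powR ?mulr_ge0 ?D0 ?(ltW lam0) //.
      by rewrite le_min (rl_exp rG) ler_wpM2l // ltW.
    have g4 : A * Num.min (D y a) c `^ chi <= A * D y a `^ chi.
      by rewrite ler_wpM2l // le_powR ?ge_min ?lexx // le_min D0.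
    have g5 : K1 * D y a `^ chi = A * (lam `^ chi * D y a `^ chi) - A * D y a `^ chi.
      by rewrite -AE; ring.
    by move: hk; rewrite !mulrBr; lra.
  have hy : b <= h y.
    have : b + c0 <= g y.
      apply: g_far => a' Oa'; rewrite ltNge; apply/negP => ya'.
      suff e : a = a' by move: ts; rewrite ltNge e ya'.
      apply: O_eq => //; apply: le_lt_trans rad_sep.
      apply: (@le_trans _ _ (rad + rad)); last by have := ler_wpM2r (ltW rad0) L1; lra.
      rewrite -(subrKA y); apply: le_trans (ler_normD _ _) _.
      rewrite distrC; apply: lerD; first exact: le_trans (rl_lb rG _ _) ya.
      exact: le_trans (rl_lb rG _ _) (le_trans ya' ss).
    by have := hg y; lra.
  (* Between [s] and [rad] the count restarts at 0: the gain [b] of this step covers the worst sum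
     along the followed orbit, and the distance to that orbit does not shrink. *)
  exists 0%N; rewrite big_ord0.
  have [[a' Oa' ya']|vf] := dich (G y).
    have e : a' = G a.
      apply: (@track y) => //; first exact: le_trans (rl_lb rG _ _) ya.
      exact: le_trans (rl_lb rG _ _) ya'.
    have [k hk] := IH1 _ _ Oa' ya'; have := O_sum k Oa'.
    have : A * Num.min (D y a) c `^ chi <= A * Num.min (D (G y) a') c `^ chi.
      rewrite ler_wpM2l // le_powR //; first by rewrite le_min D0.
      rewrite le_min !ge_min lexx orbT andbT e; apply/orP; left.
      apply: le_trans (rl_exp rG _ _); rewrite ler_peMl ?D0 // ltW //.
    move: hk; rewrite !mulrBr; lra.
  have := IH2 _ vf; have := minc _ (D0 y a); rewrite -subr_ge0 => /(mulr_ge0 A0); lra.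
have [[a Oa xa]|vf] := pselect (exists2 a, O a & D x a <= rad).
  have [k hk] := (claim n).1 _ _ Oa xa; have := O_sum k Oa.
  have : 0 <= A * Num.min (D x a) c `^ chi by rewrite mulr_ge0 // powR_ge0.
  by move: hk; rewrite mulrBr /h; lra.
have /((claim n).2) hn : forall a, O a -> rad < D x a.
  by move=> a Oa; rewrite ltNge; apply/negP => xa; apply: vf; exists a.
by apply: le_trans hn; rewrite oppr_le0 addr_ge0 // mulr_ge0 // powR_ge0.
Qed.

End Locking.

Section PeriodicOrbit.
Variables (R : realType) (d : int) (G : R -> R).
Hypothesis liftG : forall x, G (x + 1) = G x + d%:~R.
Variables (z : R) (p : nat) (M : int).
Hypotheses (p0 : (0 < p)%N) (hz : iter p G z = z + M%:~R).

Definition lifted_orbit : set R := [set a | exists i (k : int), a = iter i G z + k%:~R].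

Lemma lifted_orbit_inv a : lifted_orbit a -> lifted_orbit (G a).
Proof. by move=> [i [k ->]]; exists i.+1, (d * k); rewrite (lift_addz liftG). Qed.

Lemma lifted_orbit_addz a (l : int) : lifted_orbit a -> lifted_orbit (a + l%:~R).
Proof. by move=> [i [k ->]]; exists i, (k + l); rewrite intrD addrA. Qed.

Lemma lifted_orbit_lt a : lifted_orbit a ->
  exists i (k : int), (i < p)%N /\ a = iter i G z + k%:~R.
Proof.
move=> [i [k ->]]; elim/ltn_ind: i k => i IH k.
have [ip|pi] := ltnP i p; first by exists i, k.
have ii : (i - p < i)%N by lia.
have [j [l [jp e]]] := IH _ ii (d ^+ (i - p) * M + k).
exists j, l; split => //; rewrite -e -{1}(subnK pi) iterD hz (iter_addz liftG).
by rewrite intrD addrA.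
Qed.

Lemma lifted_orbit_sep sep : sep <= 1 ->
  (forall i j (k : int), (i < j < p)%N -> sep <= `|iter i G z - iter j G z - k%:~R|) ->
  forall a b, lifted_orbit a -> lifted_orbit b -> a <> b -> sep <= `|a - b|.
Proof.
move=> s1 hs a b /lifted_orbit_lt[i [k [ip ->]]] /lifted_orbit_lt[j [l [jp ->]]] ne.
have [ij|ij|ij] := ltngtP i j.
- have := hs i j (l - k); rewrite ij jp => /(_ isT); congr (_ <= `|_|).
  by rewrite intrB; ring.
- have := hs j i (k - l); rewrite ij ip => /(_ isT); rewrite distrC; congr (_ <= `|_|).
  by rewrite intrB; ring.
rewrite {}ij in ne *; rewrite opprD addrACA subrr add0r -intrB -intr_norm.
apply: le_trans s1 _; rewrite -[1]/(1%:~R) ler_int.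
suff : k != l by lia.
by apply: contra_not_neq ne => ->.
Qed.

End PeriodicOrbit.

(** * The perturbation *)


Section Bump.
Variable R : realType.
Implicit Types (t v x y r s : R).

Lemma is_derive_add_fun (f g : R -> R) x (a b : R) : is_derive x 1 f a -> is_derive x 1 g b ->
  is_derive x 1 (fun y => f y + g y) (a + b).
Proof. by move=> df dg; exact: is_deriveD. Qed.

Lemma is_derive_mul_fun (f g : R -> R) x (a b : R) : is_derive x 1 f a -> is_derive x 1 g b ->
  is_derive x 1 (fun y => f y * g y) (a * g x + f x * b).
Proof.
move=> df dg; apply: is_derive_eq (is_deriveM df dg) _.
by rewrite /GRing.scale /= addrC [g x * _]mulrC.
Qed.

Lemma is_derive_scale_fun (c : R) (f : R -> R) x (a : R) : is_derive x 1 f a ->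
  is_derive x 1 (fun y => c * f y) (c * a).
Proof. by move=> df; exact: is_deriveZ. Qed.

Lemma is_derive_pos_sq s : is_derive s 1 (fun s => (Num.max 0 s) ^+ 2) (2 * Num.max 0 s).
Proof.
have [s0|s0|<-] := ltgtP 0 s.
- apply: (@near_eq_is_derive _ _ _ (fun s => s ^+ 2)).
    near=> u; have u0 : 0 < u by near: u; exact: lt_nbhsr.
    by rewrite max_r // ltW.
  apply: is_derive_eq (is_derive_mul_fun (is_derive_id s 1) (is_derive_id s 1)) _.
  by rewrite mul1r mulr1 -mulr2n mulr_natl.
- apply: (@near_eq_is_derive _ _ _ (fun=> 0)).
    near=> u; have u0 : u < 0 by near: u; exact: lt_nbhsl.
    by rewrite max_l ?expr0n // ltW.
  by rewrite mulr0; exact: is_derive_cst.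
rewrite mulr0.
have c : h^-1 *: (((fun s => Num.max 0 s ^+ 2) \o shift 0) (h *: 1) - Num.max 0 0 ^+ 2) @[h --> (0:R)^'] --> (0:R).
  apply: (@cvg_to_0_linear _ _ 1 1) => // u /andP[u0 _].
  rewrite /= maxxx expr0n subr0 addr0 [u *: _]mulr1 mul1r normrZ normfV ler_pdivrMl //.
  rewrite normrX expr2; apply: ler_pM => //;
   by rewrite ger0_norm ?le_max ?lexx // ge_max normr_ge0 ler_norm.
split; first by apply/cvg_ex; exists 0.
exact: cvg_lim c.
Unshelve. all: by end_near. Qed.

(** It vanishes at 0 and its derivative is largest there, equal to 1: subtracting it fixes the orbit
    points and lowers the derivative most at them. The square makes the derivative Lipschitz. *)
Definition bump t := t * (Num.max 0 (1 - t ^+ 2)) ^+ 2.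

(** The derivative of [bump] in terms of [v = min(|t|, 1)]; it vanishes at [v = 1], so one formula
    also covers the outside. *)
Definition slope v := (1 - v ^+ 2) * (1 - 5 * v ^+ 2).

Lemma is_derive_bump t : is_derive t 1 bump (slope (Num.min `|t| 1)).
Proof.
have d1 : is_derive t 1 (fun t => 1 - t ^+ 2) (- (2 * t)).
  have dt := is_derive_mul_fun (is_derive_id t 1) (is_derive_id t 1).
  have -> : (fun t => 1 - t ^+ 2) = (fun t => 1 + (-1) * (t * t)).
    by apply/funext => u; rewrite mulN1r expr2.
  have dc : is_derive t 1 (fun=> 1 : R) 0 by exact: is_derive_cst.
  have ds := is_derive_add_fun dc (is_derive_scale_fun (-1) dt).
  refine (is_derive_eq ds _).
  by rewrite /=; ring.
have d2 := is_derive1_comp (g := fun t => 1 - t ^+ 2) (is_derive_pos_sq _) d1.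
refine (is_derive_eq (is_derive_mul_fun (is_derive_id t 1) d2) _).
rewrite /= /slope.
have [t1|t1] := leP `|t| 1.
  have -> : `|t| ^+ 2 = t ^+ 2 by rewrite -normrX ger0_norm // sqr_ge0.
  rewrite max_r; last by rewrite subr_ge0 -[t ^+ 2]ger0_norm ?sqr_ge0 // normrX expr_le1.
  by ring.
rewrite max_l; first by ring.
by rewrite subr_le0 -[t ^+ 2]ger0_norm ?sqr_ge0 // normrX expr_ge1 // ltW.
Qed.

Lemma bump_norm_le t : `|bump t| <= 1.
Proof.
rewrite /bump; have [t1|t1] := leP `|t| 1.
  rewrite normrM -[leRHS]mulr1; apply: ler_pM => //.
  rewrite ger0_norm ?sqr_ge0 // expr_le1 ?le_max ?lexx //.
  by rewrite ge_max ler01 gerBl sqr_ge0.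
rewrite max_l ?expr0n ?mulr0 ?normr0 //.
by rewrite subr_le0 -[t ^+ 2]ger0_norm ?sqr_ge0 // normrX expr_ge1 // ltW.
Qed.

Lemma bump_eq0 t : 1 <= `|t| -> bump t = 0.
Proof.
move=> t1; rewrite /bump max_l ?expr0n ?mulr0 //.
by rewrite subr_le0 -[t ^+ 2]ger0_norm ?sqr_ge0 // normrX expr_ge1.
Qed.

Lemma slope_le v : 0 <= v <= 1 -> slope v <= 1 - v ^+ 2.
Proof.
move=> /andP[v0 v1]; rewrite /slope -[leRHS]mulr1 ler_wpM2l ?subr_ge0 ?expr_le1 //.
by rewrite gerBl mulr_ge0 // sqr_ge0.
Qed.

Lemma slope_norm_le v : 0 <= v <= 1 -> `|slope v| <= 1.
Proof.
move=> v01; have := slope_le v01; case/andP: v01 => v0 v1 h.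
have v2 : 0 <= v ^+ 2 by rewrite sqr_ge0.
rewrite ler_norml; apply/andP; split; last by lra.
have : 0 <= (v ^+ 2 - 3 / 5) ^+ 2 by rewrite sqr_ge0.
rewrite /slope; lra.
Qed.

Lemma slope_lipschitz u v : 0 <= u <= 1 -> 0 <= v <= 1 -> `|slope u - slope v| <= 32 * `|u - v|.
Proof.
move=> /andP[u0 u1] /andP[v0 v1].
have -> : slope u - slope v = (u - v) * ((u + v) * (5 * (u ^+ 2 + v ^+ 2) - 6)).
  by rewrite /slope; ring.
rewrite normrM mulrC ler_wpM2r // normrM.
have -> : 32 = 2 * 16 :> R by ring.
have u2 : 0 <= u ^+ 2 <= 1 by rewrite sqr_ge0 expr_le1.
have v2 : 0 <= v ^+ 2 <= 1 by rewrite sqr_ge0 expr_le1.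
by apply: ler_pM => //; rewrite ler_norml; apply/andP; split; lra.
Qed.

(** Signed distance to the nearest integer, in [[-1/2, 1/2)]; unlike [frac] it is smooth around the
    integers, where the bump sits. *)
Definition sdist x := frac (x + 2^-1) - 2^-1.

Lemma sdist_per1 : per1 sdist.
Proof. by move=> x k; rewrite /sdist [x + _ + _]addrAC frac_addz. Qed.

Lemma sdist_norm x : `|sdist x| = circ_dist x 0.
Proof.
have [k hk] := frac_ex (x + 2^-1); have h0 := frac_ge0 (x + 2^-1); have h1 := frac_lt1 (x + 2^-1).
rewrite /circ_dist subr0; have [s0|s0] := leP 0 (sdist x).
  have -> : frac x = sdist x.
    rewrite -(frac_addz x k) frac_id; first by rewrite /sdist hk; ring.
    by move: s0; rewrite /sdist hk; lra.
  by rewrite ger0_norm // min_l // /sdist; lra.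
have -> : frac x = sdist x + 1.
  rewrite -(frac_addz x (k + 1)) frac_id intrD; first by rewrite /sdist hk; ring.
  by move: s0; rewrite /sdist hk; lra.
by rewrite ltr0_norm // min_r /sdist; lra.
Qed.

Lemma sdist_near x y : `|sdist x| <= 4^-1 -> `|y - x| < 4^-1 -> sdist y = sdist x + (y - x).
Proof.
move=> hx hy; have [k hk] := frac_ex (x + 2^-1).
have e : sdist x + (y - x) = y + k%:~R by rewrite /sdist hk; ring.
rewrite e -(sdist_per1 y k) -e {1}/sdist frac_id ?addrK //.
move: hx hy; rewrite ler_norml ltr_norml => /andP[? ?] /andP[? ?]; apply/andP; split; lra.
Qed.

Definition pbump r x := r * bump (sdist x / r).

Definition depth r x := Num.min (circ_dist x 0 / r) 1.

Lemma is_derive_pbump r x : 0 < r <= 4^-1 -> is_derive x 1 (pbump r) (slope (depth r x)).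
Proof.
move=> /andP[r0 r4].
have [x4|x4] := leP `|sdist x| 4^-1.
  apply: (@near_eq_is_derive _ _ _ (fun y => r * bump ((sdist x + (y - x)) / r))).
    near=> y; rewrite /pbump (sdist_near (y := y) x4) //.
  have d1 : is_derive x 1 (fun y => (sdist x + (y - x)) / r) r^-1.
    have := is_derive_add_fun (is_derive_scale_fun r^-1 (is_derive_id x 1)) (is_derive_cst ((sdist x - x) / r) x 1).
    rewrite mulr1 addr0; congr is_derive.
    by apply/funext => y /=; field; rewrite gt_eqF.
  have d2 := is_derive1_comp (g := fun y => (sdist x + (y - x)) / r) (is_derive_bump _) d1.
  refine (is_derive_eq (is_derive_scale_fun r d2) _).
  rewrite /= subrr addr0 mulrCA divff ?gt_eqF // mulr1.
  by rewrite normrM sdist_norm normfV (gtr0_norm r0).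
apply: (@near_eq_is_derive _ _ _ (fun=> 0)).
  near=> y; rewrite /pbump bump_eq0 ?mulr0 // normrM normfV (gtr0_norm r0) ler_pdivlMr // mul1r.
  apply: le_trans r4 _; rewrite sdist_norm.
  have h : `|y - x| < `|sdist x| - 4^-1.
    rewrite distrC; near: y; apply: cvgr_dist_lt; [exact: cvg_id|by rewrite subr_gt0].
  have := circ_dist_triangle x y 0; have := circ_dist_le_norm x y.
  by move: h; rewrite -sdist_norm distrC; lra.
rewrite /depth min_r; first by rewrite /slope expr1n subrr mul0r; exact: is_derive_cst.
by rewrite ler_pdivlMr // mul1r -sdist_norm; lra.
Unshelve. all: by end_near. Qed.

Lemma pbump_per1 r : per1 (pbump r).
Proof. by move=> x k; rewrite /pbump sdist_per1. Qed.

Lemma depth01 r x : 0 < r -> 0 <= depth r x <= 1.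
Proof.
move=> r0; rewrite /depth le_min ge_min lexx ler01 orbT !andbT.
by rewrite divr_ge0 ?circ_dist_ge0 // ltW.
Qed.

Lemma depth_lipschitz r x y : 0 < r -> `|depth r x - depth r y| <= Num.min (circ_dist x y / r) 1.
Proof.
move=> r0.
suff w u v : depth r u - depth r v <= Num.min (circ_dist u v / r) 1.
  by rewrite ler_norml lerNl opprB w andbT circ_distC w.
have /andP[u0 u1] := depth01 u r0; have /andP[v0 v1] := depth01 v r0.
rewrite le_min; apply/andP; split; last by lra.
rewrite lerBlDl /depth.
have : circ_dist u 0 / r <= circ_dist v 0 / r + circ_dist u v / r.
  by rewrite -mulrDl ler_pM2r ?invr_gt0 // addrC circ_dist_triangle.
have : 0 <= circ_dist u v / r by rewrite divr_ge0 ?circ_dist_ge0 // ltW.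
by move=> h1 h2; have [?|?] := leP (circ_dist u 0 / r) 1; have [?|?] := leP (circ_dist v 0 / r) 1; lra.
Qed.

Lemma pbump_norm_le r x : 0 < r -> `|pbump r x| <= r.
Proof.
move=> r0; rewrite /pbump normrM (gtr0_norm r0) ler_piMr ?bump_norm_le // ltW //.
Qed.

Lemma pbump_eq0 r x : 0 < r -> r <= circ_dist x 0 -> pbump r x = 0.
Proof.
move=> r0 h; rewrite /pbump bump_eq0 ?mulr0 // normrM sdist_norm normfV (gtr0_norm r0).
by rewrite ler_pdivlMr // mul1r.
Qed.

Lemma slope_depth_eq0 r x : 0 < r -> r <= circ_dist x 0 -> slope (depth r x) = 0.
Proof.
move=> r0 h; rewrite /depth min_r ?ler_pdivlMr ?mul1r // /slope expr1n subrr mul0r //.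
Qed.

End Bump.


(** Compares the logarithm of a derivative factor with its value [ln (1 - e)] on the orbit: [tau] is
    the gain from being off the centre of a bump, [k] the relative oscillation of the derivative
    over it. With [h] as below the factor is at least [(1 - e) * (1 + h)], and
    [ln (1 + h) >= h / (1 + h)]. *)
Lemma ln_perturb (R : realType) (e tau k rho : R) : 0 < e <= 1 / 2 -> 0 <= tau <= 1 ->
  0 <= k <= 1 / 2 -> 1 - e * (1 - tau + k) <= rho ->
  ln (1 - e) + e * tau / 2 - 4 * e * k <= ln rho.
Proof.
move=> /andP[e0 e2] /andP[t0 t1] /andP[k0 k2] hrho.
have e1 : 0 < 1 - e by lra.
pose h := e * (tau - k) / (1 - e).
have hE : 1 - e * (1 - tau + k) = (1 - e) * (1 + h) by rewrite /h; field; rewrite gt_eqF.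
have hh : h * (1 - e) = e * (tau - k) by rewrite /h divfK // gt_eqF.
have ek : 0 <= e * k by rewrite mulr_ge0 // ltW.
have et : 0 <= e * tau by rewrite mulr_ge0 // ltW.
have ek' : e * k <= e / 2 by rewrite ler_pM2l //; lra.
have et' : e * tau <= e by rewrite ler_piMr // ltW.
have h1 : - (1 / 2) <= h.
  rewrite /h ler_pdivlMr //; lra.
have h2 : h <= 1 by rewrite /h ler_pdivrMr //; lra.
have h0 : 0 < 1 + h by lra.
have hpos : 0 < (1 - e) * (1 + h) by rewrite mulr_gt0.
have rho0 : 0 < rho by apply: lt_le_trans hrho; rewrite hE.
apply: (@le_trans _ _ (ln ((1 - e) * (1 + h)))); last by rewrite ler_ln ?posrE // -hE.
rewrite lnM ?posrE // -addrA lerD2l.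
have g1 : h / (1 + h) <= ln (1 + h).
  have := @le_ln1Dx R ((1 + h)^-1 - 1).
  have -> : 1 + ((1 + h)^-1 - 1) = (1 + h)^-1 by ring.
  rewrite lnV ?posrE // => g.
  have : - ln (1 + h) <= (1 + h)^-1 - 1 by apply: g; rewrite ltrBDr addNr invr_gt0.
  have -> : h / (1 + h) = 1 - (1 + h)^-1 by field; rewrite gt_eqF.
  lra.
apply: le_trans g1; rewrite ler_pdivlMr //.
have [tk|tk] := leP k tau.
  have etk0 : 0 <= e * (tau - k) by rewrite mulr_ge0 ?subr_ge0 // ltW.
  have h00 : 0 <= h by rewrite /h divr_ge0 // ltW.
  have eh : e * (tau - k) <= h by rewrite -hh ler_piMr //; lra.
  have a1 : (e * tau / 2 - 4 * e * k) * (1 + h) <= (e * (tau - k) / 2) * (1 + h).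
    by rewrite ler_pM2r //; lra.
  have a2 : (e * (tau - k) / 2) * (1 + h) <= (e * (tau - k) / 2) * 2.
    by apply: ler_wpM2l; lra.
  lra.
have etk : e * (tau - k) <= 0 by rewrite nmulr_lle0 ?ltW //; lra.
have hn : h <= 0 by rewrite /h ler_pdivrMr // mul0r.
have a0 : 2 * (e * (tau - k)) <= h.
  rewrite /h ler_pdivlMr //.
  have : 0 <= - (e * (tau - k)) * (1 - 2 * e) by rewrite mulr_ge0 //; lra.
  lra.
have a1 : (e * tau / 2 - 4 * e * k) * (1 + h) <= (4 * (e * (tau - k))) * (1 + h).
  by rewrite ler_pM2r //; lra.
have a2 : (4 * (e * (tau - k))) * (1 + h) <= (4 * (e * (tau - k))) * (1 / 2).
  by rewrite ler_wnM2l //; lra.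
lra.
Qed.

Section Perturbation.
Variables (R : realType) (chi : R).
Hypothesis chi01 : 0 < chi <= 1.
Variables (F : R -> R) (d : int) (L m KF : R).
Hypotheses (liftF : forall x, F (x + 1) = F x + d%:~R) (F_C1 : C1 F)
  (m0 : 0 < m) (F_bounds : forall x, m <= `|derive1 F x| <= L) (KF0 : 0 <= KF)
  (F_holder : forall x y, `|derive1 F x - derive1 F y| <= KF * circ_dist x y `^ chi).
Variables (z r eps : R) (p : nat).
Hypotheses (p0 : (0 < p)%N) (r0 : 0 < r <= 8^-1) (eps0 : 0 < eps <= 1 / 2)
  (sep : forall i j (k : int), (i < j < p)%N -> 4 * r <= `|iter i F z - iter j F z - k%:~R|).

Let y (i : nat) := iter i F z.
(** The power [r ^ chi] makes the Hölder seminorm of the perturbation's derivative of order [eps],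
    whatever [r] is. *)
Let e := eps * r `^ chi.
Let r_gt0 : 0 < r. Proof. by case/andP: r0. Qed.
Let r4 : 0 < r <= 4^-1. Proof. by case/andP: r0 => ? ?; lra. Qed.
Let chi0 : 0 < chi. Proof. by case/andP: chi01. Qed.
Let L0 : 0 <= L. Proof. by have /andP[] := F_bounds 0; have := m0; lra. Qed.

Let rchi1 : r `^ chi <= 1.
Proof.
have {1}<- : 1 `^ chi = 1 :> R by rewrite powR1.
by rewrite le_powR // ?(ltW r_gt0) //; case/andP: r0; lra.
Qed.

Let e_gt0 : 0 < e. Proof. by rewrite mulr_gt0 ?powR_gt0 //; case/andP: eps0. Qed.

Let e_le : e <= eps.
Proof. by rewrite ler_piMr //; case/andP: eps0 => /ltW. Qed.

(** The bumps have disjoint supports because their centres are [4 * r] apart; if none of them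
    reaches [x], any index will do. *)
Lemma one_index x : exists2 i : 'I_p, true & forall j : 'I_p, j != i -> r <= circ_dist (x - y j) 0.
Proof.
have [[i hi]|no] := pselect (exists i : 'I_p, circ_dist (x - y i) 0 < r); last first.
  exists (Ordinal p0) => // j _; rewrite leNgt; apply/negP => h; apply: no; by exists j.
exists i => // j ji; rewrite leNgt; apply/negP => hj.
have w (a b : 'I_p) : (a < b)%N -> circ_dist (x - y a) 0 < r -> circ_dist (x - y b) 0 < r -> False.
  move=> ab ha hb; have [k hk] := circ_dist_ex (x - y b) 0; have [l hl] := circ_dist_ex (x - y a) 0.
  have := @sep a b (k - l); rewrite ab ltn_ord => /(_ isT).
  have -> : iter a F z - iter b F z - (k - l)%:~R = (x - y b - 0 - k%:~R) - (x - y a - 0 - l%:~R).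
    by rewrite intrB /y; ring.
  have := ler_normB (x - y b - 0 - k%:~R) (x - y a - 0 - l%:~R).
  by rewrite -hk -hl; have := r_gt0; lra.
case: (ltngtP i j) => [ij|ij|ij]; [exact: (w i j)|exact: (w j i)|].
by case/eqP: ji; apply: val_inj.
Qed.

Lemma one_index_sum (w : R -> R) x : (forall t, r <= circ_dist t 0 -> w t = 0) ->
  exists i : 'I_p, (forall j : 'I_p, j != i -> r <= circ_dist (x - y j) 0) /\
   \sum_(j < p) derive1 F (y j) * w (x - y j) = derive1 F (y i) * w (x - y i).
Proof.
move=> hw; have [i _ hi] := one_index x; exists i; split => //.
rewrite (bigD1 i) //= big1 ?addr0 // => j ji.
by rewrite hw ?mulr0 // hi.
Qed.

(** The weights [derive1 F (y i)] multiply all derivatives along the orbit by the same [1 - e], so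
    each step loses exactly [ln (1 - e)]. *)
Definition perturbed x := F x - e * \sum_(i < p) derive1 F (y i) * pbump r (x - y i).

Lemma perturbed_lift x : perturbed (x + 1) = perturbed x + d%:~R.
Proof.
rewrite /perturbed liftF addrAC; congr (_ - _ * _ + _); apply: eq_bigr => i _.
by rewrite addrAC -[1]/(1%:~R) pbump_per1.
Qed.

Lemma is_derive_perturbed (x : R) : is_derive x 1 perturbed
  (derive1 F x - e * \sum_(i < p) derive1 F (y i) * slope (depth r (x - y i))).
Proof.
have ds (i : 'I_p) : is_derive x 1 (fun x => derive1 F (y i) * pbump r (x - y i))
    (derive1 F (y i) * slope (depth r (x - y i))).
  apply: is_derive_scale_fun.
  have ds : is_derive x 1 (fun x => x - y i) (1 + 0).
    exact: is_derive_add_fun.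
  have := is_derive1_comp (g := fun x => x - y i) (is_derive_pbump _ r4) ds.
  by rewrite addr0 mulr1.
have dF := derive1_is_derive (F_C1.1 x).
have := is_derive_add_fun dF (is_derive_scale_fun (- e) (is_derive_sum ds)).
rewrite mulNr; congr is_derive; apply/funext => t.
by rewrite /perturbed mulNr fct_sumE.
Qed.

Lemma derive1_perturbed x : derive1 perturbed x =
  derive1 F x - e * \sum_(i < p) derive1 F (y i) * slope (depth r (x - y i)).
Proof. by have [_ <-] := is_derive_perturbed x; rewrite derive1E. Qed.

Let sl0 t : r <= circ_dist t 0 -> slope (depth r t) = 0.
Proof. exact: slope_depth_eq0. Qed.

Let term_le i : `|derive1 F (y i)| <= L. Proof. by have /andP[] := F_bounds (y i). Qed.

Lemma perturbed_sub_le x : `|perturbed x - F x| <= e * (L * r).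
Proof.
rewrite /perturbed addrAC subrr add0r normrN normrM (gtr0_norm e_gt0) ler_wpM2l ?(ltW e_gt0) //.
have [i [_ ->]] := one_index_sum x (fun t => pbump_eq0 r_gt0 (x := t)).
by rewrite normrM ler_pM // pbump_norm_le.
Qed.

(** With [t] the distance divided by [r], the slope changes by at most
    [32 * min(t, 1) <= 32 * t ^ chi]; the factor [r ^ chi] cancels the scale. *)
Lemma slope_diff_le x x' (i : 'I_p) :
  `|slope (depth r (x - y i)) - slope (depth r (x' - y i))| * r `^ chi <= 32 * circ_dist x x' `^ chi.
Proof.
have c0 : 0 <= circ_dist x x' / r by rewrite divr_ge0 ?circ_dist_ge0 // ltW.
apply: (@le_trans _ _ (32 * (circ_dist x x' / r) `^ chi * r `^ chi)); last first.
  rewrite -mulrA -powRM ?(ltW r_gt0) // divfK // gt_eqF //.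
rewrite ler_wpM2r ?powR_ge0 //; apply: le_trans (slope_lipschitz _ _) _; rewrite ?depth01 //.
rewrite ler_pM2l //; apply: le_trans (depth_lipschitz _ _ r_gt0) _.
have -> : circ_dist (x - y i) (x' - y i) = circ_dist x x'.
  by rewrite /circ_dist; have -> : x - y i - (x' - y i) = x - x' by ring.
have [h|h] := leP (circ_dist x x' / r) 1.
  have [->|n0] := eqVneq (circ_dist x x' / r) 0; first exact: powR_ge0.
  by apply: ger1_powR; [rewrite h lt_def n0 c0|case/andP: chi01].
have {1}<- : 1 `^ chi = 1 :> R by rewrite powR1.
by rewrite le_powR // ltW.
Qed.

Lemma perturbed_close : close chi (64 * eps * L) perturbed F.
Proof.
have eL : e * L <= eps * L by rewrite ler_wpM2r.
have eL0 : 0 <= eps * L by rewrite mulr_ge0 //; case/andP: eps0 => /ltW.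
split=> [x|x|x x'].
- apply: le_trans (circ_dist_le_norm _ _) _; apply: le_trans (perturbed_sub_le x) _.
  rewrite mulrA; apply: (@le_trans _ _ (e * L * 1)); last by lra.
  by rewrite (ler_wpM2l (mulr_ge0 (ltW e_gt0) L0)) //; case/andP: r0 => _; lra.
- rewrite derive1_perturbed addrAC subrr add0r normrN normrM (gtr0_norm e_gt0).
  have [i [_ ->]] := one_index_sum x sl0.
  apply: (@le_trans _ _ (e * (L * 1))); last by lra.
  by rewrite ler_wpM2l ?(ltW e_gt0) // normrM ler_pM // slope_norm_le // depth01.
rewrite !derive1_perturbed; set X := \sum_(i < p) _; set X' := \sum_(i < p) _.
have -> : derive1 F x - e * X - derive1 F x - (derive1 F x' - e * X' - derive1 F x') = - (e * (X - X')) by ring.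
rewrite normrN normrM (gtr0_norm e_gt0).
have [i [hi Xi]] := one_index_sum x sl0; have [i' [hi' Xi']] := one_index_sum x' sl0.
rewrite /X /X' Xi Xi' {X X' Xi Xi'}.
pose T j t := derive1 F (y j) * slope (depth r (t - y j)).
have hT (j : 'I_p) : e * `|T j x - T j x'| <= 32 * eps * L * circ_dist x x' `^ chi.
  rewrite -mulrBr normrM /e -!mulrA [32 * _]mulrCA ler_pM2l; last by case/andP: eps0.
  rewrite mulrCA [32 * _]mulrCA [r `^ _ * _]mulrC ler_pM ?mulr_ge0 ?powR_ge0 //.
  exact: slope_diff_le.
have d0 : 0 <= 32 * eps * L * circ_dist x x' `^ chi.
  by rewrite -!mulrA mulr_ge0 // mulrA mulr_ge0 // powR_ge0.
have [->|ne] := eqVneq i i'.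
  by apply: le_trans (hT i') _; lra.
have z1 : T i' x = 0 by rewrite /T sl0 ?mulr0 // hi // eq_sym.
have z2 : T i x' = 0 by rewrite /T sl0 ?mulr0 // hi'.
(* Each of two different bumps vanishes at the other point, so the difference splits into two
   differences of a single bump; hence [64 = 32 + 32]. *)
have -> : T i x - T i' x' = (T i x - T i x') + (T i' x - T i' x') by rewrite z1 z2; ring.
apply: le_trans (ler_wpM2l (ltW e_gt0) (ler_normD _ _)) _.
by rewrite mulrDr; apply: le_trans (lerD (hT i) (hT i')) _; lra.
Qed.

Lemma perturbed_orbit (i : 'I_p) (k : int) : perturbed (y i + k%:~R) = F (y i + k%:~R).
Proof.
rewrite /perturbed big1 ?mulr0 ?subr0 // => j _.
have [->|ji] := eqVneq j i.
  rewrite addrAC subrr pbump_per1.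
  by rewrite /pbump /sdist add0r frac_id ?subrr ?mul0r ?/bump ?mul0r ?mulr0 //; apply/andP; split; lra.
rewrite pbump_eq0 ?mulr0 //.
have [i' _ hi'] := one_index (y i + k%:~R).
have ii : i' = i.
  apply/eqP; apply/negPn/negP; rewrite eq_sym => h; have := hi' i h.
  rewrite addrAC subrr circ_dist_addz circ_distxx.
  by rewrite leNgt r_gt0.
by apply: hi'; rewrite ii.
Qed.

Lemma derive1_perturbed_orbit (i : 'I_p) (k : int) :
  derive1 perturbed (y i + k%:~R) = (1 - e) * derive1 F (y i).
Proof.
have lF : is_lift F by exists d.
have c00 : circ_dist (y i + k%:~R - y i) 0 = 0.
  by rewrite addrAC subrr circ_dist_addz circ_distxx.
rewrite derive1_perturbed (derive1_per1 lF).
have [i' [hi' ->]] := one_index_sum (y i + k%:~R) sl0.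
have ii : i' = i.
  apply/eqP; apply/negPn/negP; rewrite eq_sym => h; have := hi' i h.
  by rewrite c00 leNgt r_gt0.
by rewrite ii /depth c00 mul0r min_l // /slope !expr0n /=; ring.
Qed.

(** At distance [t * r] from the orbit the slope is at most [1 - t ^ 2], and the weight differs from
    [derive1 F x] by a relative error [KF / m * r ^ chi]. So [lnd] drops by less than it does on the
    orbit, up to that error. *)
Lemma lnd_perturbed_ge x t : 0 <= t <= 1 -> KF / m * r `^ chi <= 1 / 2 ->
  (forall (i : 'I_p) (k : int), t * r <= `|x - y i - k%:~R|) ->
  lnd F x + ln (1 - e) + e * t ^+ 2 / 2 - 4 * e * (KF / m * r `^ chi) <= lnd perturbed x.
Proof.
move=> /andP[t0 t1] hK ht.
have [i [_ hS]] := one_index_sum x sl0.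
pose q := derive1 F (y i) / derive1 F x; pose w := slope (depth r (x - y i)).
have /andP[mx xL] := F_bounds x.
have Fx0 : derive1 F x != 0 by rewrite -normr_gt0 (lt_le_trans m0).
have rhoE : derive1 perturbed x = derive1 F x * (1 - e * (q * w)).
  by rewrite derive1_perturbed hS /q /w; field.
have k0 : 0 <= KF / m * r `^ chi by rewrite mulr_ge0 ?powR_ge0 // divr_ge0 // ltW.
have t2 : 0 <= t ^+ 2 <= 1 by rewrite sqr_ge0 expr_le1.
have qw : q * w <= 1 - t ^+ 2 + KF / m * r `^ chi.
  have [far|near] := leP r (circ_dist (x - y i) 0).
    rewrite /w sl0 // mulr0; case/andP: t2 => ? ?; lra.
  have v01 := depth01 (x - y i) r_gt0.
  have tv : t <= depth r (x - y i).
    rewrite /depth le_min t1 andbT ler_pdivlMr //.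
    by have [k ->] := circ_dist_ex (x - y i) 0; rewrite subr0.
  have w1 : w <= 1 - t ^+ 2.
    apply: le_trans (slope_le v01) _; rewrite lerD2l lerN2.
    by rewrite lerXn2r // ?nnegrE //; case/andP: v01.
  have q1 : `|q - 1| <= KF / m * r `^ chi.
    have -> : q - 1 = (derive1 F (y i) - derive1 F x) / derive1 F x by rewrite /q; field.
    rewrite normrM normfV ler_pdivrMr ?(lt_le_trans m0) //.
    apply: le_trans (F_holder _ _) _.
    apply: (@le_trans _ _ (KF * r `^ chi)).
      rewrite ler_wpM2l // le_powR // ?circ_dist_ge0 // circ_distC.
      have <- : circ_dist (x - y i) 0 = circ_dist x (y i) by rewrite /circ_dist subr0.
      exact: ltW.
    have -> : KF / m * r `^ chi * `|derive1 F x| = (KF * r `^ chi) * (`|derive1 F x| / m) by ring.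
    by rewrite ler_peMr ?mulr_ge0 ?powR_ge0 // ler_pdivlMr // mul1r.
  have : (q - 1) * w <= KF / m * r `^ chi.
    apply: le_trans (ler_norm _) _; rewrite normrM -[leRHS]mulr1 ler_pM //.
    exact: slope_norm_le.
  lra.
have rho_ge : 1 - e * (1 - t ^+ 2 + KF / m * r `^ chi) <= 1 - e * (q * w).
  by rewrite lerD2l lerN2 ler_pM2l.
have e2 : 0 < e <= 1 / 2 by rewrite e_gt0 (le_trans e_le) //; case/andP: eps0.
have k2 : 0 <= KF / m * r `^ chi <= 1 / 2 by rewrite k0.
have := ln_perturb e2 t2 k2 rho_ge.
have rho0 : 0 < 1 - e * (q * w).
  apply: lt_le_trans rho_ge; case/andP: e2 => e0 e12; case/andP: t2 => t20 t21.
  have : e * (1 - t ^+ 2 + KF / m * r `^ chi) <= e * (1 + 1 / 2) by rewrite ler_pM2l //; lra.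
  lra.
have -> : lnd perturbed x = lnd F x + ln (1 - e * (q * w)).
  rewrite /lnd rhoE normrM (gtr0_norm rho0) lnM ?posrE // (lt_le_trans m0) //.
lra.
Qed.

Lemma perturbed_C1 : C1 perturbed.
Proof.
split=> [x|]; first by have [] := is_derive_perturbed x.
have -> : derive1 perturbed = (fun x => derive1 F x - e * \sum_(i < p) derive1 F (y i) * slope (depth r (x - y i))).
  by apply/funext => x; exact: derive1_perturbed.
move=> x; apply: continuousB; first exact: F_C1.2.
have -> : (fun x => e * \sum_(i < p) derive1 F (y i) * slope (depth r (x - y i)))
    = (fun x => e * (\sum_(i < p) derive1 F (y i) * slope (depth r (x - y i)))) by [].
apply: (@lipschitz_continuous _ (e * \sum_(i < p) (L * (32 / r)))) => a b.
rewrite -mulrBr normrM (gtr0_norm e_gt0) -mulrA ler_pM2l // -sumrB mulr_suml.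
apply: le_trans (ler_norm_sum _ _ _) _; apply: ler_sum => i _.
rewrite -mulrBr normrM -mulrA ler_pM //.
apply: le_trans (slope_lipschitz _ _) _; rewrite ?depth01 // -mulrA ler_pM2l //.
apply: le_trans (depth_lipschitz _ _ r_gt0) _; rewrite ge_min; apply/orP; left.
rewrite mulrC ler_pM2l ?invr_gt0 //; apply: le_trans (circ_dist_le_norm _ _) _.
by rewrite opprB addrA subrK.
Qed.

End Perturbation.

(** * Locking on a periodic orbit *)


(* Pointwise form of the uniqueness of the minimizing measure: [beta] is its exponent and
   [c0] the extra cost of each visit far away from its support. *)
Definition locked (R : realType) (G : R -> R) := exists (z : R) (p : nat) (M : int) (beta c0 B s : R),
  [/\ (0 < p)%N /\ iter p G z = z + M%:~R,
      \sum_(i < p) lnd G (iter i G z) = p%:R * beta,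
      0 < c0,
      forall n x, - B <= \sum_(i < n) (lnd G (iter i G x) - beta
                       - c0 * (`[< far (lifted_orbit G z) s (iter i G x) >])%:R) &
      forall x, (forall i, ~ far (lifted_orbit G z) s (iter i G x)) -> lifted_orbit G z x].

Section LockOfShadow.
Variables (R : realType) (chi : R).
Hypothesis chi01 : 0 < chi <= 1.
Variables (d : int) (L C lam : R) (G : R -> R) (D : R -> R -> R).
Hypothesis rG : regular_lift d L C lam G D.
Hypothesis L1 : 1 <= L.
Variables (K Ku : R) (u : R -> R).
Hypotheses (lnd_holder : holder chi K (lnd G)) (u_per : per1 u) (u_holder : holder chi Ku u).
Variables (al r eps rho rho' kappa w : R) (p : nat) (y fy : nat -> R) (z : R) (M : int) (k : nat -> int).
Let K1 := K + Ku + Ku * L `^ chi.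
Let A := K1 / (lam `^ chi - 1).
Let g x := lnd G x - al + u x - u (G x).
Let q := kappa * r `^ chi.
Hypotheses (r0 : 0 < r <= 8^-1) (eps0 : 0 < eps) (rho_def : rho = (L + 1)^-1)
  (rho'0 : 0 < rho') (rho'1 : rho' <= rho / 2) (rho'2 : C * L * rho' <= rho)
  (rho'3 : A * (lam * rho') `^ chi <= eps * (rho / (2 * C)) ^+ 2 / 4)
  (kappa_def : kappa = eps * (rho' / (2 * C)) ^+ 2 / 16).
Hypotheses (p0 : (0 < p)%N) (hz : iter p G z = z + M%:~R)
  (shadow : forall i, (i < p)%N -> `|iter i G z - (y i + (k i)%:~R)| <= rho' * r / (2 * C))
  (y_sep : forall i j (l : int), (i < j < p)%N -> 4 * r <= `|y i - y j - l%:~R|)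
  (w0 : 0 <= w) (pw : p%:R * w <= q)
  (g_orbit : forall i, (i < p)%N -> `|g (iter i G z) - fy i| <= w)
  (fy0 : forall i, 0 <= fy i) (fy_sum : \sum_(i < p) fy i <= q)
  (g_lower : forall x t, 0 <= t <= 1 ->
     (forall i (l : int), (i < p)%N -> t * r <= `|x - y i - l%:~R|) ->
     eps * r `^ chi * t ^+ 2 / 2 - 2 * q <= g x).

Let liftG := rl_lift rG.
Let O := lifted_orbit G z.
Let avg := (\sum_(i < p) g (iter i G z)) / p%:R.
Let h x := g x - avg.
Let rr : 0 < r. Proof. by case/andP: r0. Qed.
Let C1 : 1 <= C := rl_C1 rG.
Let C0 : 0 < C := lt_le_trans ltr01 C1.
Let rc : 0 < r `^ chi := powR_gt0 chi rr.
Let Lp : 0 < L + 1. Proof. by have := L1; lra. Qed.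
Let rho0 : 0 < rho. Proof. by rewrite rho_def invr_gt0. Qed.
Let rho1 : rho <= 1. Proof. by rewrite rho_def invf_le1 // lerDr (le_trans ler01). Qed.
Let kappa0 : 0 < kappa. Proof. by rewrite kappa_def divr_gt0 // mulr_gt0 // exprn_gt0 // divr_gt0 // mulr_gt0. Qed.
Let q0 : 0 < q. Proof. exact: mulr_gt0. Qed.
Let pp : 0 < p%:R :> R. Proof. by rewrite ltr0n. Qed.
Let Ku0 : 0 <= Ku := holder_const_ge0 u_holder.
Let K0 : 0 <= K := holder_const_ge0 lnd_holder.
Let K10 : 0 <= K1. Proof. by rewrite /K1 !addr_ge0 // mulr_ge0 // powR_ge0. Qed.

Let lndG_per : per1 (lnd G). Proof. by apply: lnd_per1; exists d. Qed.

Let uG_per : per1 (fun x => u (G x)).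
Proof. by move=> x l; rewrite (lift_addz liftG) u_per. Qed.

Let g_per : per1 g.
Proof. by move=> x l; rewrite /g lndG_per u_per uG_per. Qed.

Let h_per : per1 h. Proof. by move=> x l; rewrite /h g_per. Qed.

Let avgE : p%:R * avg = \sum_(i < p) g (iter i G z).
Proof. by rewrite /avg mulrC divfK // gt_eqF. Qed.

Let p_avg_le : p%:R * avg <= 2 * q.
Proof.
rewrite avgE; have : \sum_(i < p) g (iter i G z) <= \sum_(i < p) (fy i + w).
  by apply: ler_sum => i _; have := g_orbit (ltn_ord i); rewrite ler_norml => /andP[_]; lra.
have -> : \sum_(i < p) (fy i + w) = \sum_(i < p) fy i + p%:R * w.
  by rewrite big_split /= sumr_const card_ord mulr_natl.
have a := pw; have b := fy_sum; lra.
Qed.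

Let avg_le : avg <= 2 * q.
Proof.
have [a0|a0] := leP 0 avg; last by have := q0; lra.
apply: le_trans p_avg_le; rewrite ler_peMl // ler1n //.
Qed.

Let orbit_g_ge a : O a -> - w <= g a.
Proof.
move=> /(lifted_orbit_lt liftG p0 hz)[i [l [ip ->]]]; rewrite g_per.
have := g_orbit ip; have := fy0 i; rewrite ler_norml => f0 /andP[]; lra.
Qed.

Let O_inv a : O a -> O (G a). Proof. exact: (lifted_orbit_inv liftG). Qed.

Let O_iter n a : O a -> O (iter n G a). Proof. by move=> Oa; elim: n => //= n; exact: O_inv. Qed.

Let h_sum0 a : O a -> \sum_(j < p) h (iter j G a) = 0.
Proof.
move=> [i [l ->]].
under eq_bigr => j _ do rewrite (iter_addz liftG) h_per.
rewrite (cyclic_sum rG h_per i hz).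
have -> : \sum_(j < p) h (iter j G z) = \sum_(j < p) g (iter j G z) - \sum_(j < p) avg.
  by rewrite -sumrB.
by rewrite sumr_const card_ord -avgE mulr_natl subrr.
Qed.

(** Full periods contribute 0. In an incomplete one each term is at least [- w - avg], and
    [p * w <= q], [p * avg <= 2 * q] make the bound independent of the period. *)
Let O_sum n a : O a -> - (3 * q) <= \sum_(j < n) h (iter j G a).
Proof.
elim/ltn_ind: n a => n IH a Oa.
have [np|pn] := ltnP n p.
  have : \sum_(j < n) (- w - avg) <= \sum_(j < n) h (iter j G a).
    by apply: ler_sum => j _; rewrite lerD2r; apply/orbit_g_ge/O_iter.
  rewrite sumr_const card_ord -[(_ - avg) *+ n]mulr_natl; apply: le_trans.
  have np' : n%:R <= p%:R :> R by rewrite ler_nat ltnW.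
  have nw : n%:R * w <= q by apply: le_trans pw; rewrite ler_wpM2r.
  have na : n%:R * avg <= 2 * q.
    have [a0|/ltW a0] := leP 0 avg; first by apply: le_trans p_avg_le; rewrite ler_wpM2r.
    by apply: (@le_trans _ _ 0); [rewrite mulr_ge0_le0 // ler0n|rewrite mulr_ge0 // ltW].
  rewrite mulrDr !mulrN; lra.
rewrite -(subnKC pn) big_split_ord /= h_sum0 // add0r.
under eq_bigr => j _ do rewrite addnC iterD.
apply: IH; last exact: O_iter.
by rewrite ltn_subrL p0 (leq_trans p0 pn).
Qed.

Let s := rho' * r.
Let rad := rho * r.
Let s0 : 0 < s. Proof. exact: mulr_gt0. Qed.
Let sC : s / (2 * C) <= r / 2.
Proof.
have -> : s / (2 * C) = rho' / C * (r / 2) by rewrite /s; field; rewrite gt_eqF.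
rewrite ler_piMl ?divr_ge0 ?(ltW rr) // ler_pdivrMr // mul1r.
by have := rho'1; have := rho1; have := rho0; have := C1; lra.
Qed.

(** The gap [4 * r] of the shadowed orbit loses at most [r / 2] at each end. *)
Let O_sep a b : O a -> O b -> a <> b -> 3 * r <= `|a - b|.
Proof.
apply: (lifted_orbit_sep liftG p0 hz); first by case/andP: r0; lra.
move=> i j l ij; have jp : (j < p)%N by case/andP: ij.
have ip : (i < p)%N by case/andP: ij => /ltn_trans; apply.
have e1 := shadow ip; have e2 := shadow jp.
have := y_sep (l - k i + k j) ij.
have -> : y i - y j - (l - k i + k j)%:~R = (iter i G z - iter j G z - l%:~R)
   - (iter i G z - (y i + (k i)%:~R)) + (iter j G z - (y j + (k j)%:~R)).
  by rewrite intrD intrB; ring.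
set X := iter i G z - _ - _; set E1 := iter i G z - _ in e1 *; set E2 := iter j G z - _ in e2 *.
have := ler_normD (X - E1) E2; have := ler_normB X E1; have := sC; rewrite /s; lra.
Qed.

Let h_holder x x' : h x' - K1 * `|x - x'| `^ chi <= h x.
Proof.
have a1 := lnd_holder x x'; have a2 := u_holder x x'.
have a3 : `|u (G x) - u (G x')| <= Ku * L `^ chi * `|x - x'| `^ chi.
  apply: le_trans (u_holder _ _) _; rewrite -mulrA ler_wpM2l //.
  rewrite -powRM //; last exact: le_trans ler01 L1.
  by rewrite le_powR // (rl_lip rG).
move: a1 a2 a3; rewrite !ler_norml => /andP[a1 _] /andP[a2 _] /andP[_ a3].
rewrite /h /g /K1 !mulrDl; lra.
Qed.

(** A [D]-distance above [c * r] means a distance above [c * r / C], and the shadowing error uses up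
    at most half of it. *)
Let far_lower x c : rho' <= c <= 1 -> (forall a, O a -> c * r < D x a) ->
  eps * r `^ chi * (c / (2 * C)) ^+ 2 / 2 - 2 * q <= g x.
Proof.
move=> /andP[c1 c2] hx; have c0 : 0 < c := lt_le_trans rho'0 c1.
have C20 : 0 < 2 * C by rewrite mulr_gt0.
apply: g_lower.
  rewrite divr_ge0 ?(ltW c0) ?(ltW C20) // ler_pdivrMr // mul1r.
  by apply: le_trans c2 _; have := C1; lra.
move=> i l ip.
have Oi : O (iter i G z + (l - k i)%:~R) by exists i, (l - k i).
have h1 : c * r < C * `|x - (iter i G z + (l - k i)%:~R)|.
  exact: lt_le_trans (hx _ Oi) (rl_ub rG _ _).
have h2 := shadow ip.
have -> : x - y i - l%:~R = (x - (iter i G z + (l - k i)%:~R)) + (iter i G z - (y i + (k i)%:~R)).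
  by rewrite intrB; ring.
set X := x - _ in h1 *; set E := _ - (y i + _) in h2 *.
have h3 : c * r / C < `|X| by rewrite ltr_pdivrMr // [ltRHS]mulrC.
have h4 : rho' * r / (2 * C) <= c * r / (2 * C).
  by rewrite ler_pM2r ?invr_gt0 // ler_pM2r.
have h5 : c * r / C = c * r / (2 * C) * 2 by field; rewrite gt_eqF.
have h6 : c / (2 * C) * r = c * r / (2 * C) by rewrite mulrAC.
rewrite h6; rewrite h5 in h3; have h7 := le_trans h2 h4; have := ler_normB (X + E) E; rewrite addrK.
move: h3 h7; set Y := c * r / (2 * C); lra.
Qed.

(** The budget in units of [q]: by the choice of [kappa], [g] is at least [8 - 2 = 6] away from the
    orbit; the average takes at most 2; the remaining 4 are 3 for the debt in [O_sum] and 1 for the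
    cost [c0]. *)
Lemma lock_of_shadow : locked G.
Proof.
pose beta := al + avg.
(* The last summand bounds the difference of [u] between the two ends of an orbit segment. *)
exists z, p, M, beta, q, (3 * q + A * (lam * s) `^ chi + 2 * (`|u 0| + Ku)), s.
have hE x : h x = lnd G x - beta + u x - u (G x) by rewrite /h /g /beta; ring.
have tele n x : \sum_(i < n) (u (iter i G x) - u (iter i.+1 G x)) = u x - u (iter n G x).
  elim: n => [|n IH]; first by rewrite big_ord0 subrr.
  by rewrite big_ord_recr IH /= addrA subrK.
have srad : C * L * s <= rad by rewrite /s /rad mulrA ler_pM2r.
have radsep : (L + 1) * rad < 3 * r.
  by rewrite /rad rho_def mulrA divff ?gt_eqF // mul1r; have := rr; lra.
have t1 : eps * r `^ chi * (rho' / (2 * C)) ^+ 2 / 2 = 8 * q by rewrite /q kappa_def; set T := (rho' / (2 * C)) ^+ 2; field.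
have avgq := avg_le.
have hfar x : (forall a, O a -> s < D x a) -> 3 * q + q <= h x.
  move=> /far_lower; rewrite lexx /=; have r'1 : rho' <= 1 by have := rho'1; have := rho0; have := rho1; lra.
  by move=> /(_ r'1); rewrite t1 /h; lra.
have hvfar x : (forall a, O a -> rad < D x a) -> 3 * q + A * (lam * s) `^ chi + q <= h x.
  have r'1 : rho' <= rho by have := rho'1; have := rho0; lra.
  move=> /far_lower; rewrite r'1 rho1 => /(_ isT).
  set T := rho / (2 * C).
  (* Outside of [rad] the quadratic gain splits into two equal halves, one for the debt
     [A * (lam * s) ^ chi] and one worth at least [8 * q]. *)
  have b1 : A * (lam * s) `^ chi <= eps * T ^+ 2 / 4 * r `^ chi.
    rewrite /s mulrA powRM ?(ltW rr) ?mulr_ge0 ?(ltW rho'0) ?(ltW (rl_lam0 rG)) // mulrA.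
    by rewrite ler_pM2r.
  have b2 : 8 * q <= eps * T ^+ 2 / 4 * r `^ chi.
    rewrite /q mulrA ler_pM2r // kappa_def.
    have : (rho' / (2 * C)) ^+ 2 <= (T / 2) ^+ 2.
      have C20 : 0 < 2 * C by rewrite mulr_gt0.
      rewrite lerXn2r ?nnegrE ?divr_ge0 ?(ltW rho'0) ?(ltW rho0) ?(ltW C20) //.
      by rewrite /T mulrAC ler_pM2r ?invr_gt0.
    move=> hX; have := ler_wpM2l (ltW eps0) hX.
    have -> : (T / 2) ^+ 2 = T ^+ 2 / 4 by field.
    have : 0 <= eps * T ^+ 2 by rewrite mulr_ge0 ?sqr_ge0 // ltW.
    set X := (rho' / (2 * C)) ^+ 2; lra.
  have -> : eps * r `^ chi * T ^+ 2 / 2 = 2 * (eps * T ^+ 2 / 4 * r `^ chi) by field.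
  rewrite /h; lra.
split => //.
- have : \sum_(i < p) h (iter i G z) = 0.
    by apply: h_sum0; exists 0%N, 0; rewrite addr0.
  under eq_bigr => i _ do rewrite hE -addrA.
  rewrite big_split /= tele hz u_per subrr addr0 sumrB sumr_const card_ord -[beta *+ p]mulr_natl => /eqP.
  by rewrite subr_eq0 => /eqP.
- move=> n x.
  have := locking_sum chi01 rG L1 O_inv O_sep s0 srad radsep h_holder K10
    (mulr_ge0 (ler0n _ 3) (ltW q0)) (ltW q0) O_sum hfar hvfar n x.
  rewrite -/A => hs.
  have -> : \sum_(i < n) (lnd G (iter i G x) - beta - q * (`[< far O s (iter i G x) >])%:R)
    = \sum_(i < n) (h (iter i G x) - q * (`[< far O s (iter i G x) >])%:R)
      - \sum_(i < n) (u (iter i G x) - u (iter i.+1 G x)).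
    by rewrite -sumrB; apply: eq_bigr => i _; rewrite hE /=; ring.
  rewrite tele.
  have ux := per1_holder_bounded chi01 u_per u_holder x.
  have un := per1_holder_bounded chi01 u_per u_holder (iter n G x).
  move: ux un; rewrite !ler_norml => /andP[_ ux] /andP[un _].
  set Y := \sum_(i < n) (h _ - _) in hs *; lra.
- move=> x; exact: (never_far_orbit rG L1 O_inv O_sep s0 srad radsep).
Qed.

End LockOfShadow.


(** * Density of robustly locked maps *)

Section RobustLocking.
Variables (R : realType) (chi : R).
Hypothesis chi01 : 0 < chi <= 1.
Let chi0 : 0 < chi. Proof. by case/andP: chi01. Qed.

Lemma exists_small (c q : R) : 0 <= c -> 0 < q ->
  exists2 t0, 0 < t0 & forall t, 0 <= t <= t0 -> c * t `^ chi <= q.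
Proof.
move=> c0 q0; have c1 : 0 < c + 1 by rewrite ltr_wpDl.
have qc : 0 < q / (c + 1) by rewrite divr_gt0.
exists ((q / (c + 1)) `^ chi^-1); first by rewrite powR_gt0.
move=> t /andP[t0 tq]; have := le_powR chi01 t0 tq.
rewrite -powRrM mulVf ?gt_eqF // powRr1 ?(ltW qc) // => h.
apply: le_trans (ler_wpM2l c0 h) _; rewrite mulrCA ler_piMr ?(ltW q0) //.
by rewrite ler_pdivrMr // mul1r lerDl.
Qed.

(** The order matters: [eps] comes from the allowed size of the perturbation, [rho'] from [eps], and
    [kappa] from both. The radius [r] and the period are found only after [kappa]. *)
Lemma choose_constants (L C lam K1 e0 : R) : 1 <= L -> 1 <= C -> 1 < lam -> 0 <= K1 -> 0 < e0 ->
  exists eps rho' kappa : R, let rho := (L + 1)^-1 in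
   [/\ 0 < eps <= 1 / 2, eps * L <= 1, 64 * eps * L <= e0 &
    [/\ 0 < rho', rho' <= rho / 2, C * L * rho' <= rho,
      K1 / (lam `^ chi - 1) * (lam * rho') `^ chi <= eps * (rho / (2 * C)) ^+ 2 / 4 &
      kappa = eps * (rho' / (2 * C)) ^+ 2 / 16]].
Proof.
move=> L1 C1 lam1 K10 e00; set rho := (L + 1)^-1.
have L0 : 0 < L := lt_le_trans ltr01 L1; have C0 : 0 < C := lt_le_trans ltr01 C1.
have rho0 : 0 < rho by rewrite invr_gt0 addr_gt0.
pose eps := Num.min (2^-1 / L) (e0 / (64 * L)).
have eps0 : 0 < eps by rewrite lt_min !divr_gt0 ?invr_gt0 // mulr_gt0.
have epsL : eps * L <= 2^-1 by rewrite -ler_pdivlMr // ge_min lexx.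
have epsL64 : 64 * eps * L <= e0.
  rewrite mulrAC mulrC -ler_pdivlMr; last by rewrite mulr_gt0.
  by rewrite ge_min lexx orbT.
have A0 : 0 <= K1 / (lam `^ chi - 1) by rewrite divr_ge0 // subr_ge0 ltW // powR_gt1.
have X0 : 0 < eps * (rho / (2 * C)) ^+ 2 / 4.
  by rewrite divr_gt0 // mulr_gt0 // exprn_gt0 // divr_gt0 // mulr_gt0.
have [t0 t00 ht] := exists_small A0 X0.
have lam0 : 0 < lam := lt_trans ltr01 lam1.
pose rho' := Num.min (rho / 2) (Num.min (rho / (C * L)) (t0 / lam)).
have rho'0 : 0 < rho' by rewrite !lt_min !divr_gt0 // mulr_gt0.
exists eps, rho', (eps * (rho' / (2 * C)) ^+ 2 / 16); split => //.
- rewrite eps0 /= div1r; apply: le_trans epsL; rewrite ler_peMr // ltW //.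
- by apply: le_trans epsL _; rewrite invf_le1 // ler1n.
split => //; first by rewrite ge_min lexx.
- by rewrite mulrC -ler_pdivlMr ?mulr_gt0 // !ge_min lexx ?orbT.
apply: ht; rewrite mulr_ge0 ?(ltW lam0) ?(ltW rho'0) //= mulrC -ler_pdivlMr //.
by rewrite !ge_min lexx ?orbT.
Qed.

Lemma coboundary_holder (K Ku L al : R) (phi u G : R -> R) : holder chi K phi -> holder chi Ku u ->
  0 <= L -> (forall x y, `|G x - G y| <= L * `|x - y|) ->
  holder chi (K + Ku + Ku * L `^ chi) (fun x => phi x - al + u x - u (G x)).
Proof.
move=> hphi hu L0 hG x y; have Ku0 := holder_const_ge0 hu.
have -> : phi x - al + u x - u (G x) - (phi y - al + u y - u (G y)) =
  (phi x - phi y) + (u x - u y) - (u (G x) - u (G y)) by ring.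
rewrite !mulrDl; apply: le_trans (ler_normB _ _) _; apply: lerD.
  by apply: le_trans (ler_normD _ _) _; apply: lerD.
apply: le_trans (hu _ _) _; rewrite -mulrA ler_wpM2l //.
by rewrite -powRM // le_powR.
Qed.

Lemma holder_circ (K : R) (psi : R -> R) x y : per1 psi -> holder chi K psi ->
  `|psi x - psi y| <= K * circ_dist x y `^ chi.
Proof.
move=> pp hp; have [k ->] := circ_dist_ex x y.
by have := holder_per1 x y k pp hp; rewrite opprD addrA.
Qed.

(** The orbit of [F] is also one of [S], hence a pseudo-orbit of [G] with jumps of size [eta]. The
    bound grows with [p], so [eta] has to be chosen after the orbit. *)
Lemma shadow_orbit (d : int) (L C lam eta : R) (G : R -> R) (D : R -> R -> R) (S F : R -> R) z p (M : int) :
  regular_lift d L C lam G D -> (0 < p)%N -> iter p F z = z + M%:~R -> 0 <= eta ->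
  (forall x, circ_dist (G x) (S x) <= eta) ->
  (forall i, (i < p)%N -> S (iter i F z) = F (iter i F z)) ->
  exists z' (M' : int) (k : nat -> int), iter p G z' = z' + M'%:~R /\
    forall i, (i < p)%N -> `|iter i G z' - (iter i F z + (k i)%:~R)| `^ chi
       <= p%:R / (lam `^ chi - 1) * (C * eta) `^ chi.
Proof.
move=> rG p0 hz eta0 hGS hS; have mu1 := powR_gt1 chi01 (rl_lam rG).
have C0 : 0 <= C := le_trans ler01 (rl_C1 rG).
pose y i := if (i < p)%N then iter i F z else z.
have yp : y p = y 0%N by rewrite /y ltnn p0.
have [||z' [M' [k [hz' hs]]]] := periodic_shadowing chi01 rG (delta := fun=> C * eta) p0 yp.
- by move=> i; rewrite mulr_ge0.
- move=> i ip; rewrite /y ip.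
  have [l hl] := circ_dist_ex (G (iter i F z)) (S (iter i F z)).
  have : D (G (iter i F z)) (F (iter i F z) + l%:~R) <= C * eta.
    apply: le_trans (rl_ub rG _ _) _; rewrite ler_wpM2l // opprD addrA -(hS i ip) -hl.
    exact: hGS.
  rewrite -iterS; have [i1p|pi1] := ltnP i.+1 p; first by exists l.
  have -> : i.+1 = p by apply/eqP; rewrite eqn_leq pi1 andbT.
  by rewrite hz -addrA -intrD; exists (M + l).
exists z', M', k; split => // i ip.
rewrite mulrAC ler_pdivlMr ?subr_gt0 // mulrC.
move: hs; rewrite sumr_const card_ord -[_ *+ p]mulr_natl; apply: le_trans.
rewrite ler_pM2l ?subr_gt0 // (bigD1 (Ordinal ip)) //= /y ip.
apply: (@le_trans _ _ (D (iter i G z') (iter i F z + (k i)%:~R) `^ chi)).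
  by rewrite le_powR // (rl_lb rG).
by rewrite lerDl sumr_ge0 // => j _; exact: powR_ge0.
Qed.

Lemma powR_le_inv (a b : R) : 0 <= a -> 0 <= b -> a `^ chi <= b `^ chi -> a <= b.
Proof.
move=> a0 b0; apply: contraTT; rewrite -!ltNge => ba.
by rewrite gt0_ltr_powR // nnegrE.
Qed.

Lemma robust_locking (F : R -> R) (eps0 : R) : E1chi chi F -> 0 < eps0 ->
  exists S, [/\ E1chi chi S, close chi eps0 S F &
    exists2 eta, 0 < eta & forall G, E1chi chi G -> close chi eta G S -> locked G].
Proof.
move=> EF eps00; have [L [C [lam [K [m [eta0 [eta00 L1 m0 K0 unif]]]]]]] := uniform_regularity chi01 EF.
have [lF [CF [[KF' hKF'] _]]] := EF; have [dF liftF] := lF.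
have [[d [D rF]] lndF bF] := unif F lF CF (close_refl chi F (ltW eta00)).
have L0 : 0 <= L := le_trans ler01 L1.
pose KF := `|KF'|; have KF0 : 0 <= KF by exact: normr_ge0.
have hKF x y : `|derive1 F x - derive1 F y| <= KF * circ_dist x y `^ chi.
  by apply: le_trans (hKF' x y) _; rewrite ler_wpM2r ?powR_ge0 // ler_norm.
have lndF_per := lnd_per1 lF.
pose u := sub_action F (lnd F); pose alpha := min_average F (lnd F).
pose Ku := K / (lam `^ chi - 1) * C `^ chi.
have u_per : per1 u by exact: sub_action_per.
have u_holder : holder chi Ku u by exact: (sub_action_holder chi01 rF lndF_per lndF).
have Ku0 : 0 <= Ku := holder_const_ge0 u_holder.
pose f x := lnd F x - alpha + u x - u (F x).
have f0 x : 0 <= f x by exact: (sub_action_ge0 chi01 rF lndF_per lndF).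
pose K1 := K + Ku + Ku * L `^ chi.
have f_holder : holder chi K1 f by exact: (coboundary_holder alpha lndF u_holder L0 (rl_lip rF)).
have f_per : per1 f.
  by move=> x k; rewrite /f lndF_per u_per (lift_addz (rl_lift rF)) u_per.
have K10 : 0 <= K1 := holder_const_ge0 f_holder.
have f_small e : 0 < e -> exists z n (M : int),
    [/\ (0 < n)%N, iter n F z = z + M%:~R & \sum_(i < n) f (iter i F z) <= n%:R * e].
  move=> /(periodic_sum_approx chi01 rF lndF_per lndF)[z [n [M [n0 hz hs]]]].
  exists z, n, M; split => //.
  have tele : \sum_(i < n) (u (iter i F z) - u (iter i.+1 F z)) = 0.
    suff -> : \sum_(i < n) (u (iter i F z) - u (iter i.+1 F z)) = u z - u (iter n F z).
      by rewrite hz u_per subrr.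
    elim: (n) => [|j IH]; first by rewrite big_ord0 subrr.
    by rewrite big_ord_recr IH /= addrA subrK.
  have -> : \sum_(i < n) f (iter i F z) = \sum_(i < n) lnd F (iter i F z) - n%:R * alpha.
    have -> : \sum_(i < n) f (iter i F z) = \sum_(i < n) (lnd F (iter i F z) - alpha)
        + \sum_(i < n) (u (iter i F z) - u (iter i.+1 F z)).
      by rewrite -big_split; apply: eq_bigr => i _; rewrite /f /=; ring.
    by rewrite tele addr0 sumrB sumr_const card_ord mulr_natl.
  by rewrite lerBlDl -mulrDr ltW.
pose e1 := Num.min eps0 (eta0 / 2).
have e10 : 0 < e1 by rewrite lt_min eps00 divr_gt0.
have Cge1 := rl_C1 rF; have lam1 := rl_lam rF.
have [eps [rho' [kappa /= [epsb epsL eps64 [rho'0 rho'1 rho'2 rho'3 kappaE]]]]] :=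
  choose_constants L1 Cge1 lam1 K10 e10.
have C0 : 0 < C := lt_le_trans ltr01 Cge1.
have eps_gt0 : 0 < eps by case/andP: epsb.
have kappa0 : 0 < kappa.
  by rewrite kappaE divr_gt0 // mulr_gt0 // exprn_gt0 // divr_gt0 // mulr_gt0.
pose k' := KF / m; have k'0 : 0 <= k' by rewrite divr_ge0 // ltW.
have kappa2 : 0 < kappa / 2 by rewrite divr_gt0.
(* Smallness conditions on [r]: [r1] is for the oscillation error in [lnd_perturbed_ge], [r2] for
   its hypothesis, [r3] for the change from [u o F] to [u o S]. Each error carries an extra positive
   power of [r], so [kappa] stays fixed. *)
have [r1 r10 hr1] := exists_small (mulr_ge0 (mulr_ge0 (ler0n R 4) (ltW eps_gt0)) k'0) kappa2.
have half0 : 0 < 1 / 2 :> R by rewrite divr_gt0.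
have [r2 r20 hr2] := exists_small k'0 half0.
have [T T0 hT] := exists_small Ku0 kappa2.
have [r3 r30 hr3] := exists_small ler01 T0.
pose r0 := Num.min (Num.min 8^-1 r1) (Num.min r2 r3).
have r00 : 0 < r0 by rewrite !lt_min r10 r20 r30 invr_gt0 ltr0n.
have [z [p [M [r [p0 hz /andP[r_gt0 rr0] sep fsum]]]]] :=
  good_orbit chi01 rF f_per f_holder f0 f_small kappa0 r00.
have [r8 rr1 rr2 rr3] : [/\ r <= 8^-1, r <= r1, r <= r2 & r <= r3].
  by move: rr0; rewrite !le_min => /andP[/andP[-> ->] /andP[-> ->]].
have {}hr1 := hr1 r; have {}hr2 := hr2 r; have {}hr3 := hr3 r.
rewrite (ltW r_gt0) rr1 in hr1; rewrite (ltW r_gt0) rr2 in hr2; rewrite (ltW r_gt0) rr3 mul1r in hr3.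
have {}hr1 := hr1 isT; have {}hr2 := hr2 isT; have {}hr3 := hr3 isT.
have r_b : 0 < r <= 8^-1 by rewrite r_gt0.
have rc0 : 0 < r `^ chi by rewrite powR_gt0.
pose e := eps * r `^ chi; pose q := kappa * r `^ chi.
have q0 : 0 < q by rewrite mulr_gt0.
pose S := perturbed chi F z r eps p.
have closeS := perturbed_close chi01 CF m0 bF p0 r_b epsb sep.
have closeS1 : close chi e1 S F by exact: close_mono closeS.
have liftS : is_lift S by exists dF => x; exact: perturbed_lift.
have C1S : C1 S := perturbed_C1 chi CF bF z p r_b epsb.
have closeS0 : close chi eta0 S F.
  apply: close_mono closeS1; rewrite ge_min; apply/orP; right; lra.
have [[dS [DS rS]] _ bS] := unif S liftS C1S closeS0.
exists S; split.
- split => //; split => //; split; last exact: (regular_expanding rS C1S.1).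
  exists (KF + e1) => x y; case: closeS1 => _ _ h3.
  rewrite -[derive1 S x](subrK (derive1 F x)) -[derive1 S y](subrK (derive1 F y)) opprD addrACA mulrDl addrC.
  by apply: le_trans (ler_normD _ _) _; apply: lerD.
- by apply: close_mono closeS1; rewrite ge_min lexx.
have mu1 := powR_gt1 chi01 lam1; have mu0 : 0 < lam `^ chi - 1 by rewrite subr_gt0.
have pR : 0 < p%:R :> R by rewrite ltr0n.
(* An error [w = q / p] per step adds up to [q] over a period; one third each goes to [lnd], to [u]
   and to the shadowing distance. *)
pose q3 := q / p%:R / 3; have q30 : 0 < q3 by rewrite !divr_gt0.
pose cth := p%:R / (lam `^ chi - 1) * C `^ chi.
have cth0 : 0 <= cth by rewrite mulr_ge0 ?powR_ge0 // divr_ge0 // ltW.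
have [t1 t10 ht1] := exists_small Ku0 q30.
have [t2 t20 ht2] := exists_small (mulr_ge0 K10 cth0) q30.
have s20 : 0 < (rho' * r / (2 * C)) `^ chi by rewrite powR_gt0 // divr_gt0 ?mulr_gt0.
have [t3 t30 ht3] := exists_small cth0 s20.
(* The radius of robustness belongs to [S], so it may depend on [p] and [r]. *)
pose eta := Num.min (Num.min (eta0 / 2) (m * q3)) (Num.min t1 (Num.min t2 t3)).
have eta_gt0 : 0 < eta by rewrite !lt_min t10 t20 t30 divr_gt0 //= mulr_gt0.
exists eta => // G [lG [CG _]] clGS.
have clGF : close chi eta0 G F.
  apply: close_mono (close_trans clGS closeS1).
  have : eta <= eta0 / 2 by rewrite !ge_min lexx.
  have : e1 <= eta0 / 2 by rewrite ge_min lexx orbT.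
  lra.
have [[dG [DG rG]] lndG bG] := unif G lG CG clGF.
have eta_r : [/\ eta <= m * q3, eta <= t1, eta <= t2 & eta <= t3].
  by split; rewrite !ge_min lexx ?orbT.
have {eta_r}[etam eta1 eta2 eta3] := eta_r.
have {}ht1 := ht1 eta; have {}ht2 := ht2 eta; have {}ht3 := ht3 eta.
rewrite (ltW eta_gt0) eta1 in ht1; rewrite (ltW eta_gt0) eta2 in ht2; rewrite (ltW eta_gt0) eta3 in ht3.
have {}ht1 := ht1 isT; have {}ht2 := ht2 isT; have {}ht3 := ht3 isT.
(* [ln (1 - e)] is the exact change of exponent along the orbit, so the analogue of [g] for [S]
   equals [f] there, see [gSf]. *)
pose al := alpha + ln (1 - e).
pose g x := lnd G x - al + u x - u (G x).
case: clGS => cGS dGS _.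
have lndGS x : `|lnd G x - lnd S x| <= q3.
  have /andP[mG _] := bG x; have /andP[mS _] := bS x.
  apply: le_trans (ln_lipschitz m0 mG mS) _; rewrite ler_pdivrMr // mulrC.
  by apply: le_trans (ler_dist_dist _ _) _; apply: le_trans (dGS x) _.
have uGS x : `|u (G x) - u (S x)| <= q3.
  apply: le_trans (holder_circ _ _ u_per u_holder) _; apply: le_trans ht1.
  by rewrite ler_wpM2l // le_powR ?circ_dist_ge0.
have uSF x : `|u (S x) - u (F x)| <= q / 2.
  apply: le_trans (u_holder _ _) _.
  (* The displacement is at most [eps * L * r ^ (1 + chi)]; its extra factor [r ^ chi] makes the
     change of [u] negligible against [r ^ chi]. *)
  have h1 : `|S x - F x| <= r `^ chi * r.
    apply: le_trans (perturbed_sub_le chi bF p0 r_b epsb sep x) _.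
    rewrite mulrA ler_pM2r // -mulrA [_ * L]mulrC mulrA ler_piMl // ltW //.
  apply: (@le_trans _ _ (Ku * ((r `^ chi) `^ chi * r `^ chi))).
    by rewrite ler_wpM2l // -powRM ?(ltW rc0) ?(ltW r_gt0) // le_powR.
  have := hT (r `^ chi); rewrite (ltW rc0) hr3 => /(_ isT) h2.
  by rewrite mulrA /q [X in _ <= X]mulrAC ler_pM2r.
have orbS (i : nat) (k : int) : (i < p)%N -> S (iter i F z + k%:~R) = F (iter i F z + k%:~R).
  by move=> ip; have := perturbed_orbit chi eps p0 r_b sep (Ordinal ip) k.
have [z' [M' [k [hz' hk]]]] : exists z' (M' : int) (k : nat -> int), iter p G z' = z' + M'%:~R /\
    forall i, (i < p)%N -> `|iter i G z' - (iter i F z + (k i)%:~R)| `^ chi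
       <= p%:R / (lam `^ chi - 1) * (C * eta) `^ chi.
  apply: (shadow_orbit rG p0 hz (ltW eta_gt0) cGS) => i ip.
  by have := orbS i 0 ip; rewrite addr0.
have {}hk i : (i < p)%N -> `|iter i G z' - (iter i F z + (k i)%:~R)| `^ chi <= cth * eta `^ chi.
  by move=> /hk; rewrite powRM ?(ltW C0) ?(ltW eta_gt0) // mulrA.
pose w := q / p%:R.
have w3 : w = q3 + q3 + q3 by rewrite /w /q3; field; rewrite gt_eqF.
have wq : w <= q by rewrite /w ler_pdivrMr // ler_peMr ?(ltW q0) // ler1n.
have q3w : q3 + q3 <= q by apply: le_trans wq; rewrite w3 lerDl ltW.
have gh : holder chi K1 g by exact: (coboundary_holder al lndG u_holder L0 (rl_lip rG)).
have gSf (i : nat) (l : int) : (i < p)%N ->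
    lnd S (iter i F z + l%:~R) - al + u (iter i F z + l%:~R) - u (S (iter i F z + l%:~R)) = f (iter i F z).
  move=> ip; rewrite orbS // (lift_addz (rl_lift rF)) !u_per.
  rewrite /lnd (derive1_perturbed_orbit chi liftF CF eps p0 r_b sep (Ordinal ip) l) /=.
  have e2 : 0 < 1 - e.
    have : e <= eps by apply: ler_piMr; [exact: ltW|]; apply: le_trans (le_powR chi01 (ltW r_gt0) (_ : r <= 1)) _; [lra|rewrite powR1].
    by case/andP: epsb => _; lra.
  have /andP[mF _] := bF (iter i F z).
  rewrite normrM (gtr0_norm e2) lnM ?posrE //; last exact: lt_le_trans m0 mF.
  by rewrite /f /al /lnd; ring.
refine (lock_of_shadow (al := al) (r := r) (eps := eps) (rho := (L + 1)^-1) (rho' := rho') (kappa := kappa)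
  (w := w) (y := fun i => iter i F z) (fy := fun i => f (iter i F z)) (k := k)
  chi01 rG L1 lndG u_per u_holder r_b eps_gt0 erefl rho'0 rho'1 rho'2 rho'3 kappaE p0 hz' _ sep _ _ _ (fun i => f0 _) fsum _).
- move=> i ip; apply: powR_le_inv => //; first by rewrite divr_ge0 // mulr_ge0 // ltW.
  exact: le_trans (hk i ip) ht3.
- by apply: divr_ge0; rewrite ltW.
- by rewrite /w mulrCA divff ?mulr1 // gt_eqF.
- move=> i ip; rewrite -/(g (iter i G z')) -(gSf i (k i) ip).
  set Y := iter i F z + _.
  have a1 : `|g (iter i G z') - g Y| <= q3.
    apply: le_trans (gh _ _) _; apply: le_trans ht2; rewrite -mulrA ler_wpM2l //; exact: hk.
  have a2 := lndGS Y; have a3 := uGS Y.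
  have -> : g (iter i G z') - (lnd S Y - al + u Y - u (S Y)) =
    (g (iter i G z') - g Y) + (lnd G Y - lnd S Y) - (u (G Y) - u (S Y)) by rewrite {3}/g; ring.
  rewrite w3; apply: le_trans (ler_normB _ _) _; apply: lerD => //.
  by apply: le_trans (ler_normD _ _) _; apply: lerD.
- move=> x t t01 ht.
(* The loss of [2 * q] is made up of [q / 2] for the oscillation, [q / 2] for [u o S] against
   [u o F], and [2 * q3 <= q] for [G] against [S]. *)
have b1 := lnd_perturbed_ge chi01 CF m0 bF KF0 hKF p0 r_b epsb sep t01 hr2 (fun i l => ht i l (ltn_ord i)).
have b2 : 4 * e * (KF / m * r `^ chi) <= q / 2.
  have -> : 4 * e * (KF / m * r `^ chi) = (4 * eps * k' * r `^ chi) * r `^ chi by rewrite /e /k'; ring.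
  by rewrite /q [X in _ <= X]mulrAC ler_pM2r.
have b3 := f0 x.
have := lndGS x; have := uGS x; have := uSF x; rewrite !ler_norml => /andP[_ b4] /andP[_ b5] /andP[b6 _].
rewrite -/q -/e; move: b1 b2 b3 b4 b5 b6 q3w; rewrite -/S -/e /f /al.
set X1 := 4 * e * _; set X2 := e * t ^+ 2 / 2; lra.
Qed.

End RobustLocking.

(** * Invariant measures *)


Section CircleMeasures.
Variable R : realType.
Implicit Types (P : probability R R) (psi : R -> R) (M B : R).

Lemma measurable_frac : measurable_fun [set: R] (@frac R).
Proof.
apply: measurable_funB; first exact: measurable_id.
apply: nondecreasing_measurable => // x y xy.
by rewrite ler_int le_floor.
Qed.

Lemma bounded_integrable P psi M : measurable_fun [set: R] psi -> (forall x, `|psi x| <= M) ->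
  P.-integrable [set: R] (EFin \o psi).
Proof.
move=> mpsi hM; apply: measurable_bounded_integrable => //.
  by rewrite [ltLHS](probability_setT P) ltry.
exists M; split; first exact: num_real.
by move=> y My x _ /=; apply: le_trans (ltW My).
Qed.

Lemma Rintegral_indic_prob P (A : set R) : measurable A ->
  \int[P]_x (\1_A x : R) = fine (P A).
Proof. by move=> mA; rewrite /Rintegral integral_indic // setIT. Qed.

Section Invariant.
Variables (G : R -> R) (P : probability R R).
Hypotheses (mT : measurable_fun [set: R] (tmap G)) (invP : invariant G P).
Let T := tmap G.

Lemma measurable_iter n : measurable_fun [set: R] (iter n T).
Proof.
elim: n => [|n IH]; first exact: measurable_id.
by apply: (measurableT_comp mT IH).
Qed.

Lemma invariant_Rintegral psi M : measurable_fun [set: R] psi -> (forall x, `|psi x| <= M) ->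
  \int[P]_x psi (T x) = \int[P]_x psi x.
Proof.
move=> mpsi hM; rewrite /Rintegral; congr fine.
have mE : measurable_fun [set: R] (EFin \o psi) by exact/measurable_EFinP.
have iE : P.-integrable (T @^-1` setT) ((EFin \o psi) \o T).
  rewrite preimage_setT; apply: (@bounded_integrable P (psi \o T) M _ (fun x => hM _)).
  exact: measurableT_comp.
have := integral_pushforward mT mE iE measurableT; rewrite preimage_setT => <-.
apply: eq_measure_integral => A mA _.
exact: invP.2.
Qed.

Lemma invariant_iter n (A : set R) : measurable A -> P (iter n T @^-1` A) = P A.
Proof.
elim: n A => [|n IH] A mA //.
have -> : iter n.+1 T @^-1` A = iter n T @^-1` (T @^-1` A) by [].
rewrite IH; first exact: invP.2.
by rewrite -[X in measurable X]setTI; exact: mT.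
Qed.

Lemma Birkhoff_sum_integrable psi M n : measurable_fun [set: R] psi -> (forall x, `|psi x| <= M) ->
  P.-integrable [set: R] (EFin \o (fun x => \sum_(i < n) psi (iter i T x))).
Proof.
move=> mpsi hM; apply: (@bounded_integrable P _ (M *+ n)).
  apply: measurable_sum => i; apply: measurableT_comp => //; exact: measurable_iter.
move=> x; apply: le_trans (ler_norm_sum _ _ _) _.
rewrite -[X in _ <= _ *+ X](card_ord n) -sumr_const; exact: ler_sum.
Qed.

Lemma invariant_Birkhoff psi M n : measurable_fun [set: R] psi -> (forall x, `|psi x| <= M) ->
  \int[P]_x (\sum_(i < n) psi (iter i T x)) = n%:R * \int[P]_x psi x.
Proof.
move=> mpsi hM; elim: n => [|n IH].
  under eq_Rintegral do rewrite big_ord0.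
  by rewrite Rintegral_cst // !mul0r.
under eq_Rintegral do rewrite big_ord_recr.
rewrite RintegralD //; last 2 first.
- exact: Birkhoff_sum_integrable mpsi hM.
- apply: (@bounded_integrable P (psi \o iter n T) M _ (fun x => hM _)).
  apply: measurableT_comp => //; exact: measurable_iter.
rewrite IH -natr1 mulrDl mul1r; congr (_ + _).
elim: n {IH} => // n <-.
have mn : measurable_fun [set: R] (psi \o iter n T).
  by apply: measurableT_comp => //; exact: measurable_iter.
rewrite -[RHS](invariant_Rintegral mn (fun x => hM _)).
by apply: eq_Rintegral => x _; rewrite iterSr.
Qed.

(** By invariance the [n]-th sum has integral [n] times that of [psi], and a negative multiple of
    [n] would drop below any bound. *)
Lemma Birkhoff_bounded_below psi M B : measurable_fun [set: R] psi -> (forall x, `|psi x| <= M) ->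
  (forall n x, - B <= \sum_(i < n) psi (iter i T x)) -> 0 <= \int[P]_x psi x.
Proof.
move=> mpsi hM hB; rewrite leNgt; apply/negP => neg.
pose n := (Num.trunc (`|B| / - \int[P]_x psi x)).+1.
set I := \int[P]_x psi x in neg n *.
have : `|B| / - I < n%:R by exact: truncnS_gt.
rewrite ltr_pdivrMr ?oppr_gt0 // mulrN ltrNr -(invariant_Birkhoff n mpsi hM).
apply/negP; rewrite -leNgt.
have -> : - `|B| = \int[P]_x (- `|B|).
  by rewrite Rintegral_cst // [X in fine X](probability_setT P) /= mulr1.
apply: le_Rintegral => //.
- apply: (@bounded_integrable P (cst (- `|B|)) `|B|) => // x.
  by rewrite normrN normr_id.
- exact: Birkhoff_sum_integrable mpsi hM.
by move=> x _; apply: le_trans (hB n x); rewrite lerN2 ler_norm.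
Qed.

Variables (x0 : R) (p : nat).
Hypotheses (hx0 : iter p T x0 = x0).

Definition orbit_set := [set iter k T x0 | k in [set k : nat | (k < p)%N]].

Lemma measurable_orbit_set : measurable orbit_set.
Proof.
have -> : orbit_set = \bigcup_(k in [set k : nat | (k < p)%N]) [set iter k T x0].
  apply/seteqP; split=> x.
    by move=> [k kp <-]; exists k.
  by move=> [k kp ->]; exists k.
by apply: bigcup_measurable => k _; exact: measurable_set1.
Qed.

Lemma cyclic_orbit_sum (h : R -> R) k :
  \sum_(i < p) h (iter i T (iter k T x0)) = \sum_(i < p) h (iter i T x0).
Proof.
elim: k => // k <-; apply: (addIr (h (iter k T x0))).
rewrite [LHS]addrC.
have e : h (iter k T x0) = h (iter p T (iter k T x0)) by rewrite -iterD addnC iterD hx0.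
rewrite [in RHS]e -(big_ord_recr p (fun i => h (iter i T (iter k T x0)))) big_ord_recl.
by congr (_ + _); apply: eq_bigr => i _; rewrite [iter k.+1 T x0]iterS -iterSr.
Qed.

(** On the orbit, which has full measure, the sum over one period is constant. Applied to indicators
    this determines [P]. *)
Lemma orbit_average psi M : measurable_fun [set: R] psi -> (forall x, `|psi x| <= M) ->
  P orbit_set = 1%E -> p%:R * \int[P]_x psi x = \sum_(i < p) psi (iter i T x0).
Proof.
move=> mpsi hM PO; rewrite -(invariant_Birkhoff p mpsi hM).
have -> : \sum_(i < p) psi (iter i T x0) = \int[P]_x (\sum_(i < p) psi (iter i T x0)).
  by rewrite Rintegral_cst // [X in fine X](probability_setT P) /= mulr1.
rewrite /Rintegral; congr fine; apply: ae_eq_integral => //.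
- by have /integrableP[] := Birkhoff_sum_integrable p mpsi hM.
- exists (~` orbit_set); split; first exact: measurableC measurable_orbit_set.
    by rewrite [LHS]probability_setC ?PO ?subee //; exact: measurable_orbit_set.
move=> x /= nx Ox; apply: nx => _; case: Ox => k kp <-.
by rewrite cyclic_orbit_sum.
Qed.

End Invariant.

Section OrbitMeasure.
Variables (G : R -> R) (x0 : R) (p : nat).
Let T := tmap G.
Hypotheses (p0 : (0 < p)%N) (hx0 : iter p T x0 = x0).

(** Points are counted with multiplicity, so [p] may be any multiple of the least period. *)
Definition orbit_counting : measure R R := msum (fun i => dirac (iter i T x0) : measure R R) p.

Definition orbit_measure : probability R R :=
  mnormalize orbit_counting (dirac x0 : probability R R).

Lemma orbit_countingE (A : set R) : orbit_counting A = (\sum_(i < p) (\1_A (iter i T x0) : R))%:E.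
Proof. by rewrite /= /msum -sumEFin. Qed.

Lemma orbit_measureE (A : set R) :
  orbit_measure A = ((\sum_(i < p) (\1_A (iter i T x0) : R)) / p%:R)%:E.
Proof.
have pp : (p%:R : R) != 0 by rewrite pnatr_eq0 -lt0n.
have -> : orbit_measure A = mnormalize orbit_counting (dirac x0 : probability R R) A by [].
rewrite /mnormalize orbit_countingE.
have -> : \sum_(i < p) (\1_[set: R] (iter i T x0) : R) = p%:R.
  under eq_bigr => i _ do rewrite indicE in_setT.
  by rewrite sumr_const card_ord.
rewrite ifF; last by rewrite eqe (negbTE pp).
by rewrite orbit_countingE -EFinM.
Qed.

Lemma orbit_measure_invariant : (forall i, 0 <= iter i T x0 < 1) -> invariant G orbit_measure.
Proof.
move=> h01; split.
  rewrite orbit_measureE; congr (_%:E).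
  under eq_bigr => i _ do rewrite indicE mem_set ?h01 //= ?in_itv /= ?h01 //.
  by rewrite sumr_const card_ord divff // pnatr_eq0 -lt0n.
move=> A mA; rewrite !orbit_measureE; congr (_ / _)%:E.
have := cyclic_orbit_sum hx0 (fun x => \1_A x : R) 1; rewrite -[RHS]/(\sum_(i < p) _) => <-.
apply: eq_bigr => i _; rewrite [iter 1 T x0]/= -iterSr !indicE.
by congr (_%:R); congr nat_of_bool; apply/idP/idP; rewrite !inE.
Qed.

Lemma orbit_measure_orbit : orbit_measure (orbit_set G x0 p) = 1%E.
Proof.
rewrite orbit_measureE; congr (_%:E).
have h1 (i : 'I_p) : \1_(orbit_set G x0 p) (iter i T x0) = 1 :> R.
  by rewrite indicE mem_set //; exists i => //=.
under eq_bigr => i _ do rewrite h1.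
by rewrite sumr_const card_ord divff // pnatr_eq0 -lt0n.
Qed.

End OrbitMeasure.
End CircleMeasures.


(** * Minimizing measures of locked maps *)

Section LockedMeasures.
Variables (R : realType) (chi : R).
Hypothesis chi01 : 0 < chi <= 1.
Variable G : R -> R.
Hypotheses (EG : E1chi chi G).
Variables (z : R) (p : nat) (M : int) (beta c0 B s : R).
Let O := lifted_orbit G z.
Hypotheses (p0 : (0 < p)%N) (hz : iter p G z = z + M%:~R)
  (orbit_beta : \sum_(i < p) lnd G (iter i G z) = p%:R * beta) (c00 : 0 < c0)
  (below : forall n x, - B <= \sum_(i < n) (lnd G (iter i G x) - beta - c0 * (`[< far O s (iter i G x) >])%:R))
  (never_far : forall x, (forall i, ~ far O s (iter i G x)) -> O x).
Let T := tmap G.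
Let x0 := frac z.
Let lG : is_lift G. Proof. by case: EG. Qed.

Let G_continuous : continuous G.
Proof.
move=> x; have [_ [[dG _] _]] := EG.
by apply: differentiable_continuous; apply/derivable1_diffP; exact: dG.
Qed.

Let mT : measurable_fun [set: R] T.
Proof.
apply: (measurableT_comp (@measurable_frac R)).
exact: continuous_measurable_fun.
Qed.

Let tmap_frac y : T (frac y) = frac (G y).
Proof.
have [d liftG] := lG; have [k ->] := frac_ex y.
by rewrite /T /tmap (lift_addz liftG) frac_addz.
Qed.

Let iter_frac n y : iter n T (frac y) = frac (iter n G y).
Proof. by elim: n => //= n ->; exact: tmap_frac. Qed.

Let hx0 : iter p T x0 = x0.
Proof. by rewrite /x0 iter_frac hz frac_addz. Qed.

Let x01 i : 0 <= iter i T x0 < 1.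
Proof. by rewrite /x0 iter_frac frac_ge0 frac_lt1. Qed.

Let iter_tmap n x : exists k : int, iter n T x = iter n G x + k%:~R.
Proof.
have [d liftG] := lG; elim: n => [|n [k IH]]; first by exists 0; rewrite addr0.
have [l hl] := frac_ex (G (iter n T x)).
exists (d * k + l); rewrite /= {1}/T /tmap hl IH (lift_addz liftG) intrD; ring.
Qed.

Let far_addz x (k : int) : far O s (x + k%:~R) <-> far O s x.
Proof.
have w y (l : int) : far O s y -> far O s (y + l%:~R).
  move=> f a Oa; have := f _ (lifted_orbit_addz (- l) Oa).
  by congr (_ < `|_|); rewrite intrN; ring.
by split; [move=> /(w _ (- k)); rewrite intrN addrK|exact: w].
Qed.

Let farset := [set x | far O s x].

(** A countable intersection of open conditions over times and integer translates, the latter listed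
    as [m] and [- m]. *)
Let measurable_far : measurable farset.
Proof.
have -> : farset = \bigcap_n \bigcap_m
   ([set x | s < `|x - (iter n G z + m%:R)|] `&` [set x | s < `|x - (iter n G z - m%:R)|]).
  apply/seteqP; split => x /=.
    move=> fx n _ m _; split; apply: fx; exists n.
      by exists (m : int).
    by exists (- (m : int)); rewrite intrN.
  move=> h a [n [[m|m] ->]]; first by have [] := h n I m I.
  by have [_] := h n I m.+1 I; rewrite NegzE intrN.
apply: bigcapT_measurable => n; apply: bigcapT_measurable => m.
have mop c : measurable [set x : R | s < `|x - c|].
  have mf : measurable_fun [set: R] (fun x => `|x - c|).
    apply: (measurableT_comp (@normr_measurable R setT)).
    by apply: measurable_funB.
  have := mf measurableT _ (measurable_itv `]s, +oo[); rewrite setTI.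
  by congr measurable; apply/seteqP; split => x /=; rewrite in_itv /= andbT.
by apply: measurableI.
Qed.

Let lnd_per : per1 (lnd G) := lnd_per1 lG.

Let lnd_bounded : exists2 Mb : R, 0 <= Mb & forall x, `|lnd G x| <= Mb.
Proof.
have [L [C [lam [K [m [eta0 [eta00 L1 m0 K0 unif]]]]]]] := uniform_regularity chi01 EG.
have [_ [CG _]] := EG.
have [_ hK _] := unif G lG CG (close_refl chi G (ltW eta00)).
exists (`|lnd G 0| + K); first by rewrite addr_ge0.
by move=> x; exact: (per1_holder_bounded chi01 lnd_per hK x).
Qed.

Let lnd_measurable : measurable_fun [set: R] (lnd G).
Proof.
have [_ [[_ cG] _]] := EG.
apply: (measurableT_comp (@measurable_ln R)).
apply: (measurableT_comp (@normr_measurable R setT)).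
exact: continuous_measurable_fun.
Qed.

Let lyapE (P : probability R R) : lyap G P = (\int[P]_x lnd G x)%:E.
Proof.
have [Mb _ hM] := lnd_bounded.
rewrite /lyap /Rintegral fineK //; apply: integrable_fin_num => //.
exact: (bounded_integrable P lnd_measurable hM).
Qed.

(** Iterates of [T] and [G] differ by integers and the integrand is 1-periodic, so the lower bound
    of locking can be integrated. For a measure of exponent [beta] it leaves no room for the far
    set. *)
Let far_integral_le (P : probability R R) : invariant G P ->
  beta + c0 * fine (P farset) <= \int[P]_x lnd G x.
Proof.
move=> invP; have [Mb Mb0 hM] := lnd_bounded.
pose psi x := (lnd G x - beta) - c0 * \1_farset x.
have mind : measurable_fun [set: R] (\1_farset : R -> R) by exact: measurable_indic.
have m1 : measurable_fun [set: R] (fun x => lnd G x - beta) by apply: measurable_funB.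
have m2 : measurable_fun [set: R] (fun x => c0 * \1_farset x : R) by apply: measurable_funM.
have ind_le x : `|\1_farset x : R| <= 1.
  by rewrite indicE; case: (x \in farset); rewrite ?normr1 ?normr0.
have b1 x : `|lnd G x - beta| <= Mb + `|beta|.
  by apply: le_trans (ler_normB _ _) _; rewrite lerD2r.
have b2 x : `|c0 * \1_farset x| <= c0.
  by rewrite normrM (gtr0_norm c00) ler_piMr // ltW.
have mpsi : measurable_fun [set: R] psi by apply: measurable_funB.
have bpsi x : `|psi x| <= Mb + `|beta| + c0.
  by apply: le_trans (ler_normB _ _) _; apply: lerD.
have : 0 <= \int[P]_x psi x.
  apply: (Birkhoff_bounded_below mT invP (B := B) mpsi bpsi) => n x.
  apply: le_trans (below n x) _; rewrite le_eqVlt; apply/orP; left; apply/eqP.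
  apply: eq_bigr => i _; have [k ->] := iter_tmap i x.
  rewrite /psi lnd_per indicE; congr (_ - _ * (nat_of_bool _)%:R).
  apply/asboolP/idP => [h|]; rewrite inE; last by move=> /far_addz.
  exact/far_addz.
have i1 := bounded_integrable P m1 b1; have i2 := bounded_integrable P m2 b2.
have i3 := bounded_integrable P lnd_measurable hM.
have i4 : P.-integrable [set: R] (EFin \o (cst beta)) by apply: (@bounded_integrable _ P (cst beta) `|beta|).
have i5 : P.-integrable [set: R] (EFin \o (\1_farset : R -> R)) by exact: (@bounded_integrable _ P _ 1).
rewrite /psi RintegralB // RintegralB // RintegralZl // Rintegral_cst //.
rewrite [X in fine X](probability_setT P) /= mulr1 Rintegral_indic_prob //; lra.
Qed.

Let P0 := orbit_measure G x0 p.

Let P0_inv : invariant G P0.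
Proof. exact: orbit_measure_invariant. Qed.

Let orbit_integral (P : probability R R) : invariant G P -> P (orbit_set G x0 p) = 1%E ->
  \int[P]_x lnd G x = beta.
Proof.
move=> invP PO; have [Mb _ hM] := lnd_bounded.
have pp : (p%:R : R) != 0 by rewrite pnatr_eq0 -lt0n.
apply: (mulfI pp); rewrite (orbit_average mT invP hx0 lnd_measurable hM PO) -orbit_beta.
apply: eq_bigr => i _; rewrite -/T /x0 iter_frac.
by have [k ->] := frac_ex (iter i G z); rewrite lnd_per.
Qed.

Let alphaE : alpha G = beta%:E.
Proof.
apply/eqP; rewrite eq_le; apply/andP; split.
  apply: ereal_inf_lbound; exists P0; first exact: P0_inv.
  by rewrite lyapE orbit_integral //; exact: orbit_measure_orbit.
apply: le_ereal_inf_tmp => _ [P invP <-]; rewrite lyapE lee_fin.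
apply: le_trans (far_integral_le invP); rewrite lerDl mulr_ge0 ?(ltW c00) //.
exact: fine_ge0.
Qed.

(** The far set is null, and by invariance so is the set of points that ever visit it; every other
    point of [[0, 1)] belongs to the orbit. *)
Let minimizing_orbit (P : probability R R) : lyap_minimizing G P -> P (orbit_set G x0 p) = 1%E.
Proof.
move=> [invP]; rewrite lyapE alphaE => -[intP].
have mO := measurable_orbit_set G x0 p.
have far0 : P farset = 0%E.
  have := far_integral_le invP; rewrite intP gerDl pmulr_rle0 // => h.
  have : (0 <= P farset)%E by [].
  rewrite -[P farset]fineK ?fin_num_measure // lee_fin => h'.
  by congr (_%:E); apply/eqP; rewrite eq_le h h'.
have neg : P.-negligible (~` orbit_set G x0 p).
  apply: (@negligibleS _ _ _ _ ((\bigcup_i (iter i T @^-1` farset)) `|` ~` [set` `[0%R, 1%R[])).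
    move=> x nO; apply: contrapT => /not_orP[h1 /contrapT h2]; apply: nO.
    have Ox : O x.
      apply: never_far => i fi; apply: h1; exists i => //=.
      by have [k ->] := iter_tmap i x; apply/far_addz.
    have [d liftG] := lG.
    have [i [k [ip xE]]] := lifted_orbit_lt liftG p0 hz Ox.
    exists i => //; rewrite -/T /x0 iter_frac -(frac_addz _ k) -xE frac_id //.
  apply: negligibleU.
    apply: negligible_bigcup => i; apply/negligibleP.
      by rewrite -[X in measurable X]setTI; exact: (measurable_iter mT i).
    exact: etrans (invariant_iter mT invP i measurable_far) far0.
  apply/negligibleP; first exact: measurableC.
  rewrite [LHS]probability_setC //; have [-> _] := invP; by rewrite subee.
have := measure_negligible (measurableC mO) neg.
rewrite [LHS in LHS = _ -> _]probability_setC // => h.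
have hf : P (orbit_set G x0 p) \is a fin_num by exact: fin_num_measure.
by move: h; rewrite -(fineK hf) -EFinB => -[] /eqP; rewrite subr_eq0 => /eqP <-.
Qed.

Lemma locked_measures :
  (exists P : probability R R, lyap_minimizing G P) /\
  (forall P Q : probability R R, lyap_minimizing G P -> lyap_minimizing G Q ->
     forall A : set R, measurable A -> P A = Q A) /\
  (forall P : probability R R, lyap_minimizing G P -> supported_on_periodic_orbit G P).
Proof.
split; [|split].
- exists P0; split; first exact: P0_inv.
  by rewrite lyapE alphaE orbit_integral //; exact: orbit_measure_orbit.
(* Uniqueness: the measure of [A] is the orbit average of its indicator. *)
- have key (P : probability R R) (A : set R) : lyap_minimizing G P -> measurable A ->
      p%:R * fine (P A) = \sum_(i < p) (\1_A (iter i T x0) : R).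
    move=> mP mA; rewrite -Rintegral_indic_prob //.
    apply: (@orbit_average R G P mT mP.1 x0 p hx0 (\1_A : R -> R) 1) => //.
    - by move=> x; rewrite indicE; case: (x \in A); rewrite ?normr1 ?normr0.
    - exact: minimizing_orbit.
  move=> P Q mP mQ A mA; have pp : (p%:R : R) != 0 by rewrite pnatr_eq0 -lt0n.
  rewrite -[P A]fineK ?fin_num_measure // -[Q A]fineK ?fin_num_measure //.
  by congr (_%:E); apply: (mulfI pp); rewrite !key.
by move=> P mP; exists x0, p; split => //; split => //; exact: minimizing_orbit.
Qed.

End LockedMeasures.

Theorem theoremC (R : realType) (chi : R) (hchi : 0 < chi <= 1) :
  exists U : set (R -> R),
    U `<=` E1chi chi /\ C1chi_open chi U /\ C1chi_dense chi U /\
    forall F, U F ->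
      (exists P : probability R R, lyap_minimizing F P) /\
      (forall P Q : probability R R, lyap_minimizing F P -> lyap_minimizing F Q ->
         forall A : set R, measurable A -> P A = Q A) /\
      (forall P : probability R R, lyap_minimizing F P ->
         supported_on_periodic_orbit F P).
Proof.
(* Locking is required on a whole neighbourhood of [S], which makes the set open by construction;
   density is [robust_locking]. *)
exists [set S | E1chi chi S /\ exists2 eta, 0 < eta &
  forall G, E1chi chi G -> close chi eta G S -> locked G].
split; [by move=> S []|split; [|split]].
- move=> S [ES [eta eta0 hS]]; exists (eta / 2); first by rewrite divr_gt0.
  move=> G EG /(dC1chi_close EG.1 ES.1) GS; split => //.
  exists (eta / 2); first by rewrite divr_gt0.
  move=> H EH HG; apply: hS => //; rewrite [eta]splitr; exact: close_trans HG GS.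
- move=> F EF eps eps0.
  (* Each of the three suprema is at most [eps / 4], and [3 * eps / 4 < eps]. *)
  have [S [ES SF hS]] := robust_locking hchi EF (divr_gt0 eps0 (ltr0n _ 4)).
  exists S; split => //; apply: le_lt_trans (close_dC1chi SF) _.
  by rewrite lte_fin; lra.
move=> F [EF [eta eta0 hF]].
have [z [p [M [beta [c0 [B [s [[p0 hz] hb c00 hB hO]]]]]]]] := hF F EF (close_refl chi F (ltW eta0)).
exact: (locked_measures hchi EF p0 hz hb c00 hB hO).
Qed.
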